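(* Let $m\ge2$ and let $N$ be an $(m+1)$-dimensional manifold. Every lightlike extension vector bundle over $N$ is isomorphic to the standard tractor bundle $(\mathcal T,\mathbf h,\nabla^{\mathcal T},\xi)$ of a lightlike Cartan geometry $(p:\mathcal P\to N,\omega)$, and this lightlike Cartan geometry is unique up to isomorphism covering $\mathrm{id}_N$.
   Context: Conventions. Manifolds are smooth, Hausdorff, connected, second countable. $\mathbb L^{m+2}$ is $\mathbb R^{m+2}$ with its Lorentzian inner product $\langle\,,\rangle$ of signature $(m+1,1)$ and a fixed basis $(\ell,e_1,\dots,e_m,n)$ with $\ell$ in the future lightlike cone, $\langle \ell,n\rangle=1$, $\langle e_i,e_j\rangle=\delta_{ij}$ and all other products of basis vectors zero. $G=O^+(m+1,1)$ is the group of linear isometries of $\mathbb L^{m+2}$ preserving the future lightlike cone, $H\subset G$ is the isotropy subgroup of $\ell$, with Lie algebras $\mathfrak h\subset\mathfrak g$. A lightlike Cartan geometry on $N$ is a principal bundle $p:\mathcal P\to N$ with structure group $H$ and $\omega\in\Omega^1(\mathcal P,\mathfrak g)$ such that each $\omega(u):T_u\mathcal P\to\mathfrak g$ is a linear isomorphism, $(r^h)^*\omega=\mathrm{Ad}(h^{-1})\circ\omega$ for $h\in H$, and $\omega(\zeta_X)=X$ for the fundamental vector field $\zeta_X$ of each $X\in\mathfrak h$. An isomorphism of two such geometries is a principal bundle isomorphism pulling back one Cartan connection to the other. Its standard tractor bundle is $\mathcal T=\mathcal P\times_H\mathbb L^{m+2}$ with metric $\mathbf h([u,v_1],[u,v_2])=\langle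 v_1,v_2\rangle$, the $\mathbf h$-metric connection $\nabla^{\mathcal T}$ induced by the unique principal connection on $\mathcal P\times_HG$ restricting to $\omega$ on $\mathcal P$ (locally $\nabla^{\mathcal T}_W[s,f]=[s,W(f)+\omega(Ts\cdot W)f]$ for a local section $s$ of $\mathcal P$ and an $\mathbb L^{m+2}$-valued function $f$), and the section $\xi_x=[u,\ell]$, $p(u)=x$. A lightlike extension vector bundle over $N$ is a quadruple $(\mathcal V,\mathbf g,\nabla^{\mathcal V},\eta)$: a real vector bundle $\mathcal V\to N$ of rank $m+2$ with a bundle metric $\mathbf g$ of Lorentzian signature, a linear connection $\nabla^{\mathcal V}$ with $\nabla^{\mathcal V}\mathbf g=0$, and a lightlike section $\eta\in\Gamma(\mathcal V)$ such that $w\mapsto\nabla^{\mathcal V}_w\eta$ is a monomorphism of vector bundles $TN\to\mathcal V$ over $N$. Isomorphisms of such quadruples are vector bundle isomorphisms over $\mathrm{id}_N$ preserving metric, connection and distinguished section. *)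

(* Defs.v *)
From HB Require Import structures.
From mathcomp Require Import all_boot all_order all_algebra.
From mathcomp Require Import perm generic_quotient.
From mathcomp Require Import all_classical all_reals all_analysis.

Set Implicit Arguments.
Unset Strict Implicit.
Unset Printing Implicit Defensive.

Import Order.TTheory GRing.Theory Num.Theory.
Import numFieldNormedType.Exports.
Local Open Scope classical_set_scope.
Local Open Scope quotient_scope.
Local Open Scope ring_scope.

Section Smooth.
Context {R : realType} {E F : normedModType R}.

(* [f] is of class C^k on the open set [U].  In finite dimension, f is C^(k+1)
   iff it is differentiable and each x |-> Df(x)v is C^k. *)
Fixpoint Ck (k : nat) (U : set E) (f : E -> F) : Prop :=
  if k is k'.+1 then
    (forall x, U x -> differentiable f x) /\
    (forall v, Ck k' U (fun x => 'd f x v))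
  else forall x, U x -> {for x, continuous f}.

Definition smooth_near (f : E -> F) (x : E) : Prop :=
  exists2 U : set E, open_nbhs x U & forall k, Ck k U f.

End Smooth.

(* A smooth atlas in which every point [x] has a designated chart [chart x],
   defined on [chart_dom x]; any atlas contains one of this form defining the
   same smooth structure.  The chart designated at [x] identifies the tangent space
   at [x] with the model space [E]: a tangent vector at [x] is an element of [E],
   its coordinates in [chart x]. *)
Record manifold (R : realType) (E : normedModType R) := Manifold {
  mpoint :> topologicalType;
  chart_dom : mpoint -> set mpoint;
  chart : mpoint -> mpoint -> E;
  chart_inv : mpoint -> E -> mpoint;
  manifold_hausdorff : hausdorff_space mpoint;
  manifold_second_countable : @second_countable mpoint;
  chart_dom_refl : forall x, chart_dom x x;
  chart_dom_open : forall x, open (chart_dom x);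
  chart_open : forall x, open (chart x @` chart_dom x);
  chartK : forall x y, chart_dom x y -> chart_inv x (chart x y) = y;
  chart_continuous : forall x y, chart_dom x y -> {for y, continuous (chart x)};
  chart_inv_continuous : forall x e, (chart x @` chart_dom x) e ->
    {for e, continuous (chart_inv x)};
  chart_smooth : forall x y z, chart_dom x z -> chart_dom y z ->
    smooth_near (chart y \o chart_inv x) (chart x z) }.

Definition tangent (R : realType) (E : normedModType R) (M : manifold E)
  of mpoint M : normedModType R := E.
Arguments tangent {R E M} x.

Section SmoothMaps.
Context {R : realType} {E E' : normedModType R}.
Variables (M : manifold E) (M' : manifold E').

Definition smooth_fun_at (F : normedModType R) (f : M -> F) (x : M) : Prop :=
  smooth_near (f \o chart_inv x) (chart x x).

Definition fun_deriv (F : normedModType R) (f : M -> F) (x : M)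
    (w : tangent x) : F :=
  'd (f \o chart_inv x) (chart x x) w.

Definition smooth_map_at (f : M -> M') (x : M) : Prop :=
  {for x, continuous f} /\
  smooth_near (chart (f x) \o f \o chart_inv x) (chart x x).

Definition tangent_map (f : M -> M') (x : M) (w : tangent x) : tangent (f x) :=
  'd (chart (f x) \o f \o chart_inv x) (chart x x) w.

(* Smoothness at (x, a) of a map M x A -> M', for a subset A of a normed space:
   as usual for maps on a subset, it asks for a smooth local extension [g] to
   an open set.  For A an embedded submanifold this is smoothness on the
   product manifold. *)
Definition smooth_map2_at (F : normedModType R) (A : set F) (f : M -> F -> M')
    (x : M) (a : F) : Prop :=
  exists2 g : E * F -> E', smooth_near g (chart x x, a) &
    \forall z \near (x, a), A z.2 ->
      chart_dom (f x a) (f z.1 z.2) /\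
      chart (f x a) (f z.1 z.2) = g (chart x z.1, z.2).

(* The coordinate vector field, with constant coordinates [v], of the chart
   designated at [x0]. *)
Definition coord_field (x0 : M) (v : E) (x : M) : tangent x :=
  'd (chart x \o chart_inv x0) (chart x0 x) v.

End SmoothMaps.

(* A one-form with values in the normed space [F], linear at each point. *)
Definition smooth_form (R : realType) (E F : normedModType R) (M : manifold E)
    (omega : forall x : M, {linear tangent x -> F}) : Prop :=
  forall (x0 : M) (v : E),
    smooth_fun_at (fun x => omega x (coord_field x0 v x)) x0.

Section Lorentz.
Variables (R : realType) (m : nat).

(* Coordinates in the basis (l, e_1, .., e_m, n): index 0 is l, index m+1 is n.
   The Gram matrix exchanges the two extreme indices. *)
Definition lorentz (v w : 'cV[R]_m.+2) : R :=
  (v^T *m tperm_mx ord0 ord_max *m w) 0 0.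

Definition ell : 'cV[R]_m.+2 := delta_mx ord0 0.
Definition enn : 'cV[R]_m.+2 := delta_mx ord_max 0.

(* Two causal vectors that are not proportional lie in the same half of the
   causal cone iff their product is negative; [ell - enn] is timelike and its
   product with [ell] is -1, so that [ell] is future-directed. *)
Definition future_cone : set 'cV[R]_m.+2 :=
  [set v | [/\ v != 0, lorentz v v = 0 & lorentz v (ell - enn) < 0]].

(* O^+(m+1,1), acting on column vectors *)
Definition lorentz_group : set 'M[R]_m.+2 :=
  [set A | (forall v w, lorentz (A *m v) (A *m w) = lorentz v w) /\
           (forall v, future_cone (A *m v) <-> future_cone v)].

Definition isotropy : set 'M[R]_m.+2 :=
  [set A | lorentz_group A /\ A *m ell = ell].

End Lorentz.
Arguments ell {R m}.
Arguments enn {R m}.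
Arguments lorentz_group R m : clear implicits.
Arguments isotropy R m : clear implicits.

(* Lie algebra of a matrix group: velocities at 0 of smooth curves in the group
   starting at the identity. *)
Definition curve_at_id (R : realType) n (S : set 'M[R]_n)
    (c : R^o -> 'M[R]_n) : Prop :=
  [/\ smooth_near c 0, c 0 = 1%:M & \forall t \near (0 : R^o), S (c t)].

Definition lie_algebra (R : realType) n (S : set 'M[R]_n) : set 'M[R]_n :=
  [set X | exists2 c, curve_at_id S c & 'D_1 c 0 = X].

Section PrincipalBundle.
Context {R : realType} {E : normedModType R}.
Variables (N : manifold E) (n : nat) (H : set 'M[R]_n).

(* [H] is meant to be a closed group of matrices, hence an embedded Lie subgroup.
   A local trivialization over a neighborhood U of [x] is an H-equivariant
   diffeomorphism u |-> (p u, ltriv u) from p^-1(U) to U x H, with inverse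
   [ltriv_inv]. *)
Record local_triv (E' : normedModType R) (P : manifold E') (p : P -> N)
    (bact : P -> 'M[R]_n -> P) (x : N) := LocalTriv {
  ltdom : set N;
  ltriv : P -> 'M[R]_n;
  ltriv_inv : N -> 'M[R]_n -> P;
  ltdomP : open_nbhs x ltdom;
  ltriv_in : forall u, ltdom (p u) -> H (ltriv u);
  ltriv_act : forall u h, ltdom (p u) -> H h ->
    ltriv (bact u h) = ltriv u *m h;
  ltrivK : forall u, ltdom (p u) -> ltriv_inv (p u) (ltriv u) = u;
  ltriv_inv_proj : forall y h, ltdom y -> H h -> p (ltriv_inv y h) = y;
  ltriv_invK : forall y h, ltdom y -> H h -> ltriv (ltriv_inv y h) = h;
  ltriv_smooth : forall u, ltdom (p u) -> smooth_fun_at ltriv u;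
  ltriv_inv_smooth : forall y h, ltdom y -> H h ->
    smooth_map2_at H ltriv_inv y h }.

(* The total space is not required to be connected, as H need not be.  The
   values of [bact] outside H are irrelevant. *)
Record principal_bundle := PrincipalBundle {
  pdim : nat;
  ptotal :> manifold 'rV[R]_pdim;
  bproj : ptotal -> N;
  bact : ptotal -> 'M[R]_n -> ptotal;
  bact1 : forall u, bact u 1%:M = u;
  bactM : forall u h k, H h -> H k -> bact (bact u h) k = bact u (h *m k);
  bproj_act : forall u h, H h -> bproj (bact u h) = bproj u;
  bproj_smooth : forall u, smooth_map_at bproj u;
  bact_smooth : forall u h, H h -> smooth_map2_at H bact u h;
  locally_trivial : forall x, inhabited (local_triv bproj bact x) }.

End PrincipalBundle.

Section Cartan.
Context {R : realType} {m : nat}.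
Variable N : manifold 'rV[R]_m.+1.

(* [cform_fund]: the fundamental vector field of X in the Lie algebra of H has
   value at u the velocity at t = 0 of t |-> u c(t), for any curve c in H with
   c(0) = 1 and c'(0) = X. *)
Record cartan_geometry := CartanGeometry {
  cbundle :> principal_bundle N (isotropy R m);
  cform : forall u : cbundle, {linear tangent u -> 'M[R]_m.+2};
  cform_smooth : smooth_form cform;
  cform_inj : forall u, injective (cform u);
  cform_image : forall u, range (cform u) = lie_algebra (lorentz_group R m);
  cform_act : forall u h (v : tangent u), isotropy R m h ->
    cform (bact u h) (tangent_map (fun u' => bact u' h) v)
      = invmx h *m cform u v *m h;
  cform_fund : forall u (c : R^o -> 'M[R]_m.+2), curve_at_id (isotropy R m) c ->
    cform u ('D_1 (fun t => chart u (bact u (c t))) 0) = 'D_1 c 0 }.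

(* Isomorphism covering the identity of N. *)
Definition cartan_iso (C C' : cartan_geometry) : Prop :=
  exists f : C -> C', exists g : C' -> C,
  [/\ cancel f g /\ cancel g f,
      (forall u, smooth_map_at f u) /\ (forall u, smooth_map_at g u),
      forall u, bproj (f u) = bproj u,
      forall u h, isotropy R m h -> f (bact u h) = bact (f u) h &
      forall u (v : tangent u), cform (f u) (tangent_map f v) = cform u v].

End Cartan.

Section Extension.
Context {R : realType} {E : normedModType R}.
Variable N : manifold E.

(* Fibers, and for each [x] a chart of the vector bundle over a set [vdom x]
   containing [x]; the smooth structure of the total space is the one given by
   these charts. *)
Record vbundle_data (r : nat) := VBundleData {
  fiber :> N -> lmodType R;
  vdom : N -> set N;
  vtriv : forall x y : N, fiber y -> 'cV[R]_r;
  vtriv_inv : forall x y : N, 'cV[R]_r -> fiber y }.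

Definition smooth_section_at r (V : vbundle_data r) (s : forall y, V y) (x : N) :=
  smooth_fun_at (fun y => vtriv x (s y)) x.

Record is_vbundle r (V : vbundle_data r) : Prop := IsVBundle {
  vdomP : forall x, open_nbhs x (vdom V x);
  vtriv_linear : forall x y, vdom V x y -> linear (@vtriv r V x y);
  vtrivK : forall x y, vdom V x y ->
    cancel (@vtriv r V x y) (@vtriv_inv r V x y);
  vtriv_invK : forall x y, vdom V x y ->
    cancel (@vtriv_inv r V x y) (@vtriv r V x y);
  vtriv_smooth : forall x x' y (a : 'cV[R]_r), vdom V x y -> vdom V x' y ->
    smooth_fun_at (fun z => vtriv x' (vtriv_inv V x z a)) y }.

(* [nabla x w s] is the derivative at [x] of [s] in the direction [w]; it is
   only meaningful when the section [s] is smooth on a neighborhood of [x]. *)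
Record quadruple (r : nat) := Quadruple {
  qbundle :> vbundle_data r;
  qmetric : forall x, qbundle x -> qbundle x -> R;
  nabla : forall x : N, tangent x -> (forall y, qbundle y) -> qbundle x;
  qsection : forall x, qbundle x }.

Record is_lorentz_metric r (Q : quadruple r) : Prop := IsLorentzMetric {
  qmetric_linear : forall x (v : Q x), linear_for *%R (qmetric v);
  qmetric_sym : forall x (v w : Q x), qmetric v w = qmetric w v;
  qmetric_signature : forall x, exists e : 'I_r -> Q x, forall i j,
    qmetric (e i) (e j) = (if i.+1 == r then -1 else 1) *+ (i == j);
  qmetric_smooth : forall (s t : forall y, Q y) x,
    smooth_section_at s x -> smooth_section_at t x ->
    smooth_fun_at (fun y => qmetric (s y) (t y) : R^o) x }.

(* Connection acting on sections smooth near a point; locality is a consequence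
   of the Leibniz rule, since [f] need only be smooth near [x]. *)
Record is_connection r (Q : quadruple r) : Prop := IsConnection {
  nabla_linear : forall x (s : forall y, Q y), smooth_section_at s x ->
    linear (fun w : tangent x => nabla w s);
  nabla_add : forall x (w : tangent x) (s t : forall y, Q y),
    smooth_section_at s x -> smooth_section_at t x ->
    nabla w (fun y => s y + t y) = nabla w s + nabla w t;
  nabla_leibniz : forall x (w : tangent x) (f : N -> R^o) (s : forall y, Q y),
    smooth_fun_at f x -> smooth_section_at s x ->
    nabla w (fun y => f y *: s y) = fun_deriv f w *: s x + f x *: nabla w s;
  nabla_smooth : forall (x0 : N) (v : E) (s : forall y, Q y),
    smooth_section_at s x0 ->
    smooth_section_at (fun x => nabla (coord_field x0 v x) s) x0 }.

Record is_extension r (Q : quadruple r) : Prop := IsExtension {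
  ext_vbundle : is_vbundle Q;
  ext_metric : is_lorentz_metric Q;
  ext_connection : is_connection Q;
  ext_parallel : forall x (w : tangent x) (s t : forall y, Q y),
    smooth_section_at s x -> smooth_section_at t x ->
    fun_deriv (fun y => qmetric (s y) (t y) : R^o) w
      = qmetric (nabla w s) (t x) + qmetric (s x) (nabla w t);
  ext_section : forall x, smooth_section_at (qsection Q) x;
  ext_lightlike : forall x,
    qsection Q x != 0 /\ qmetric (qsection Q x) (qsection Q x) = 0;
  ext_mono : forall x, injective (fun w : tangent x => nabla w (qsection Q)) }.

Definition quadruple_iso r (Q Q' : quadruple r) : Prop :=
  exists f : forall x, Q x -> Q' x,
  [/\ forall x, linear (f x) /\ bijective (f x),
      forall x (s : forall y, Q y),
        smooth_section_at s x <-> smooth_section_at (fun y => f y (s y)) x,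
      forall x (v w : Q x), qmetric (f x v) (f x w) = qmetric v w,
      forall x (w : tangent x) (s : forall y, Q y), smooth_section_at s x ->
        f x (nabla w s) = nabla w (fun y => f y (s y)) &
      forall x, f x (qsection Q x) = qsection Q' x].

End Extension.

Definition lightlike_extension (R : realType) (m : nat)
    (N : manifold 'rV[R]_m.+1) (Q : quadruple N m.+2) : Prop :=
  is_extension Q.

Section LorentzTheory.
Context {R : realType} {m : nat}.
Implicit Types (v w : 'cV[R]_m.+2) (A B : 'M[R]_m.+2).

Lemma lorentz_group_unit A : lorentz_group R m A -> A \in unitmx.
Proof.
move=> [isoA _]; pose J : 'M[R]_m.+2 := tperm_mx ord0 ord_max.
have AJA : A^T *m J *m A = J.
  apply/matrixP => i j.
  have E (M : 'M[R]_m.+2) : ((delta_mx 0 i : 'rV_m.+2) *m M *m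
      (delta_mx j 0 : 'cV_m.+2)) 0 0 = M i j.
    by rewrite -rowE -colE !mxE.
  have := isoA (delta_mx i 0) (delta_mx j 0).
  rewrite /lorentz -/J trmx_mul trmx_delta E => <-.
  by rewrite -(E (A^T *m J *m A)) !mulmxA.
have JJ : J *m J = 1%:M by rewrite /J /tperm_mx -perm_mxM tperm2 perm_mx1.
have /mulmx1_unit[] // : (J *m A^T *m J) *m A = 1%:M.
by rewrite -!mulmxA [A^T *m _]mulmxA AJA JJ.
Qed.

Lemma isotropy_unit A : isotropy R m A -> A \in unitmx.
Proof. by case=> /lorentz_group_unit. Qed.

Lemma isotropy1 : isotropy R m 1%:M.
Proof. by split; [split=> *|]; rewrite ?mul1mx. Qed.

Lemma isotropyM A B : isotropy R m A -> isotropy R m B -> isotropy R m (A *m B).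
Proof.
move=> [[isoA coneA] Al] [[isoB coneB] Bl]; split; last by rewrite -mulmxA Bl.
by split=> [v w|v]; rewrite -!mulmxA ?isoA ?coneA.
Qed.

Lemma isotropyV A : isotropy R m A -> isotropy R m (invmx A).
Proof.
move=> HA; have uA := isotropy_unit HA; case: HA => [[isoA coneA] Al].
split; last by rewrite -{1}Al mulKmx.
by split=> [v w|v]; [rewrite -isoA|rewrite -coneA]; rewrite !mulKVmx.
Qed.

End LorentzTheory.

Section Tractor.
Context {R : realType} {m : nat} {N : manifold 'rV[R]_m.+1}.
Variable C : cartan_geometry N.
Implicit Types (u : C) (v : 'cV[R]_m.+2) (h : 'M[R]_m.+2) (x y : N).
Local Notation H := (isotropy R m).

Definition triv_at x : local_triv H (@bproj _ _ _ _ _ C) (@bact _ _ _ _ _ C) x :=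
  inhabited_witness (locally_trivial C x).

Lemma bact_free u h k : H h -> H k -> bact u h = bact u k -> h = k.
Proof.
move=> Hh Hk /(congr1 (ltriv (triv_at (bproj u)))).
have [_ du] := ltdomP (triv_at (bproj u)).
have uA : ltriv (triv_at (bproj u)) u \in unitmx.
  by apply: isotropy_unit; apply: ltriv_in.
by rewrite !ltriv_act// => /(can_inj (mulKmx uA)).
Qed.

Lemma bact_transitive u u' : bproj u = bproj u' -> exists2 h, H h & u' = bact u h.
Proof.
move=> uu'; pose l := triv_at (bproj u); have [_ du] := ltdomP l.
have du' : ltdom l (bproj u') by rewrite -uu'.
have uA : ltriv l u \in unitmx by apply: isotropy_unit; apply: ltriv_in.
pose h := invmx (ltriv l u) *m ltriv l u'.
have Hh : H h by apply: isotropyM; [apply: isotropyV|]; apply: ltriv_in.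
have dh : ltdom l (bproj (bact u h)) by rewrite bproj_act.
exists h => //; rewrite -[LHS](ltrivK du') -[RHS](ltrivK dh).
by rewrite ltriv_act// mulKVmx// bproj_act//; congr ltriv_inv.
Qed.

Definition assoc_rel (q q' : C * 'cV[R]_m.+2) : bool :=
  `[< exists2 h, H h & q' = (bact q.1 h, invmx h *m q.2) >].

Lemma assoc_relP : equiv_class_of assoc_rel.
Proof.
have sym q q' : assoc_rel q q' -> assoc_rel q' q.
  move=> /asboolP[h Hh ->]; apply/asboolP; exists (invmx h).
    exact: isotropyV.
  have uh := isotropy_unit Hh; case: q => u v /=.
  by rewrite bactM ?mulmxV ?bact1 ?invmxK ?mulKVmx//; exact: isotropyV.
split.
- move=> [u v]; apply/asboolP; exists 1%:M; first exact: isotropy1.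
  by rewrite bact1 invmx1 mul1mx.
- by move=> q q'; apply/idP/idP; exact: sym.
- move=> q1 q2 q3 /asboolP[h Hh ->] /asboolP[k Hk ->].
  apply/asboolP; exists (h *m k); first exact: isotropyM.
  rewrite /= bactM// mulmxA; congr (_, _ *m _).
  have Hhk := isotropy_unit (isotropyM Hh Hk).
  apply: (can_inj (mulKmx Hhk)); rewrite mulmxV// -mulmxA.
  by rewrite mulKVmx ?mulmxV//; exact: isotropy_unit.
Qed.

Canonical assoc_equiv := EquivRelPack assoc_relP.

Definition assoc : Type := {eq_quot assoc_equiv}.
HB.instance Definition _ := Choice.on assoc.

Definition bracket u v : assoc := \pi_({eq_quot assoc_equiv}) (u, v).

Definition assoc_proj (c : assoc) : N :=
  bproj (repr (c : {eq_quot assoc_equiv})).1.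

Lemma bracketP u v u' v' : bracket u v = bracket u' v' <->
  exists2 h, H h & u' = bact u h /\ v' = invmx h *m v.
Proof.
split=> [/eqmodP/asboolP[h Hh [-> ->]]|[h Hh [-> ->]]]; first by exists h.
by apply/eqmodP/asboolP; exists h.
Qed.

Lemma assoc_proj_bracket u v : assoc_proj (bracket u v) = bproj u.
Proof.
rewrite /assoc_proj.
have := reprK (bracket u v : {eq_quot assoc_equiv}).
case: repr => u' v' /bracketP[h Hh [-> _]].
by rewrite bproj_act.
Qed.

Lemma bracket_surj (c : assoc) u : assoc_proj c = bproj u ->
  exists v, c = bracket u v.
Proof.
rewrite /assoc_proj; have := reprK (c : {eq_quot assoc_equiv}).
case: repr => u' v' <- /= /bact_transitive[h Hh ->].
by exists (invmx h *m v'); apply/bracketP; exists h.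
Qed.

Definition tractor_fiber x : Type := {c : assoc | assoc_proj c == x}.
HB.instance Definition _ x := Choice.on (tractor_fiber x).

Definition local_section x y : C := ltriv_inv (triv_at x) y 1%:M.

Lemma local_section_proj x : bproj (local_section x x) = x.
Proof.
by apply: ltriv_inv_proj; [case: (ltdomP (triv_at x))|exact: isotropy1].
Qed.

Lemma fiber_point_subproof x :
  assoc_proj (bracket (local_section x x) 0) == x.
Proof. by rewrite assoc_proj_bracket local_section_proj. Qed.

(* The element [u, v] of the fiber at [x]; meaningful when [bproj u = x]. *)
Definition fbracket x u v : tractor_fiber x :=
  insubd (exist (fun c => assoc_proj c == x) _ (fiber_point_subproof x))
    (bracket u v).

(* The vector [v] such that [c = [u, v]], for [u] over the base point of [c]. *)
Definition frame_coord x u (c : tractor_fiber x) : 'cV[R]_m.+2 :=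
  xget 0 [set v | bracket u v = val c].

Lemma fbracketE x u v : bproj u = x -> val (fbracket x u v) = bracket u v.
Proof. by move=> ux; rewrite val_insubd assoc_proj_bracket ux eqxx. Qed.

Lemma bracket_inj u : injective (bracket u).
Proof.
move=> v w /bracketP[h Hh]; rewrite -{1}[u]bact1 => -[eu ->].
by rewrite -(bact_free isotropy1 Hh eu) invmx1 mul1mx.
Qed.

Lemma bracket_coord x u (c : tractor_fiber x) : bproj u = x ->
  bracket u (frame_coord u c) = val c.
Proof.
move=> ux; have /(bracket_surj (c := val c))[v cE] : assoc_proj (val c) = bproj u.
  by rewrite ux; apply/eqP; exact: (valP c).
by apply: (@xgetI _ _ [set w | bracket u w = val c] v).
Qed.

Lemma fbracketK x u : bproj u = x -> cancel (fbracket x u) (frame_coord u).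
Proof.
by move=> ux v; apply: (@bracket_inj u); rewrite bracket_coord// fbracketE.
Qed.

Lemma frame_coordK x u : bproj u = x ->
  cancel (@frame_coord x u) (fbracket x u).
Proof.
by move=> ux c; apply: val_inj; rewrite fbracketE// bracket_coord.
Qed.

Lemma fbracket_act x u h v : bproj u = x -> H h ->
  fbracket x (bact u h) v = fbracket x u (h *m v).
Proof.
move=> ux Hh; apply: val_inj; rewrite !fbracketE ?bproj_act//.
apply/esym/bracketP; exists h => //; split => //.
by rewrite mulKmx//; exact: isotropy_unit.
Qed.

Lemma frame_coord_act x u h (c : tractor_fiber x) : bproj u = x -> H h ->
  frame_coord (bact u h) c = invmx h *m frame_coord u c.
Proof.
move=> ux Hh; have uhx : bproj (bact u h) = x by rewrite bproj_act.
apply: (can_inj (fbracketK uhx)); rewrite frame_coordK// fbracket_act//.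
by rewrite mulKVmx ?frame_coordK//; exact: isotropy_unit.
Qed.

(* The vector space structure of the fibers, read in an arbitrary point of the
   principal bundle; see [fbracketD] and [fbracketZ]. *)
Section FiberModule.
Variable x : N.
Let p := local_section x x.
Let px : bproj p = x := local_section_proj x.
Implicit Types (c d : tractor_fiber x) (a b : R).

Definition fiber_zero : tractor_fiber x := fbracket x p 0.
Definition fiber_opp c := fbracket x p (- frame_coord p c).
Definition fiber_add c d := fbracket x p (frame_coord p c + frame_coord p d).
Definition fiber_scale a c := fbracket x p (a *: frame_coord p c).

Lemma fiber_addA : associative fiber_add.
Proof. by move=> c d e; rewrite /fiber_add !(fbracketK px) addrA. Qed.
Lemma fiber_addC : commutative fiber_add.
Proof. by move=> c d; rewrite /fiber_add addrC. Qed.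
Lemma fiber_add0 : left_id fiber_zero fiber_add.
Proof.
by move=> c; rewrite /fiber_add !(fbracketK px) add0r (frame_coordK px).
Qed.
Lemma fiber_addN : left_inverse fiber_zero fiber_opp fiber_add.
Proof. by move=> c; rewrite /fiber_add !(fbracketK px) addNr. Qed.

HB.instance Definition _ := GRing.isZmodule.Build (tractor_fiber x)
  fiber_addA fiber_addC fiber_add0 fiber_addN.

Lemma fiber_scaleA a b c :
  fiber_scale a (fiber_scale b c) = fiber_scale (a * b) c.
Proof. by rewrite /fiber_scale (fbracketK px) scalerA. Qed.
Lemma fiber_scale1 : left_id 1 fiber_scale.
Proof. by move=> c; rewrite /fiber_scale scale1r (frame_coordK px). Qed.
Lemma fiber_scaleDr : right_distributive fiber_scale +%R.
Proof.
move=> a c d.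
by rewrite /fiber_scale /GRing.add/= /fiber_add !(fbracketK px) scalerDr.
Qed.
Lemma fiber_scaleDl c : {morph fiber_scale^~ c : a b / a + b}.
Proof.
move=> a b; rewrite /fiber_scale [RHS]/GRing.add/= /fiber_add !(fbracketK px).
by rewrite scalerDl.
Qed.

HB.instance Definition _ := GRing.Zmodule_isLmodule.Build R (tractor_fiber x)
  fiber_scaleA fiber_scale1 fiber_scaleDr fiber_scaleDl.

End FiberModule.

Lemma fbracketD x u v w : bproj u = x ->
  fbracket x u (v + w) = fbracket x u v + fbracket x u w.
Proof.
have px := local_section_proj x; move=> ux.
have [h Hh ->] := bact_transitive (etrans px (esym ux)).
rewrite !fbracket_act// [RHS]/GRing.add/= /fiber_add !(fbracketK px).
by rewrite mulmxDr.
Qed.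

Lemma fbracketZ x u (a : R) v : bproj u = x ->
  fbracket x u (a *: v) = a *: fbracket x u v.
Proof.
have px := local_section_proj x; move=> ux.
have [h Hh ->] := bact_transitive (etrans px (esym ux)).
rewrite !fbracket_act// [RHS]/GRing.scale/= /fiber_scale !(fbracketK px).
by rewrite -scalemxAr.
Qed.

(* The vector bundle charts are those induced by the local sections of C. *)
Definition tractor_bundle : vbundle_data N m.+2 := {|
  fiber := tractor_fiber : N -> lmodType R;
  vdom := fun x => ltdom (triv_at x);
  vtriv := fun x y c => frame_coord (local_section x y) c;
  vtriv_inv := fun x y v => fbracket y (local_section x y) v |}.

Definition tractor_metric x (c d : tractor_fiber x) : R :=
  lorentz (frame_coord (local_section x x) c) (frame_coord (local_section x x) d).

Lemma tractor_metricE x u v w : bproj u = x ->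
  tractor_metric (fbracket x u v) (fbracket x u w) = lorentz v w.
Proof.
have px := local_section_proj x; move=> ux.
have [h Hh ->] := bact_transitive (etrans px (esym ux)).
rewrite /tractor_metric !fbracket_act// !(fbracketK px).
by case: Hh => -[->].
Qed.

(* nabla_w [s, f] = [s, w(f) + omega(Ts w) f], for the local section s of C given
   at [x] and the function f with t = [s, f]; by equivariance of the Cartan
   connection the result does not depend on the choice of s. *)
Definition tractor_nabla x (w : tangent x) (t : forall y, tractor_fiber y) :
    tractor_fiber x :=
  let s := local_section x in
  let f y := frame_coord (s y) (t y) in
  fbracket x (s x) (fun_deriv f w + cform (s x) (tangent_map s w) *m f x).

Definition tractor_section x : tractor_fiber x :=
  fbracket x (local_section x x) ell.

Lemma tractor_sectionE x u : bproj u = x ->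
  tractor_section x = fbracket x u ell.
Proof.
have px := local_section_proj x; move=> ux.
have [h Hh ->] := bact_transitive (etrans px (esym ux)).
by rewrite fbracket_act//; case: Hh => _ ->.
Qed.

Definition standard_tractor : quadruple N m.+2 := {|
  qbundle := tractor_bundle;
  qmetric := tractor_metric;
  nabla := tractor_nabla;
  qsection := tractor_section |}.

End Tractor.

(* Main.v *)
(* A frame u of a Cartan geometry over x gives an isometry [u, .] from L to the
   tractor fiber over x carrying ell to xi.  Conversely the isometries L -> V_x
   carrying ell to eta form an H-principal bundle: local smooth ones come from
   pseudo-Gram-Schmidt followed by a reflection moving ell to eta, and the total
   space gets its charts from the Cayley transform of H.  If Gamma is the connection
   matrix of V in a local frame, the Cartan form at the frame of matrix M is
   M^-1 (dM + Gamma M).  It is injective because w |-> nabla_w eta is, hence bijective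
   onto g by dimension count.  For uniqueness, an isomorphism of the tractor bundles
   carries [u, .] to [F u, .] for a bundle map F; the connections determine the two
   Cartan forms along local sections, and equivariance does the rest. *)

Require Import Defs.
From HB Require Import structures.
From mathcomp Require Import all_boot all_order all_algebra.
From mathcomp Require Import perm.
From mathcomp Require Import all_classical all_reals all_analysis.
From mathcomp Require Import ring lra.

Set Implicit Arguments.
Unset Strict Implicit.
Unset Printing Implicit Defensive.

Import Order.TTheory GRing.Theory Num.Theory.
Import numFieldNormedType.Exports.
Local Open Scope classical_set_scope.
Local Open Scope ring_scope.

(** * Smooth functions on normed spaces *)

(** The fibers of the given bundle are bare vector spaces, and smoothness is visible only in charts.
    The frames are therefore encoded by one adapted frame chosen at every point, with no continuity
    in the point: as a set, the total space is the product of [N] and [H], and its topology and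
    charts come from the local frames through the record [gauge], which keeps only transition
    matrices and connection matrices.

    Two facts keep the group side algebraic. An isometry that fixes [ell] preserves the future cone,
    so [H] is cut out by A^T J A = J and A ell = ell, and no time orientation of the bundle has to
    be chosen. The map X |-> X ell on the Lie algebra of G has the Lie algebra of [H] as kernel, and
    its values are orthogonal to [ell], a space of dimension m + 1. The derivative of eta controls
    exactly this column, which is why injectivity of w |-> nabla_w eta becomes an isomorphism onto
    the whole algebra. *)

Lemma linear_fun0 (R : pzRingType) (U V : lmodType R) (f : U -> V) : linear f -> f 0 = 0.
Proof.
move=> lf; have := lf 1 0 0; rewrite !scale1r addr0 => /eqP.
by rewrite -subr_eq0 opprD addrA subrr sub0r oppr_eq0 => /eqP.
Qed.

Section LinearMatrix.
Variable R : comNzRingType.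

Lemma linear_matrix p q (f : 'cV[R]_p -> 'cV[R]_q) : linear f ->
  forall v, (\matrix_(i, j) f (delta_mx j 0) i 0) *m v = f v.
Proof.
move=> lf v.
pose L : {linear 'cV[R]_p -> 'cV[R]_q} :=
  HB.pack f (GRing.isLinear.Build _ _ _ _ _ lf).
rewrite -[f v]/(L v) [in RHS](matrix_sum_delta v) linear_sum.
apply/colP => i; rewrite mxE summxE; apply: eq_bigr => j _.
by rewrite big_ord1 linearZ !mxE mulrC.
Qed.

Lemma mulmx_delta_eq p q (B C : 'M[R]_(p, q)) :
  (forall j, B *m (delta_mx j 0 : 'cV_q) = C *m delta_mx j 0) -> B = C.
Proof.
move=> e; apply/matrixP => i j.
by have := congr1 (fun c : 'cV_p => c i 0) (e j); rewrite -!colE !mxE.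
Qed.

Lemma gram_pullback n p q (A : 'M[R]_(n, p)) (B : 'M[R]_(p, q)) (G : 'M[R]_n) :
  B^T *m (A^T *m G *m A) *m B = (A *m B)^T *m G *m (A *m B).
Proof. by rewrite trmx_mul !mulmxA. Qed.

End LinearMatrix.

(** * Functions of class C^k between normed spaces *)

Section Calculus.
Variable R : realType.
Implicit Types E F G : normedModType R.

(** The first-order expansion at [x] sees only values near [x], so the expansion of [f] is one of
    [g], and expansions are unique. *)
Lemma near_eq_diff E F (f g : E -> F) x : (\forall y \near x, f y = g y) ->
  differentiable f x -> differentiable g x /\ 'd g x = 'd f x :> (E -> F).
Proof.
move=> fg df; have fgx := nbhs_singleton fg.
have cd := diff_continuous df.
have gE : g \o shift x = cst (g x) + 'd f x +o_ 0 id.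
  apply/eqaddoP => eps e0.
  have /eqaddoP/(_ _ e0) := diff_locally df.
  have : \forall y \near (0 : E), f (y + x) = g (y + x).
    have c0 : {for (0 : E), continuous (fun y : E => y + x)}.
      by apply: cvgD; [exact: cvg_id|exact: cvg_cst].
    by apply: (c0 [set z | f z = g z]); rewrite /= add0r; exact: fg.
  by apply: filterS2 => y /= fgy; rewrite !fctE/= fgy fgx.
have dE : 'd g x = 'd f x :> (E -> F) by apply: diff_unique.
split; last exact: dE.
by apply/diff_locallyP; rewrite dE; split; [exact: cd|exact: gE].
Qed.

Lemma Ck_ext E F k (U : set E) (f g : E -> F) : open U ->
  (forall x, U x -> f x = g x) -> Ck k U f -> Ck k U g.
Proof.
move=> oU; elim: k f g => [|k IH] f g fg /=.
  move=> cf x Ux; have := cf x Ux; rewrite /prop_for /continuous_at (fg _ Ux).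
  apply: cvg_trans; apply: near_eq_cvg.
  by apply: filterS (open_nbhs_nbhs (conj oU Ux)) => y /fg.
have nfg x : U x -> \forall y \near x, f y = g y.
  by move=> Ux; apply: filterS (open_nbhs_nbhs (conj oU Ux)) => y /fg.
case=> df dk; split=> [x Ux|v]; first exact: (near_eq_diff (nfg x Ux) (df x Ux)).1.
apply: IH (dk v) => x Ux.
exact: esym (congr1 (@^~ v) (near_eq_diff (nfg x Ux) (df x Ux)).2).
Qed.

Lemma Ck_sub E F k (U V : set E) (f : E -> F) :
  V `<=` U -> Ck k U f -> Ck k V f.
Proof.
move=> VU; elim: k f => [|k IH] f /=; first by move=> cf x /VU/cf.
by move=> [df dk]; split=> [x /VU/df //|v]; exact: IH.
Qed.

Lemma CkS E F k (U : set E) (f : E -> F) : Ck k.+1 U f -> Ck k U f.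
Proof.
elim: k f => [|k IH] f [df dk].
  by move=> x Ux; apply: differentiable_continuous; exact: df.
by split=> // v; apply: IH; exact: dk.
Qed.

Lemma Ck_cst E F k (U : set E) (c : F) : Ck k U (cst c : E -> F).
Proof.
elim: k c => [|k IH] c /=; first by move=> x _; exact: cst_continuous.
split=> [x _|v]; first exact: differentiable_cst.
rewrite (_ : (fun x => _) = cst (0 : F)) //; apply/funext => x.
by rewrite diff_cst.
Qed.

Lemma Ck_lin E F G k (U : set E) (L : {linear F -> G}) (f : E -> F) :
  open U -> continuous L -> Ck k U f -> Ck k U (L \o f).
Proof.
move=> oU cL; elim: k f => [|k IH] f /=.
  by move=> cf x Ux; apply: continuous_comp; [exact: cf|exact: cL].
have dL y : differentiable L y by exact: linear_differentiable.
move=> [df dk]; split=> [x Ux|v].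
  by apply: differentiable_comp; [exact: df|].
apply: Ck_ext (IH _ (dk v)) => // x Ux /=.
rewrite (diff_comp (df x Ux) (dL _)) /=.
by rewrite (diff_lin (f x) cL).
Qed.

Lemma CkD E F k (U : set E) (f g : E -> F) : open U ->
  Ck k U f -> Ck k U g -> Ck k U (fun x => f x + g x).
Proof.
move=> oU; elim: k f g => [|k IH] f g /=.
  by move=> cf cg x Ux; apply: continuousD; [exact: cf|exact: cg].
move=> [df dfk] [dg dgk]; split=> [x Ux|v].
  by apply: differentiableD; [exact: df|exact: dg].
apply: Ck_ext (IH _ _ (dfk v) (dgk v)) => // x Ux.
exact: esym (congr1 (@^~ v) (diffD (df x Ux) (dg x Ux))).
Qed.

Lemma Ck_sum E F k (U : set E) I (r : seq I) (f : I -> E -> F) : open U ->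
  (forall i, Ck k U (f i)) -> Ck k U (fun x => \sum_(i <- r) f i x).
Proof.
move=> oU Hf; elim: r => [|i r IH].
  by apply: Ck_ext (Ck_cst k U 0) => // x _; rewrite big_nil.
by apply: Ck_ext (CkD oU (Hf i) IH) => // x _; rewrite big_cons.
Qed.

Lemma scale_bilinear F : bilinear_for
  (GRing.Scale.Law.clone _ _ *:%R _) (GRing.Scale.Law.clone _ _ *:%R _)
  (@GRing.scale R F : R^o -> F -> F).
Proof.
split=> [u'|u] a x y /=; first by rewrite scalerDl scalerA.
by rewrite scalerDr !scalerA mulrC.
Qed.

Lemma diff_scale E F (f : E -> R^o) (g : E -> F) x :
  differentiable f x -> differentiable g x ->
  differentiable (fun y => f y *: g y) x /\
  'd (fun y => f y *: g y) x = (fun v => f x *: 'd g x v + 'd f x v *: g x) :> (E -> F).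
Proof.
move=> df dg.
pose B : {bilinear R^o -> F -> F} :=
  HB.pack (@GRing.scale R F : R^o -> F -> F) (bilinear_isBilinear.Build _ _ _ _ _ _ _
      (@scale_bilinear F)).
have cB : continuous (fun p => B p.1 p.2) by move=> p; exact: scale_continuous.
have dB := @differentiable_bilin _ _ _ _ B (f x, g x) cB.
have dfg := differentiable_pair df dg.
split; first exact: (differentiable_comp dfg dB).
rewrite (_ : (fun y => _) = (fun p => B p.1 p.2) \o (fun y => (f y, g y))) //.
rewrite diff_comp // diff_bilin //; apply/funext => v /=.
by rewrite diff_pair.
Qed.

Lemma CkZ E F k (U : set E) (f : E -> R^o) (g : E -> F) : open U ->
  Ck k U f -> Ck k U g -> Ck k U (fun x => f x *: g x).
Proof.
move=> oU; elim: k f g => [|k IH] f g.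
  by move=> cf cg x Ux; apply: continuousZ; [exact: cf|exact: cg].
move=> Hf Hg; have [df dfk] := Hf; have [dg dgk] := Hg.
split=> [x Ux|v]; first exact: (diff_scale (df x Ux) (dg x Ux)).1.
apply: (@Ck_ext _ _ _ _ (fun x => f x *: 'd g x v + 'd f x v *: g x)) => //.
  by move=> x Ux; exact: esym (congr1 (@^~ v) (diff_scale (df x Ux) (dg x Ux)).2).
by apply: CkD => //; apply: IH => //; [exact: (CkS Hf)|exact: dgk|exact: dfk|exact: (CkS Hg)].
Qed.

(** Continuous coefficient functionals make every linear map out of [F] continuous and let a moving
    direction be expanded in fixed ones. *)
Definition findim F := exists (I : finType) (e : I -> F) (c : I -> {linear F -> R^o}),
  (forall i, continuous (c i)) /\ forall v, v = \sum_i c i v *: e i.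

Lemma findim_continuous F G (L : {linear F -> G}) : findim F -> continuous L.
Proof.
move=> [I [e [c [cc ve]]]] x.
rewrite (_ : L = (fun v => \sum_i c i v *: L (e i)) :> (F -> G)); last first.
  by apply/funext => v; rewrite {1}(ve v) linear_sum; apply: eq_bigr => i _; rewrite linearZ.
have oT : open [set: F] by exact: openT.
have := @Ck_sum F G 0 setT _ (index_enum I) (fun i v => c i v *: L (e i)) oT.
apply => // i; apply: CkZ => //.
  by rewrite /= => y _; exact: cc.
exact: Ck_cst.
Qed.

(* The derivative of [g \o f] is x |-> 'd g (f x) ('d f x v), where the direction
   varies with x; expanding it in a basis leaves derivatives of [g] in fixed
   directions, to which the induction hypothesis applies. *)
Lemma Ck_comp E F G k (U : set E) (V : set F) (f : E -> F) (g : F -> G) :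
  findim F -> open U -> (forall x, U x -> V (f x)) ->
  Ck k U f -> Ck k V g -> Ck k U (g \o f).
Proof.
move=> [I [e [c [cc ve]]]] oU UV; elim: k g => [|k IH] g.
  by move=> cf cg x Ux; apply: continuous_comp; [exact: cf|exact/cg/UV].
move=> Hf [dg dgk]; have [df dfk] := Hf.
split=> [x Ux|v]; first by apply: differentiable_comp; [exact: df|exact/dg/UV].
apply: (@Ck_ext _ _ _ _
  (fun x => \sum_i (c i \o (fun y => 'd f y v)) x *: 'd g (f x) (e i))) => //.
  move=> x Ux; rewrite (diff_comp (df x Ux) (dg _ (UV _ Ux))) /=.
  rewrite [in RHS](ve ('d f x v)) linear_sum; apply: eq_bigr => i _.
  by rewrite linearZ.
apply: Ck_sum => // i; apply: CkZ => //.
  exact: (Ck_lin oU (cc i) (dfk v)).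
exact: IH _ (CkS Hf) (dgk (e i)).
Qed.

Lemma Ck_pair E F G k (U : set E) (f : E -> F) (g : E -> G) : open U ->
  Ck k U f -> Ck k U g -> Ck k U (fun x => (f x, g x)).
Proof.
move=> oU; elim: k f g => [|k IH] f g /=.
  by move=> cf cg x Ux; apply: cvg_pair; [exact: cf|exact: cg].
move=> [df dfk] [dg dgk]; split=> [x Ux|v].
  by apply: differentiable_pair; [exact: df|exact: dg].
apply: Ck_ext (IH _ _ (dfk v) (dgk v)) => // x Ux.
by rewrite (diff_pair (df x Ux) (dg x Ux)).
Qed.

(** The derivative is a multiple of the square of the function itself, so the induction on [k]
    closes. *)
Lemma Ck_inv k : Ck k [set x : R^o | x != 0] (fun x : R^o => x^-1 : R^o).
Proof.
have oU : open [set x : R^o | x != 0] := @open_neq R 0.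
elim: k => [|k IH]; first by move=> x x0; exact: inv_continuous.
split=> [x x0|v]; first exact: differentiable_Rinv.
apply: (@Ck_ext _ _ _ _ (fun x : R^o => (- v) *: (x^-1 *: (x^-1 : R^o)) : R^o)) => //.
  move=> x x0; rewrite (diff_Rinv x0).
  by rewrite /GRing.scale/= -exprVn expr2 !mulNr mulrC.
by apply: CkZ => //; [exact: Ck_cst|exact: CkZ].
Qed.

(** The function r = x^(-1/2) satisfies r' = - r^3 / 2, so the induction closes on r alone.
    Normalizing a vector needs r rather than the square root. *)
Lemma Ck_rsqrt k : Ck k [set x : R^o | 0 < x] (fun x : R^o => (Num.sqrt x)^-1 : R^o).
Proof.
have oU : open [set x : R^o | 0 < x] by exact: open_gt.
have is_d (x : R) : 0 < x -> is_derive x 1 (fun y => (Num.sqrt y)^-1)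
    (- (Num.sqrt x)^-2 * (2 * Num.sqrt x)^-1).
  move=> x0; have s0 : Num.sqrt x != 0 by rewrite gt_eqF// sqrtr_gt0.
  have D := is_derive1_sqrt x0.
  exact: is_deriveV.
have dif (x : R^o) : 0 < x -> differentiable (fun x : R^o => (Num.sqrt x)^-1 : R^o) x.
  by move=> x0; apply/derivable1_diffP; case: (is_d x x0).
elim: k => [|k IH].
  by move=> x x0; apply: differentiable_continuous; exact: dif.
split=> [x x0|v]; first exact: dif.
apply: (@Ck_ext _ _ _ _ (fun x : R^o => (- v / 2) *: ((Num.sqrt x)^-1 *:
   ((Num.sqrt x)^-1 *: ((Num.sqrt x)^-1 : R^o))) : R^o)) => //.
  move=> x x0; rewrite deriv1E; last exact/derivable1_diffP/dif.
  rewrite derive1E; case: (is_d x x0) => _ ->.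
  have r0 : Num.sqrt x != 0 by rewrite gt_eqF// sqrtr_gt0.
  by move: (Num.sqrt x) r0 => r r0; rewrite /GRing.scale/=; field.
by do 3?[apply: CkZ => //]; exact: Ck_cst.
Qed.

End Calculus.

(** * Germs of smooth functions and their derivatives *)

Section SmoothNear.
Variable R : realType.
Implicit Types E F G : normedModType R.

(* A constant distinct from ['d], whose filter argument makes unification
   diverge when its lemmas are used for rewriting. *)
Definition der E F (f : E -> F) (x v : E) : F := 'd f x v.

Lemma der_is_linear E F (f : E -> F) x : linear (der f x).
Proof. by move=> a u v; rewrite /der linearP. Qed.

Lemma der0 E F (f : E -> F) x : der f x 0 = 0.
Proof. exact: linear0. Qed.

Lemma smooth_near_near E F (f : E -> F) x :
  smooth_near f x -> \forall y \near x, smooth_near f y.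
Proof.
move=> [U oU Uf]; apply: filterS (open_nbhs_nbhs oU) => y Uy.
by exists U => //; split => //; case: oU.
Qed.

Lemma smooth_near_differentiable E F (f : E -> F) x :
  smooth_near f x -> differentiable f x.
Proof. by move=> [U [_ Ux] /(_ 1%N)[df _]]; exact: df. Qed.

Lemma smooth_near_continuous E F (f : E -> F) x :
  smooth_near f x -> {for x, continuous f}.
Proof. by move=> [U [_ Ux] /(_ 0%N)]; exact. Qed.

Lemma smooth_near_ext E F (f g : E -> F) x : (\forall y \near x, f y = g y) ->
  smooth_near f x -> smooth_near g x.
Proof.
rewrite -nbhs_nearE nbhsE => -[V [oV Vx] fg] [U [oU Ux] Uf].
have oI := openI oU oV.
exists (U `&` V); first by split.
move=> k; apply: (@Ck_ext _ _ _ _ _ f) => //; first by move=> y [_ /fg].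
by apply: Ck_sub (Uf k) => y [].
Qed.

Lemma smooth_near_eq E F (f g : E -> F) x : f =1 g ->
  smooth_near f x -> smooth_near g x.
Proof. by move=> /funext ->. Qed.

Lemma der_ext E F (f g : E -> F) x v : (\forall y \near x, f y = g y) ->
  smooth_near f x -> der g x v = der f x v.
Proof.
move=> fg /smooth_near_differentiable df.
exact: (congr1 (@^~ v) (near_eq_diff fg df).2).
Qed.

Lemma smooth_near_cst E F (c : F) (x : E) : smooth_near (fun=> c) x.
Proof.
by exists setT => [|k]; [exact: (conj openT I)|exact: Ck_cst].
Qed.

Lemma der_cst E F (c : F) (x v : E) : der (fun=> c) x v = 0.
Proof. exact: (congr1 (@^~ v) (diff_cst c x)). Qed.

Lemma smooth_near_der E F (f : E -> F) x v :
  smooth_near f x -> smooth_near (fun y => der f y v) x.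
Proof. by move=> [U oU Uf]; exists U => // k; exact: (Uf k.+1).2. Qed.

Lemma smooth_near_clin E F (L : {linear E -> F}) x :
  continuous L -> smooth_near L x.
Proof.
move=> cL; exists setT => [|k]; first exact: (conj openT I).
have dL y : differentiable L y by exact: linear_differentiable.
case: k => [|k]; first by move=> y _; exact: cL.
split=> [y _ //|v].
apply: (@Ck_ext _ _ _ _ _ (cst (L v))); [exact: openT| |exact: Ck_cst].
by move=> y _; rewrite diff_lin.
Qed.

Lemma smooth_near_lin E F (L : {linear E -> F}) x : findim E -> smooth_near L x.
Proof. by move=> fE; apply: smooth_near_clin; exact: findim_continuous. Qed.

Lemma smooth_near_id E (x : E) : smooth_near id x.
Proof. by apply: (@smooth_near_clin _ _ idfun) => y; exact: cvg_id. Qed.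

Lemma smooth_near_comp E F G (f : E -> F) (g : F -> G) x : findim F ->
  smooth_near f x -> smooth_near g (f x) -> smooth_near (fun y => g (f y)) x.
Proof.
move=> fF sf [V [oV Vfx] Vg]; have [U [oU Ux] Uf] := sf.
have cf y : U y -> {for y, continuous f} by move: y; exact: (Uf 0%N).
have oW : open (U `&` f @^-1` V).
  rewrite openE => y [Uy Vy]; apply: filterI; first exact: open_nbhs_nbhs.
  by apply: (cf y Uy); exact: open_nbhs_nbhs.
exists (U `&` f @^-1` V) => // k.
apply: (@Ck_comp _ _ _ _ _ _ V f g) => //; first by move=> y [].
by apply: Ck_sub (Uf k) => y [].
Qed.

Lemma der_comp E F G (f : E -> F) (g : F -> G) x v :
  smooth_near f x -> smooth_near g (f x) ->
  der (fun y => g (f y)) x v = der g (f x) (der f x v).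
Proof.
move=> /smooth_near_differentiable df /smooth_near_differentiable dg.
exact: (congr1 (@^~ v) (diff_comp df dg)).
Qed.

Lemma der_clin E F (L : {linear E -> F}) (x v : E) :
  continuous L -> der L x v = L v.
Proof. by move=> cL; exact: (congr1 (@^~ v) (diff_lin x cL)). Qed.

Lemma der_lin E F (L : {linear E -> F}) (x v : E) : findim E -> der L x v = L v.
Proof. by move=> fE; apply: der_clin; exact: findim_continuous. Qed.

Lemma der_id E (x v : E) : der id x v = v.
Proof. by apply: (@der_clin _ _ idfun) => y; exact: cvg_id. Qed.

Lemma deriveE1 F (c : R^o -> F) t : smooth_near c t -> 'D_1 c t = der c t 1.
Proof. by move=> /smooth_near_differentiable dc; exact: deriveE. Qed.

(** One open set must serve all orders [k], so the two domains are intersected before the order is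
    fixed. *)
Lemma smooth_near2 E F F' G (f : E -> F) (f' : E -> F') (h : E -> G) x :
  (forall k U, open U -> Ck k U f -> Ck k U f' -> Ck k U h) ->
  smooth_near f x -> smooth_near f' x -> smooth_near h x.
Proof.
move=> H [U [oU Ux] Uf] [V [oV Vx] Vf].
have oI := openI oU oV.
exists (U `&` V); first by split.
move=> k; apply: H => //; [apply: Ck_sub (Uf k)|apply: Ck_sub (Vf k)];
  by move=> y [].
Qed.

Lemma smooth_nearD E F (f g : E -> F) x :
  smooth_near f x -> smooth_near g x -> smooth_near (fun y => f y + g y) x.
Proof. by apply: smooth_near2 => k U; exact: CkD. Qed.

Lemma derD E F (f g : E -> F) x v : smooth_near f x -> smooth_near g x ->
  der (fun y => f y + g y) x v = der f x v + der g x v.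
Proof.
move=> /smooth_near_differentiable df /smooth_near_differentiable dg.
exact: (congr1 (@^~ v) (diffD df dg)).
Qed.

Lemma smooth_nearZ E F (f : E -> R^o) (g : E -> F) x :
  smooth_near f x -> smooth_near g x -> smooth_near (fun y => f y *: g y) x.
Proof. by apply: smooth_near2 => k U; exact: CkZ. Qed.

Lemma smooth_nearN E F (f : E -> F) x :
  smooth_near f x -> smooth_near (fun y => - f y) x.
Proof.
move=> sf; by apply: smooth_near_eq (smooth_nearZ (smooth_near_cst (-1 : R^o) x) sf) => y;
    rewrite scaleN1r.
Qed.

Lemma derN E F (f : E -> F) x v : smooth_near f x ->
  der (fun y => - f y) x v = - der f x v.
Proof.
move=> /smooth_near_differentiable df.
exact: (congr1 (@^~ v) (diffN df)).
Qed.

Lemma smooth_nearM E (f g : E -> R^o) x :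
  smooth_near f x -> smooth_near g x -> smooth_near (fun y => f y * g y : R^o) x.
Proof. exact: smooth_nearZ. Qed.

Lemma smooth_near_pair E F G (f : E -> F) (g : E -> G) x :
  smooth_near f x -> smooth_near g x -> smooth_near (fun y => (f y, g y)) x.
Proof. by apply: smooth_near2 => k U; exact: Ck_pair. Qed.

Lemma der_pair E F G (f : E -> F) (g : E -> G) x v :
  smooth_near f x -> smooth_near g x ->
  der (fun y => (f y, g y)) x v = (der f x v, der g x v).
Proof.
move=> /smooth_near_differentiable df /smooth_near_differentiable dg.
exact: (congr1 (@^~ v) (diff_pair df dg)).
Qed.

Lemma smooth_near_sum E F I (r : seq I) (P : pred I) (f : I -> E -> F) x :
  (forall i, smooth_near (f i) x) -> smooth_near (fun y => \sum_(i <- r | P i) f i y) x.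
Proof.
move=> sf; elim: r => [|i r IH].
  by apply: smooth_near_eq (smooth_near_cst 0 x) => y; rewrite big_nil.
case Pi: (P i).
  by apply: smooth_near_eq (smooth_nearD (sf i) IH) => y; rewrite big_cons Pi.
by apply: smooth_near_eq IH => y; rewrite big_cons Pi.
Qed.

Lemma smooth_near_prod E I (r : seq I) (f : I -> E -> R^o) x :
  (forall i, smooth_near (f i) x) ->
  smooth_near (fun y => \prod_(i <- r) (f i y : R) : R^o) x.
Proof.
move=> sf; elim: r => [|i r IH].
  by apply: smooth_near_eq (smooth_near_cst (1 : R^o) x) => y; rewrite big_nil.
by apply: smooth_near_eq (smooth_nearM (sf i) IH) => y; rewrite big_cons.
Qed.

Lemma findim_prod E F : findim E -> findim F -> findim (E * F)%type.
Proof.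
move=> [I [e [c [cc ce]]]] [J [e' [c' [cc' ce']]]].
have l1 i : linear (fun p : E * F => c i p.1) by move=> a u v; rewrite linearP.
have l2 i : linear (fun p : E * F => c' i p.2) by move=> a u v; rewrite linearP.
pose L1 i : {linear (E * F)%type -> R^o} := HB.pack (fun p : E * F => c i p.1)
    (GRing.isLinear.Build _ _ _ _ _ (l1 i)).
pose L2 i : {linear (E * F)%type -> R^o} := HB.pack (fun p : E * F => c' i p.2)
    (GRing.isLinear.Build _ _ _ _ _ (l2 i)).
exists (I + J)%type, (fun i => match i with inl j => (e j, 0) | inr j => (0, e' j) end),
  (fun i => match i with inl j => L1 j | inr j => L2 j end); split.
  move=> [j|j] p.
    by apply: (@continuous_comp _ _ _ fst (c j)); [exact: cvg_fst|exact: cc].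
  by apply: (@continuous_comp _ _ _ snd (c' j)); [exact: cvg_snd|exact: cc'].
move=> [u v]; rewrite big_sumType/=.
rewrite (eq_bigr (fun i => (c i u *: e i, 0 : F))); last first.
  by move=> i _; congr pair; exact: scaler0.
rewrite [X in _ + X](eq_bigr (fun i => (0 : E, c' i v *: e' i))); last first.
  by move=> i _; congr pair; exact: scaler0.
have s1 (a : I -> E) (r : seq I) : \sum_(i <- r) (a i, 0 : F) = (\sum_(i <- r) a i, 0).
  elim: r => [|i r IH]; first by rewrite !big_nil.
  by rewrite !big_cons IH; congr pair; rewrite /= addr0.
have s2 (a : J -> F) (r : seq J) : \sum_(i <- r) (0 : E, a i) = (0, \sum_(i <- r) a i).
  elim: r => [|i r IH]; first by rewrite !big_nil.
  by rewrite !big_cons IH; congr pair; rewrite /= addr0.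
by rewrite s1 s2 -ce -ce'; congr pair; rewrite /= ?addr0 ?add0r.
Qed.

Lemma findim_regular : findim R^o.
Proof.
exists 'I_1, (fun=> 1 : R^o), (fun=> idfun); split; first by move=> i y; exact: cvg_id.
by move=> v; rewrite big_ord1 /= /GRing.scale/= mulr1.
Qed.

Definition mx_coord m n i j (A : 'M[R]_(m, n)) : R^o := A i j.

Lemma mx_coord_linear m n i j : linear (@mx_coord m n i j).
Proof. by move=> a A B; rewrite /mx_coord !mxE. Qed.

HB.instance Definition _ m n i j := GRing.isLinear.Build R 'M[R]_(m, n) R^o _
  (@mx_coord m n i j) (@mx_coord_linear m n i j).

Lemma findim_mx m n : findim 'M[R]_(m, n).
Proof.
exists ('I_m * 'I_n)%type, (fun ij => delta_mx ij.1 ij.2),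
  (fun ij => @mx_coord m n ij.1 ij.2).
split; first by move=> k; exact: coord_continuous.
by move=> A; rewrite {1}[A]matrix_sum_delta pair_big.
Qed.

Lemma smooth_near_mx m n E (f : E -> 'M[R]_(m, n)) x :
  (forall i j, smooth_near (fun y => f y i j : R^o) x) -> smooth_near f x.
Proof.
move=> sf.
have := smooth_near_sum (index_enum _) xpredT (fun i => smooth_near_sum (index_enum _) xpredT
  (fun j => smooth_nearZ (sf i j) (smooth_near_cst (delta_mx i j : 'M[R]_(m, n)) x))).
by apply: smooth_near_eq => y; rewrite -matrix_sum_delta.
Qed.

Lemma smooth_near_coord m n E (f : E -> 'M[R]_(m, n)) x i j :
  smooth_near f x -> smooth_near (fun y => f y i j : R^o) x.
Proof.
move=> sf; apply: (@smooth_near_comp _ _ _ f (@mx_coord m n i j)) => //.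
  exact: findim_mx.
by apply: smooth_near_lin; exact: findim_mx.
Qed.

Lemma der_coord m n E (f : E -> 'M[R]_(m, n)) x v i j : smooth_near f x ->
  der (fun y => f y i j : R^o) x v = der f x v i j.
Proof.
move=> sf; have sL : smooth_near (@mx_coord m n i j) (f x).
  by apply: smooth_near_lin; exact: findim_mx.
apply: etrans (der_comp v sf sL) _.
by rewrite der_lin //; exact: findim_mx.
Qed.

Lemma smooth_near_mulmx m n p E (f : E -> 'M[R]_(m, n)) (g : E -> 'M[R]_(n, p)) x :
  smooth_near f x -> smooth_near g x -> smooth_near (fun y => f y *m g y) x.
Proof.
move=> sf sg; apply: smooth_near_mx => i j.
have := smooth_near_sum (index_enum _) xpredT
    (fun k => smooth_nearM (smooth_near_coord i k sf) (smooth_near_coord k j sg)).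
by apply: smooth_near_eq => y; rewrite mxE.
Qed.

Lemma mulmx_continuous m n p : continuous (fun q : 'M[R]_(m, n) * 'M[R]_(n, p) => q.1 *m q.2).
Proof.
move=> q; apply: smooth_near_continuous; apply: smooth_near_mulmx.
  by apply: (@smooth_near_clin _ _ fst) => y; exact: cvg_fst.
by apply: (@smooth_near_clin _ _ snd) => y; exact: cvg_snd.
Qed.

Lemma der_mulmx m n p E (f : E -> 'M[R]_(m, n)) (g : E -> 'M[R]_(n, p)) x v :
  smooth_near f x -> smooth_near g x ->
  der (fun y => f y *m g y) x v = f x *m der g x v + der f x v *m g x.
Proof.
move=> /smooth_near_differentiable df /smooth_near_differentiable dg.
have dB := @differentiable_bilin _ _ _ _ (@mulmx R m n p) (f x, g x) (@mulmx_continuous m n p).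
apply: etrans (congr1 (@^~ v) (diff_comp (differentiable_pair df dg) dB)) _.
have dp := congr1 (@^~ v) (diff_pair df dg).
apply: etrans (congr1 (@^~ _) (diff_bilin (f x, g x) (@mulmx_continuous m n p))) _.
by rewrite [X in _ *m X.2 + _]dp [X in _ + X.1 *m _]dp.
Qed.

Lemma der_mulmxl m n p E (c : 'M[R]_(m, n)) (g : E -> 'M[R]_(n, p)) x v :
  smooth_near g x -> der (fun y => c *m g y) x v = c *m der g x v.
Proof.
move=> sg; rewrite (der_mulmx v (smooth_near_cst c x) sg).
by rewrite der_cst mul0mx addr0.
Qed.

Lemma der_mulmxr m n p E (c : 'M[R]_(n, p)) (f : E -> 'M[R]_(m, n)) x v :
  smooth_near f x -> der (fun y => f y *m c) x v = der f x v *m c.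
Proof.
move=> sf; rewrite (der_mulmx v sf (smooth_near_cst c x)).
by rewrite der_cst mulmx0 add0r.
Qed.

Lemma smooth_near_inv E (f : E -> R^o) x : f x != 0 -> smooth_near f x ->
  smooth_near (fun y => (f y)^-1 : R^o) x.
Proof.
move=> f0 sf; apply: (@smooth_near_comp _ _ _ f (fun t : R^o => t^-1 : R^o)) => //.
  exact: findim_regular.
by exists [set t | t != 0] => [|k]; [exact: (conj (@open_neq R 0) f0)|exact: Ck_inv].
Qed.

Lemma smooth_near_rsqrt E (f : E -> R^o) x : 0 < f x -> smooth_near f x ->
  smooth_near (fun y => (Num.sqrt (f y))^-1 : R^o) x.
Proof.
move=> f0 sf; apply: (@smooth_near_comp _ _ _ f (fun t : R^o => (Num.sqrt t)^-1 : R^o)) => //.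
  exact: findim_regular.
have oU : open [set t : R^o | 0 < t] by exact: open_gt.
by exists [set t | 0 < t] => [|k]; [exact: (conj oU f0)|exact: Ck_rsqrt].
Qed.

Lemma smooth_near_det n E (f : E -> 'M[R]_n) x : smooth_near f x ->
  smooth_near (fun y => \det (f y) : R^o) x.
Proof.
move=> sf; apply: smooth_near_sum => s; apply: smooth_nearM.
  exact: smooth_near_cst.
by apply: smooth_near_prod => i; exact: smooth_near_coord.
Qed.

Lemma near_unitmx n (T : topologicalType) (f : T -> 'M[R]_n) x :
  {for x, continuous f} -> f x \in unitmx -> \forall y \near x, f y \in unitmx.
Proof.
move=> cf ufx.
have cd : {for x, continuous (fun y => \det (f y) : R^o)}.
  apply: (@continuous_comp _ _ _ f (fun A => \det A : R^o)) => //.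
  by apply: smooth_near_continuous; apply: smooth_near_det; exact: smooth_near_id.
have d0 : \det (f x) != 0 by rewrite -unitfE -unitmxE.
have : \forall y \near x, \det (f y) != 0.
  exact: cd _ (open_nbhs_nbhs (conj (@open_neq R 0) d0)).
apply: filterS => y /=.
by rewrite -unitfE -unitmxE.
Qed.

Lemma smooth_near_invmx n E (f : E -> 'M[R]_n) x : f x \in unitmx -> smooth_near f x ->
  smooth_near (fun y => invmx (f y)) x.
Proof.
move=> ufx sf.
have d0 : (\det (f x) : R^o) != 0 by rewrite -unitfE -unitmxE.
have sa : smooth_near (fun y => \adj (f y)) x.
  apply: smooth_near_mx => i j.
  have : smooth_near (fun y => (-1) ^+ (j + i) * \det (row' j (col' i (f y))) : R^o) x.
    apply: smooth_nearM; first exact: smooth_near_cst.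
    apply: smooth_near_det; apply: smooth_near_mx => k l.
    by apply: smooth_near_eq (smooth_near_coord (lift j k) (lift i l) sf) => y; rewrite !mxE.
  by apply: smooth_near_eq => y; rewrite !mxE.
have si := @smooth_near_inv _ (fun y => \det (f y) : R^o) x d0 (smooth_near_det sf).
apply: smooth_near_ext (smooth_nearZ si sa).
(* [invmx] is adjugate over determinant only on invertible matrices, hence an equality that holds
   near [x]. *)
have := near_unitmx (smooth_near_continuous sf) ufx.
by apply: filterS => y uy; rewrite /invmx uy.
Qed.

End SmoothNear.

(** * The Lorentz group and the Cayley transform *)

Section LorentzGram.
Context {R : realType} {m : nat}.
Implicit Types (v w t : 'cV[R]_m.+2) (A B X : 'M[R]_m.+2).

Definition gram : 'M[R]_m.+2 := tperm_mx ord0 ord_max.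

(** The Lie algebra of the Lorentz group, as [lie_algebra_lorentz] confirms. *)
Definition skew_alg X := X^T *m gram + gram *m X = 0.

Lemma gram_tr : gram^T = gram.
Proof. by rewrite /gram /tperm_mx tr_perm_mx tpermV. Qed.

Lemma gram_sqr : gram *m gram = 1%:M.
Proof. by rewrite /gram /tperm_mx -perm_mxM tperm2 perm_mx1. Qed.

Lemma lorentz_delta (M : 'M[R]_m.+2) i j : ((delta_mx i 0 : 'cV_m.+2)^T *m M *m
  (delta_mx j 0 : 'cV_m.+2)) 0 0 = M i j.
Proof. by rewrite trmx_delta -rowE -colE !mxE. Qed.

Lemma lorentz_isometryP A : (forall v w, lorentz (A *m v) (A *m w) = lorentz v w) <->
  A^T *m gram *m A = gram.
Proof.
split=> [isoA|AJA v w]; last first.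
  by rewrite /lorentz -/gram -{2}AJA trmx_mul !mulmxA.
apply/matrixP => i j; have := isoA (delta_mx i 0) (delta_mx j 0).
by rewrite /lorentz -/gram trmx_mul !mulmxA -(mulmxA _ A^T) -(mulmxA _ (A^T *m gram))
    !lorentz_delta.
Qed.

Lemma lorentzC v w : lorentz v w = lorentz w v.
Proof.
have -> : lorentz v w = (v^T *m gram *m w)^T 0 0 by rewrite mxE.
by rewrite !trmx_mul trmxK gram_tr mulmxA.
Qed.

Lemma lorentzDl v v' w : lorentz (v + v') w = lorentz v w + lorentz v' w.
Proof. by rewrite /lorentz linearD /= !mulmxDl mxE. Qed.

Lemma lorentzZl a v w : lorentz (a *: v) w = a * lorentz v w.
Proof. by rewrite /lorentz linearZ /= -!scalemxAl mxE. Qed.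

Lemma lorentzDr v w w' : lorentz v (w + w') = lorentz v w + lorentz v w'.
Proof. by rewrite !(lorentzC v) lorentzDl. Qed.

Lemma lorentzZr a v w : lorentz v (a *: w) = a * lorentz v w.
Proof. by rewrite !(lorentzC v) lorentzZl. Qed.

Lemma lorentzNr v w : lorentz v (- w) = - lorentz v w.
Proof. by rewrite -scaleN1r lorentzZr mulN1r. Qed.

Lemma lorentzE v w : lorentz v w = \sum_i v i 0 * w (tperm ord0 ord_max i) 0.
Proof.
rewrite /lorentz -mulmxA mxE; apply: eq_bigr => i _.
by rewrite mxE -row_permE mxE.
Qed.

Lemma lorentz_ell v : lorentz v ell = v ord_max 0.
Proof.
rewrite lorentzE (bigD1 ord_max)//= tpermR mxE !eqxx mulr1 big1 ?addr0// => i im.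
rewrite mxE; case: tpermP => [->|im'|/eqP i0 _]; rewrite ?mulr0 //.
  by rewrite im' eqxx in im.
by rewrite (negPf i0) mulr0.
Qed.

Lemma lorentz_enn v : lorentz v enn = v ord0 0.
Proof.
rewrite lorentzE (bigD1 ord0)//= tpermL mxE !eqxx mulr1 big1 ?addr0// => i i0.
rewrite mxE; case: tpermP => [i0'|->|_ /eqP im]; rewrite ?mulr0 //.
  by rewrite i0' eqxx in i0.
by rewrite (negPf im) mulr0.
Qed.

Definition timelike0 : 'cV[R]_m.+2 := ell - enn.

Lemma lorentz_timelike0 v : lorentz v timelike0 = v ord_max 0 - v ord0 0.
Proof. by rewrite lorentzDr lorentzNr lorentz_ell lorentz_enn. Qed.

Lemma ell_max : (ell : 'cV[R]_m.+2) ord_max 0 = 0.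
Proof. by rewrite mxE. Qed.
Lemma ell_0 : (ell : 'cV[R]_m.+2) ord0 0 = 1.
Proof. by rewrite mxE. Qed.
Lemma enn_max : (enn : 'cV[R]_m.+2) ord_max 0 = 1.
Proof. by rewrite mxE !eqxx. Qed.
Lemma enn_0 : (enn : 'cV[R]_m.+2) ord0 0 = 0.
Proof. by rewrite mxE. Qed.

Lemma timelike0_sqr : lorentz timelike0 timelike0 = -2.
Proof.
have E i : timelike0 i 0 = ell i 0 - enn i 0 by rewrite !mxE.
rewrite lorentz_timelike0 !E ell_max ell_0 enn_max enn_0; lra.
Qed.

(** Orthogonality to [timelike0] makes the two extreme coordinates equal; the Gram matrix exchanges
    them, so the form becomes a sum of squares. *)
Lemma lorentz_ge0 v : lorentz v timelike0 = 0 -> 0 <= lorentz v v.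
Proof.
rewrite lorentz_timelike0 => /eqP; rewrite subr_eq0 => /eqP v0m.
rewrite lorentzE; apply: sumr_ge0 => i _.
by case: tpermP => [->|->|_ _]; rewrite ?v0m -?expr2 ?sqr_ge0// -v0m -expr2 sqr_ge0.
Qed.

(* The combination of [v] and [t] orthogonal to [timelike0] has non-negative
   square; this replaces the reversed Cauchy-Schwarz inequality. *)
Lemma lorentz_causal_lt0 v t : lorentz v v = 0 -> lorentz v timelike0 < 0 ->
  lorentz t t < 0 -> lorentz t timelike0 < 0 -> lorentz v t < 0.
Proof.
move=> vv v0 tt t0.
set a := lorentz v timelike0 in v0; set b := lorentz t timelike0 in t0.
have : 0 <= lorentz (b *: v + (- a) *: t) (b *: v + (- a) *: t).
  apply: lorentz_ge0; rewrite lorentzDl !lorentzZl -/a -/b; ring.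
rewrite !(lorentzDl, lorentzDr, lorentzZl, lorentzZr) vv (lorentzC t v).
move: (lorentz v t) (lorentz t t) tt => q s s0 le0; rewrite ltNge; apply/negP => q0.
have ab : 0 < a * b by rewrite nmulr_rgt0.
have aas : 0 < a * a * - s by rewrite mulr_gt0 ?nmulr_rgt0 ?oppr_gt0.
by have := mulr_ge0 (ltW ab) q0; lra.
Qed.

(** The single vector [timelike0] tests the time orientation: for a future null v, the product of B
    v with [timelike0] is that of v with B^-1 [timelike0], negative by [lorentz_causal_lt0]. The
    test passes from A to its inverse by symmetry of the form, which gives both directions of the
    equivalence. *)
Lemma lorentz_groupI A : A^T *m gram *m A = gram ->
  lorentz (A *m timelike0) timelike0 < 0 -> lorentz_group R m A.
Proof.
move=> AJA A0; have isoA := (lorentz_isometryP A).2 AJA.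
have uA : A \in unitmx.
  have /mulmx1_unit[] // : (gram *m A^T *m gram) *m A = 1%:M.
  by rewrite -!mulmxA [A^T *m _]mulmxA AJA gram_sqr.
have isoV v w : lorentz (invmx A *m v) (invmx A *m w) = lorentz v w.
  by rewrite -isoA !mulKVmx.
have step B : (forall v w, lorentz (B *m v) (B *m w) = lorentz v w) ->
    B \in unitmx -> lorentz (invmx B *m timelike0) timelike0 < 0 ->
    forall v, future_cone v -> future_cone (B *m v).
  move=> isoB uB B0 v [vn0 vv v0]; split; last 1 first.
  - rewrite -[ell - enn](mulKVmx uB) isoB; apply: lorentz_causal_lt0 => //.
    by rewrite -isoB !mulKVmx // timelike0_sqr oppr_lt0.
  - by apply: contra vn0 => /eqP Bv; rewrite -[v](mulKmx uB) Bv mulmx0.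
  - by rewrite isoB.
have A0' : lorentz (invmx A *m timelike0) timelike0 < 0.
  by rewrite -isoA mulKVmx // lorentzC.
split=> // v; split; last exact: step.
move=> fAv; rewrite -[v](mulKmx uA); apply: step fAv => //.
- by rewrite unitmx_inv.
- by rewrite invmxK.
Qed.

(** Put T = [timelike0]. Since A fixes [ell], the product of A T with [ell] is still -1. If A T were
    past-directed, - A T would be a future timelike vector with product +1 with [ell], against
    [lorentz_causal_lt0]; and A T cannot be orthogonal to T, because its square is -2. *)
Lemma isotropyP A : isotropy R m A <-> A^T *m gram *m A = gram /\ A *m ell = ell.
Proof.
split=> [[[isoA _] Al]|[AJA Al]]; first by split => //; exact/lorentz_isometryP.
have isoA := (lorentz_isometryP A).2 AJA.
split=> //; apply: lorentz_groupI => //.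
have AT : lorentz (A *m timelike0) (A *m timelike0) = -2.
  by rewrite isoA timelike0_sqr.
have Al0 : lorentz ell (A *m timelike0) = -1.
  by rewrite -{1}Al isoA lorentz_timelike0 ell_max ell_0 sub0r.
case: (ltgtP (lorentz (A *m timelike0) timelike0) 0) => // [AT0|AT0].
  suff : lorentz ell (- (A *m timelike0)) < 0 by rewrite lorentzNr Al0; lra.
  apply: lorentz_causal_lt0.
  - by rewrite lorentz_ell ell_max.
  - by rewrite lorentz_timelike0 ell_max ell_0 sub0r; lra.
  - by rewrite lorentzNr lorentzC lorentzNr AT; lra.
  - by rewrite lorentzC lorentzNr lorentzC; lra.
by have := lorentz_ge0 AT0; rewrite AT; lra.
Qed.

End LorentzGram.
Arguments gram R m : clear implicits.

Section Cayley.
Variables (R : realType) (n : nat).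
Implicit Types (A X J : 'M[R]_n).

Definition cayley X := (1%:M + X) *m invmx (1%:M - X).
Definition cayley_inv A := (A - 1%:M) *m invmx (1%:M + A).

Lemma cayleyE X : 1%:M - X \in unitmx -> cayley X *m (1%:M - X) = 1%:M + X.
Proof. by move=> uX; rewrite mulmxKV. Qed.

Lemma cayley_add1 X : 1%:M - X \in unitmx -> (1%:M + cayley X) *m (1%:M - X) = 2%:M.
Proof.
move=> uX; rewrite mulmxDl cayleyE // mul1mx addrACA addNr addr0.
by rewrite -[RHS]/((1 + 1)%:M) raddfD.
Qed.

Lemma cayley_unit X : 1%:M - X \in unitmx -> 1%:M + cayley X \in unitmx.
Proof.
move=> /cayley_add1 e.
have /mulmx1_unit[] // : (1%:M + cayley X) *m (2^-1 *: (1%:M - X)) = 1%:M.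
by rewrite -scalemxAr e -scalemx1 scalerA mulVf ?scale1r // pnatr_eq0.
Qed.

Lemma cayleyK X : 1%:M - X \in unitmx -> cayley_inv (cayley X) = X.
Proof.
move=> uX; have uc := cayley_unit uX.
apply: (can_inj (mulmxK uc)); rewrite mulmxKV //.
apply: (can_inj (mulmxK uX)); rewrite mulmxBl cayleyE // mul1mx -mulmxA cayley_add1 //.
by rewrite mul_mx_scalar scaler_nat opprB mulr2n addrC addrA subrK.
Qed.

Lemma cayley_invE A : 1%:M + A \in unitmx -> cayley_inv A *m (1%:M + A) = A - 1%:M.
Proof. by move=> uA; rewrite mulmxKV. Qed.

Lemma cayley_inv_sub1 A : 1%:M + A \in unitmx ->
  (1%:M - cayley_inv A) *m (1%:M + A) = 2%:M.
Proof.
move=> uA; rewrite mulmxBl cayley_invE // mul1mx opprB addrA.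
by rewrite addrAC addrK -[RHS]/((1 + 1)%:M) raddfD.
Qed.

Lemma cayley_inv_unit A : 1%:M + A \in unitmx -> 1%:M - cayley_inv A \in unitmx.
Proof.
move=> /cayley_inv_sub1 e.
have /mulmx1_unit[] // : (1%:M - cayley_inv A) *m (2^-1 *: (1%:M + A)) = 1%:M.
by rewrite -scalemxAr e -scalemx1 scalerA mulVf ?scale1r // pnatr_eq0.
Qed.

Lemma cayley_invK A : 1%:M + A \in unitmx -> cayley (cayley_inv A) = A.
Proof.
move=> uA; have uc := cayley_inv_unit uA.
apply: (can_inj (mulmxK uc)); rewrite mulmxKV //.
apply: (can_inj (mulmxK uA)); rewrite mulmxDl cayley_invE // mul1mx -mulmxA cayley_inv_sub1 //.
by rewrite mul_mx_scalar scaler_nat mulr2n addrC addrA subrK.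
Qed.

End Cayley.

(** * Cayley coordinates on the isotropy group and the Lie algebras *)

Section CayleyIsotropy.
Context {R : realType} {m : nat}.
Implicit Types (A X : 'M[R]_m.+2).
Local Notation J := (gram R m).

(* The Cayley transform identifies a neighborhood of the identity in the isotropy
   group with an open set of its Lie algebra, rationally in both directions. *)
Lemma cayley_gram X : skew_alg X -> 1%:M - X \in unitmx ->
  (cayley X)^T *m J *m cayley X = J.
Proof.
move=> sX uX; have XJ : X^T *m J = - (J *m X) by apply/eqP; rewrite -addr_eq0 sX.
have uXT : (1%:M - X)^T \in unitmx by rewrite unitmx_tr.
apply: (can_inj (mulmxK uX)); apply: (can_inj (mulKmx uXT)).
have := cayleyE uX; move: (cayley X) => C CE.
have -> : (1%:M - X)^T *m (C^T *m J *m C *m (1%:M - X))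
   = (C *m (1%:M - X))^T *m J *m (C *m (1%:M - X)) by rewrite trmx_mul !mulmxA.
rewrite CE mulmxA ?linearD ?linearN /= ?trmx1.
rewrite ?mulmxDl ?mulmxDr ?mulNmx ?mulmxN ?mul1mx ?mulmx1 XJ ?mulNmx.
move: (J) (J *m X) (J *m X *m X) => a b c; apply/matrixP => i j; rewrite !mxE; lra.
Qed.

Lemma cayley_inv_skew A : A^T *m J *m A = J -> 1%:M + A \in unitmx ->
  skew_alg (cayley_inv A).
Proof.
move=> AJA uA; have uAT : (1%:M + A)^T \in unitmx by rewrite unitmx_tr.
apply: (can_inj (mulmxK uA)); apply: (can_inj (mulKmx uAT)).
rewrite mul0mx mulmx0 mulmxDl mulmxDr.
have := cayley_invE uA; move: (cayley_inv A) => C CE.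
have -> : (1%:M + A)^T *m ((C)^T *m J *m (1%:M + A))
   = (C *m (1%:M + A))^T *m J *m (1%:M + A) by rewrite trmx_mul !mulmxA.
have -> : (1%:M + A)^T *m (J *m C *m (1%:M + A))
   = (1%:M + A)^T *m J *m (C *m (1%:M + A)) by rewrite !mulmxA.
rewrite CE ?linearD ?linearN /= ?trmx1 ?mulmxDl ?mulNmx ?mulmxDr ?mulmxN.
rewrite ?mul1mx ?mulmx1 AJA.
move: (J) (J *m A) (A^T *m J) => a b c; apply/matrixP => i j; rewrite !mxE; lra.
Qed.

Lemma cayley_ell X : X *m ell = 0 :> 'cV[R]_m.+2 -> 1%:M - X \in unitmx -> cayley X *m ell = ell.
Proof.
move=> Xl uX; have e : (1%:M - X) *m ell = ell :> 'cV[R]_m.+2 by rewrite mulmxBl mul1mx Xl subr0.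
by rewrite -{1}e mulmxA cayleyE // mulmxDl mul1mx Xl addr0.
Qed.

Lemma cayley_inv_ell A : A *m ell = ell :> 'cV[R]_m.+2 -> 1%:M + A \in unitmx ->
  cayley_inv A *m ell = 0 :> 'cV[R]_m.+2.
Proof.
move=> Al uA; have e : (1%:M + A) *m ell = 2 *: ell :> 'cV[R]_m.+2.
  by rewrite mulmxDl mul1mx Al scaler_nat mulr2n.
have e2 : (2 : R) != 0 by rewrite pnatr_eq0.
apply: (scalerI e2); rewrite scaler0 scalemxAr -e mulmxA cayley_invE // mulmxBl mul1mx Al subrr.
by [].
Qed.

Definition isotropy_alg X := skew_alg X /\ X *m ell = 0.

Lemma cayley_isotropy X : isotropy_alg X -> 1%:M - X \in unitmx -> isotropy R m (cayley X).
Proof.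
move=> [sX Xl] uX; apply/isotropyP; split; first exact: cayley_gram.
exact: cayley_ell.
Qed.

Lemma cayley_inv_isotropy A : isotropy R m A -> 1%:M + A \in unitmx ->
  isotropy_alg (cayley_inv A).
Proof.
move=> /isotropyP[AJA Al] uA; split; first exact: cayley_inv_skew.
exact: cayley_inv_ell.
Qed.

(** The algebra is the kernel of the linear map [phi]; a basis of this kernel and its pseudo-inverse
    give the coordinates. The dimension stays a rank, as the charts only need some row space as
    model. *)
Lemma isotropy_alg_coord : exists d (k : {linear 'M[R]_m.+2 -> 'rV[R]_d})
    (k' : {linear 'rV[R]_d -> 'M[R]_m.+2}),
  [/\ forall e, isotropy_alg (k' e), cancel k' k &
      forall X, isotropy_alg X -> k' (k X) = X].
Proof.
pose phi X := row_mx (X^T *m J + J *m X) (X *m ell).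
have lphi : linear phi.
  move=> a X Y; rewrite /phi linearP /= !mulmxDl mulmxDr -!scalemxAl -!scalemxAr.
  by rewrite scale_row_mx add_row_mx scalerDr addrACA.
pose L : {linear 'M[R]_m.+2 -> 'M[R]_(m.+2, m.+2 + 1)} :=
  HB.pack phi (GRing.isLinear.Build _ _ _ _ _ lphi).
pose K := row_base (kermx (lin_mx L)).
have phi0 X : (mxvec X <= K)%MS <-> isotropy_alg X.
  rewrite /K eq_row_base; split=> [/sub_kermxP|[sX Xl]].
    rewrite mul_vec_lin => /(congr1 vec_mx); rewrite mxvecK linear0 /= /phi.
    by rewrite -[RHS](row_mx0) => /eq_row_mx[].
  by apply/sub_kermxP; rewrite mul_vec_lin /= /phi sX Xl row_mx0 linear0.
have l1 : linear (fun X : 'M[R]_m.+2 => mxvec X *m pinvmx K).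
  by move=> a X Y; rewrite linearP /= mulmxDl scalemxAl.
have l2 : linear (fun e => vec_mx (e *m K) : 'M[R]_m.+2).
  by move=> a X Y; rewrite mulmxDl -scalemxAl linearP.
pose L1 : {linear 'M[R]_m.+2 -> 'rV[R]_(\rank (kermx (lin_mx L)))} :=
  HB.pack (fun X : 'M[R]_m.+2 => mxvec X *m pinvmx K) (GRing.isLinear.Build _ _ _ _ _ l1).
pose L2 : {linear 'rV[R]_(\rank (kermx (lin_mx L))) -> 'M[R]_m.+2} :=
  HB.pack (fun e => vec_mx (e *m K)) (GRing.isLinear.Build _ _ _ _ _ l2).
exists (\rank (kermx (lin_mx L))), L1, L2; split=> [e|e|X hX] /=.
- by apply/phi0; rewrite vec_mxK submxMl.
- by rewrite vec_mxK mulmxKp // row_base_free.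
- by rewrite mulmxKpV ?mxvecK //; apply/phi0.
Qed.

Lemma smooth_near_cayley (E : normedModType R) (f : E -> 'M[R]_m.+2) x :
  smooth_near f x -> 1%:M - f x \in unitmx -> smooth_near (fun y => cayley (f y)) x.
Proof.
move=> sf u; apply: smooth_near_mulmx.
  by apply: smooth_nearD => //; exact: smooth_near_cst.
apply: smooth_near_invmx => //; apply: smooth_nearD; first exact: smooth_near_cst.
exact: smooth_nearN.
Qed.

Lemma smooth_near_cayley_inv (E : normedModType R) (f : E -> 'M[R]_m.+2) x :
  smooth_near f x -> 1%:M + f x \in unitmx -> smooth_near (fun y => cayley_inv (f y)) x.
Proof.
move=> sf u; apply: smooth_near_mulmx.
  by apply: smooth_nearD => //; exact: smooth_near_cst.
by apply: smooth_near_invmx => //; apply: smooth_nearD => //; exact: smooth_near_cst.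
Qed.

Lemma smooth_near_trmx (E : normedModType R) n p (f : E -> 'M[R]_(n, p)) x :
  smooth_near f x -> smooth_near (fun y => (f y)^T) x.
Proof.
move=> sf; apply: (@smooth_near_comp _ _ _ _ f (@trmx R n p)) => //; first exact: findim_mx.
by apply: smooth_near_lin; exact: findim_mx.
Qed.

Lemma der_trmx (E : normedModType R) n p (f : E -> 'M[R]_(n, p)) x v :
  smooth_near f x -> der (fun y => (f y)^T) x v = (der f x v)^T.
Proof.
move=> sf; rewrite (@der_comp _ _ _ _ f (@trmx R n p)) //.
  by rewrite der_lin //; exact: findim_mx.
by apply: smooth_near_lin; exact: findim_mx.
Qed.

Lemma der_gram (E : normedModType R) (f : E -> 'M[R]_m.+2) x v : smooth_near f x ->
  (\forall y \near x, (f y)^T *m J *m f y = J) ->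
  (der f x v)^T *m J *m f x + (f x)^T *m J *m der f x v = 0.
Proof.
move=> sf fJ; have sfT := smooth_near_trmx sf.
have sJ : smooth_near (fun y => (f y)^T *m J) x.
  by apply: smooth_near_mulmx => //; exact: smooth_near_cst.
have := der_ext v fJ (smooth_near_mulmx sJ sf).
by rewrite der_cst der_mulmx // der_mulmxr // der_trmx // addrC.
Qed.

(** At 0 the Cayley transform doubles directions, hence the curve [cayley (t / 2 X)]. The same curve
    serves both groups: it fixes [ell] as soon as X kills [ell]. *)
Lemma cayley_curve X : skew_alg X -> exists2 c : R^o -> 'M[R]_m.+2,
  curve_at_id (lorentz_group R m) c /\ (X *m ell = 0 -> curve_at_id (isotropy R m) c) &
  'D_1 c 0 = X.
Proof.
move=> sX; pose h (t : R^o) := (t / 2) *: X.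
have lh : linear h by move=> a s t; rewrite /h mulrDl scalerDl scalerA mulrA.
pose L : {linear R^o -> 'M[R]_m.+2} := HB.pack h (GRing.isLinear.Build _ _ _ _ _ lh).
have sh : smooth_near h 0 by apply: (@smooth_near_lin _ _ _ L); exact: findim_regular.
have h0 : h 0 = 0 by rewrite /h mul0r scale0r.
have u0 : 1%:M - h 0 \in unitmx by rewrite h0 subr0 unitmx1.
have sc := smooth_near_cayley sh u0.
have c0 : cayley (h 0) = 1%:M by rewrite /cayley h0 addr0 subr0 invmx1 mulmx1.
have snN : smooth_near (fun t => - h t) 0 by exact: smooth_nearN.
have snh : smooth_near (fun t => 1%:M - h t) 0.
  by apply: smooth_nearD => //; exact: smooth_near_cst.
have nu := near_unitmx (smooth_near_continuous snh) u0.
have sht t : skew_alg (h t).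
  by rewrite /skew_alg /h linearZ /= -scalemxAl -scalemxAr -scalerDr sX scaler0.
exists (fun t => cayley (h t)); [split|].
- split=> //.
  (* The time-orientation test of [lorentz_groupI] is an open condition that holds at t = 0. *)
  have cT : {for (0 : R^o), continuous (fun t => lorentz (cayley (h t) *m timelike0) timelike0 :
      R^o)}.
    apply: smooth_near_continuous; apply: (@smooth_near_coord _ _ _ _
      (fun t => (cayley (h t) *m timelike0)^T *m tperm_mx ord0 ord_max *m timelike0)).
    apply: smooth_near_mulmx; last exact: smooth_near_cst.
    apply: smooth_near_mulmx; last exact: smooth_near_cst.
    apply: (@smooth_near_comp _ _ _ _ _ (@trmx R m.+2 1)); first exact: findim_mx.
      by apply: smooth_near_mulmx => //; exact: smooth_near_cst.
    by apply: smooth_near_lin; exact: findim_mx.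
  have T0 : lorentz (cayley (h 0) *m timelike0) timelike0 < (0 : R).
    by rewrite c0 mul1mx timelike0_sqr oppr_lt0.
  have oU : open [set t : R^o | t < 0] by exact: open_lt.
  have nT : \forall t \near (0 : R^o), lorentz (cayley (h t) *m timelike0) timelike0 < (0 : R).
    exact: cT _ (open_nbhs_nbhs (conj oU T0)).
  apply: filterS2 nu nT => t ut Tt; apply: lorentz_groupI => //.
  exact: cayley_gram.
- move=> Xl; split=> //; apply: filterS nu => t ut; apply: cayley_isotropy => //.
  by split=> //; rewrite /h -scalemxAl Xl scaler0.
- rewrite deriveE1 //.
  have dh : der h 0 1 = 2^-1 *: X.
    by rewrite (@der_lin _ _ _ L) /= ?/h ?mul1r //; exact: findim_regular.
  (* Differentiating this identity avoids differentiating an inverse matrix. *)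
  have e : \forall t \near (0 : R^o), cayley (h t) *m (1%:M - h t) = 1%:M + h t.
    by apply: filterS nu => t ut; rewrite cayleyE.
  have s1 : smooth_near (fun=> 1%:M : 'M[R]_m.+2) (0 : R^o) by exact: smooth_near_cst.
  have := der_ext (1 : R^o) e (smooth_near_mulmx sc snh).
  rewrite (derD _ s1 sh) (der_mulmx _ sc snh) (derD _ s1 snN) (derN _ sh) dh !der_cst.
  rewrite c0 h0 subr0 mul1mx mulmx1 !add0r.
  move/eqP; rewrite addrC -subr_eq opprK => /eqP <-.
  by rewrite -scalerDl -[2^-1 + _]mulr2n -[_ *+ 2]mulr_natr mulVf ?scale1r // pnatr_eq0.
Qed.

Lemma lie_algebra_lorentz X : lie_algebra (lorentz_group R m) X <-> skew_alg X.
Proof.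
split=> [[c [sc c0 nc] <-]|/cayley_curve[c [cc _] <-]]; last by exists c.
rewrite deriveE1 //; have := @der_gram _ c 0 1 sc.
rewrite c0 trmx1 mul1mx mulmx1; apply.
by apply: filterS nc => t [/lorentz_isometryP].
Qed.

End CayleyIsotropy.

(** * Smooth functions on manifolds *)

Lemma near_all (T : topologicalType) (x : T) (A : set T) :
  (forall y, A y) -> \forall y \near x, A y.
Proof. by move=> HA; exact: nearW. Qed.

Lemma near_continuous (T U : topologicalType) (f : T -> U) (x : T) (A : set U) :
  {for x, continuous f} -> (\forall y \near f x, A y) -> \forall z \near x, A (f z).
Proof. by move=> cf nA; exact: cf _ nA. Qed.

Lemma continuous_pair (T U V : topologicalType) (f : T -> U) (g : T -> V) t :
  {for t, continuous f} -> {for t, continuous g} -> {for t, continuous (fun s => (f s, g s))}.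
Proof. by move=> cf cg; exact: cvg_pair. Qed.

Lemma continuous_fst (U V : topologicalType) (z : U * V) : {for z, continuous (@fst U V)}.
Proof. exact: cvg_fst. Qed.

Lemma continuous_snd (U V : topologicalType) (z : U * V) : {for z, continuous (@snd U V)}.
Proof. exact: cvg_snd. Qed.

Section ManifoldCalculus.
Variables (R : realType) (n : nat) (M : manifold 'rV[R]_n).
Implicit Types (x y z : M) (F G : normedModType R).

Lemma chart_nbhs x y : chart_dom x y -> \forall z \near y, chart_dom x z.
Proof. by move=> xy; apply: open_nbhs_nbhs; split => //; exact: chart_dom_open. Qed.

Lemma chart_inv_cvg x y (A : set M) : chart_dom x y ->
  (\forall z \near y, A z) -> \forall e \near chart x y, A (chart_inv x e).
Proof.
move=> xy; have im : (chart x @` chart_dom x) (chart x y) by exists y.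
have := chart_inv_continuous im; rewrite /prop_for /continuous_at (chartK xy).
by move=> c nA; exact: c nA.
Qed.

Lemma chart_cvg x y (B : set 'rV[R]_n) : chart_dom x y ->
  (\forall e \near chart x y, B e) -> \forall z \near y, B (chart x z).
Proof. by move=> xy nB; exact: (chart_continuous xy) nB. Qed.

Lemma near_chart_invK x y : chart_dom x y -> \forall e \near chart x y,
  chart_dom x (chart_inv x e) /\ chart x (chart_inv x e) = e.
Proof.
move=> xy; have im : (chart x @` chart_dom x) (chart x y) by exists y.
apply: filterS (open_nbhs_nbhs (conj (@chart_open _ _ M x) im)) => _ [z xz <-].
by rewrite chartK.
Qed.

Lemma chart_invxx x : chart_inv x (chart x x) = x.
Proof. by apply: chartK; exact: chart_dom_refl. Qed.

(** Smoothness at [y] is defined in the chart designated at [y], which jumps with [y]. This lemma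
    allows one fixed chart while the point moves. *)
Lemma smooth_fun_chart F (f : M -> F) x y : chart_dom x y ->
  smooth_fun_at f y <-> smooth_near (fun e => f (chart_inv x e)) (chart x y).
Proof.
have aux u v : chart_dom u y -> chart_dom v y ->
    smooth_near (fun e => f (chart_inv v e)) (chart v y) ->
    smooth_near (fun e => f (chart_inv u e)) (chart u y).
  move=> uy vy sf.
  have := @smooth_near_comp _ _ _ _ (chart v \o chart_inv u) _ (chart u y)
    (@findim_mx _ _ _) (chart_smooth uy vy).
  rewrite /= (chartK uy) => /(_ _ _ sf).
  apply: smooth_near_ext.
  by apply: filterS (chart_inv_cvg uy (chart_nbhs vy)) => e ve; rewrite /= chartK.
move=> xy; split; first by apply: aux => //; exact: chart_dom_refl.
by move=> sf; apply: (aux y x) => //; exact: chart_dom_refl.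
Qed.

Lemma smooth_fun_near F (f : M -> F) x :
  smooth_fun_at f x -> \forall y \near x, smooth_fun_at f y.
Proof.
move=> /smooth_near_near/(chart_cvg (chart_dom_refl x)).
apply: filterS2 (chart_nbhs (chart_dom_refl x)) => y xy sf.
by apply/(smooth_fun_chart f xy).
Qed.

Lemma smooth_fun_continuous F (f : M -> F) x :
  smooth_fun_at f x -> {for x, continuous f}.
Proof.
move=> /smooth_near_continuous cf.
have cc := chart_continuous (chart_dom_refl x).
have : {for x, continuous ((f \o chart_inv x) \o chart x)} by exact: continuous_comp.
rewrite /prop_for /continuous_at /= chart_invxx; apply: cvg_trans.
apply: near_eq_cvg; apply: filterS (chart_nbhs (chart_dom_refl x)) => y xy /=.
by rewrite chartK.
Qed.

Lemma smooth_fun_ext F (f g : M -> F) x : (\forall y \near x, f y = g y) ->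
  smooth_fun_at f x -> smooth_fun_at g x.
Proof.
move=> /(chart_inv_cvg (chart_dom_refl x)); exact: smooth_near_ext.
Qed.

Lemma fun_deriv_ext F (f g : M -> F) x (w : tangent x) :
  (\forall y \near x, f y = g y) -> smooth_fun_at f x ->
  fun_deriv g w = fun_deriv f w.
Proof.
move=> /(chart_inv_cvg (chart_dom_refl x)); exact: der_ext.
Qed.

Lemma smooth_fun_chart_self x y : chart_dom x y -> smooth_fun_at (chart x) y.
Proof. by move=> xy; apply: chart_smooth => //; exact: chart_dom_refl. Qed.

Lemma fun_deriv_chart x (w : tangent x) : fun_deriv (chart x) w = w.
Proof.
have e : \forall e \near chart x x, id e = chart x (chart_inv x e).
  by apply: filterS (near_chart_invK (chart_dom_refl x)) => e [].
by apply: etrans (der_ext w e (smooth_near_id _)) (der_id _ _).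
Qed.

Lemma smooth_fun_cst F (c : F) x : smooth_fun_at (fun=> c) x.
Proof. exact: smooth_near_cst. Qed.

Lemma fun_deriv_cst F (c : F) x (w : tangent x) : fun_deriv (fun=> c) w = 0.
Proof. exact: der_cst. Qed.

Lemma fun_derivP F (f : M -> F) x : linear (fun w : tangent x => fun_deriv f w).
Proof. exact: der_is_linear. Qed.

Lemma smooth_fun_comp F G (f : M -> F) (g : F -> G) x : findim F ->
  smooth_fun_at f x -> smooth_near g (f x) -> smooth_fun_at (fun y => g (f y)) x.
Proof.
move=> fF sf sg; apply: (@smooth_near_comp _ _ _ _ (f \o chart_inv x)) => //.
by rewrite /= chart_invxx.
Qed.

Lemma fun_deriv_comp F G (f : M -> F) (g : F -> G) x (w : tangent x) :
  smooth_fun_at f x -> smooth_near g (f x) ->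
  fun_deriv (fun y => g (f y)) w = der g (f x) (fun_deriv f w).
Proof.
move=> sf sg; have e : (f \o chart_inv x) (chart x x) = f x by rewrite /= chart_invxx.
rewrite -e in sg *; exact: (der_comp w sf sg).
Qed.

Lemma fun_deriv_mulmx p q r (f : M -> 'M[R]_(p, q)) (g : M -> 'M[R]_(q, r)) x
    (w : tangent x) : smooth_fun_at f x -> smooth_fun_at g x ->
  fun_deriv (fun y => f y *m g y) w = f x *m fun_deriv g w + fun_deriv f w *m g x.
Proof.
move=> sf sg; apply: etrans (der_mulmx w sf sg) _.
by rewrite /= chart_invxx.
Qed.

(** The change of charts inside [coord_field] cancels the one hidden in [fun_deriv], leaving a
    partial derivative in the chart at [x0]. *)
Lemma coord_field_deriv F (f : M -> F) x0 v y : chart_dom x0 y -> smooth_fun_at f y ->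
  fun_deriv f (coord_field x0 v y) = der (fun e => f (chart_inv x0 e)) (chart x0 y) v.
Proof.
move=> xy sf; have yy := chart_dom_refl y.
have sc := chart_smooth xy yy.
have cE : (chart y \o chart_inv x0) (chart x0 y) = chart y y by rewrite /= chartK.
have sf' : smooth_near (f \o chart_inv y) ((chart y \o chart_inv x0) (chart x0 y)).
  by rewrite cE.
have := der_comp v sc sf'; rewrite cE => e.
apply: etrans (esym e) _; apply: esym; apply: der_ext.
  apply: filterS (chart_inv_cvg xy (chart_nbhs yy)) => z zy /=.
  by rewrite chartK.
exact: (smooth_near_comp (@findim_mx _ _ _) sc sf').
Qed.

Lemma fun_deriv_curve F (f : M -> F) x (c : R^o -> M) : c 0 = x ->
  (\forall t \near 0, chart_dom x (c t)) -> smooth_near (fun t => chart x (c t)) 0 ->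
  smooth_fun_at f x ->
  der (fun t => f (c t)) 0 1 = fun_deriv f (der (fun t => chart x (c t)) 0 1 : tangent x).
Proof.
move=> c0 cd sc sf.
have sf' : smooth_near (f \o chart_inv x) (chart x (c 0)) by rewrite c0.
have e : \forall t \near (0 : R^o), (f \o chart_inv x) (chart x (c t)) = f (c t).
  by apply: filterS cd => t dt /=; rewrite chartK.
apply: etrans (der_ext _ e (smooth_near_comp (@findim_mx _ _ _) sc sf')) _.
by apply: etrans (der_comp _ sc sf') _; rewrite c0.
Qed.

End ManifoldCalculus.

Section MapCalculus.
Variables (R : realType) (n n' : nat) (M : manifold 'rV[R]_n) (M' : manifold 'rV[R]_n').
Implicit Types (x y z : M) (F G : normedModType R).

Lemma smooth_fun_map F (f : M -> M') (g : M' -> F) x :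
  smooth_map_at f x -> smooth_fun_at g (f x) -> smooth_fun_at (fun y => g (f y)) x.
Proof.
move=> [cf sf] sg.
apply: (smooth_fun_ext _ (@smooth_fun_comp _ _ M _ _ (fun y => chart (f x) (f y))
    (fun e => g (chart_inv (f x) e)) x (@findim_mx _ _ _) sf sg)).
have := near_continuous cf (chart_nbhs (chart_dom_refl (f x))).
by apply: filterS => y xy /=; rewrite chartK.
Qed.

Lemma fun_deriv_map F (f : M -> M') (g : M' -> F) x (w : tangent x) :
  smooth_map_at f x -> smooth_fun_at g (f x) ->
  fun_deriv (fun y => g (f y)) w = fun_deriv g (tangent_map f w).
Proof.
move=> [cf sf] sg.
have e : \forall y \near x, g (chart_inv (f x) (chart (f x) (f y))) = g (f y).
  have := near_continuous cf (chart_nbhs (chart_dom_refl (f x))).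
  by apply: filterS => y xy /=; rewrite chartK.
rewrite (fun_deriv_ext w e); last exact: (@smooth_fun_comp _ _ M _ _ (fun y => chart (f x) (f y))
    (fun e => g (chart_inv (f x) e)) x (@findim_mx _ _ _) sf sg).
exact: (@fun_deriv_comp _ _ M _ _ (fun y => chart (f x) (f y)) (fun e => g (chart_inv (f x) e)) x
    w sf sg).
Qed.

Lemma smooth_map_ext (f g : M -> M') x : (\forall y \near x, f y = g y) ->
  smooth_map_at f x -> smooth_map_at g x.
Proof.
move=> fg [cf sf]; have fgx := nbhs_singleton fg; split.
  move: cf; rewrite /prop_for /continuous_at fgx; apply: cvg_trans.
  exact: near_eq_cvg.
rewrite -fgx; apply: (@smooth_fun_ext _ _ M _ (fun y => chart (f x) (f y))) sf.
by apply: filterS fg => y ->.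
Qed.

Lemma tangent_map_ext (f g : M -> M') x (w : tangent x) : (\forall y \near x, f y = g y) ->
  smooth_map_at f x -> tangent_map g w = tangent_map f w :> 'rV[R]_n'.
Proof.
move=> fg [cf sf]; have fgx := nbhs_singleton fg.
rewrite /tangent_map -fgx.
apply: (@fun_deriv_ext _ _ M _ (fun y => chart (f x) (f y)) (fun y => chart (f x) (g y))) => //.
by apply: filterS fg => y ->.
Qed.

Lemma smooth_map_id x : smooth_map_at (@id M) x.
Proof. by split; [exact: cvg_id|apply: smooth_fun_chart_self; exact: chart_dom_refl]. Qed.

Lemma tangent_map_id x (w : tangent x) : tangent_map (@id M) w = w.
Proof. exact: fun_deriv_chart. Qed.

End MapCalculus.

Section MapComp.
Variables (R : realType) (n n' n'' : nat) (M : manifold 'rV[R]_n) (M' : manifold 'rV[R]_n')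
  (M'' : manifold 'rV[R]_n'').

Lemma smooth_map_comp (f : M -> M') (g : M' -> M'') x :
  smooth_map_at f x -> smooth_map_at g (f x) -> smooth_map_at (fun y => g (f y)) x.
Proof.
move=> sf sg; split; last exact: (smooth_fun_map sf (proj2 sg)).
by apply: continuous_comp; [exact: (proj1 sf)|exact: (proj1 sg)].
Qed.

Lemma tangent_map_comp (f : M -> M') (g : M' -> M'') x (w : tangent x) :
  smooth_map_at f x -> smooth_map_at g (f x) ->
  tangent_map (fun y => g (f y)) w = tangent_map g (tangent_map f w).
Proof. by move=> sf sg; exact: (fun_deriv_map w sf (proj2 sg)). Qed.

End MapComp.

(** * Maps with a parameter in a subset of a normed space *)

Section SmoothMap2.
Variables (R : realType) (n n' n0 : nat) (M : manifold 'rV[R]_n) (M' : manifold 'rV[R]_n')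
  (M0 : manifold 'rV[R]_n0) (F : normedModType R) (A : set F) (f : M -> F -> M').
Hypothesis fF : findim F.

Lemma smooth_map2_comp (alpha : M0 -> M) (beta : M0 -> F) z :
  smooth_map2_at A f (alpha z) (beta z) -> smooth_map_at alpha z ->
  smooth_fun_at beta z -> (\forall z' \near z, A (beta z')) ->
  smooth_map_at (fun z' => f (alpha z') (beta z')) z.
Proof.
move=> [g sg ng] sa sb nA.
pose ab z' := (chart (alpha z) (alpha z'), beta z').
have sab : smooth_fun_at ab z by apply: smooth_near_pair; [exact: (proj2 sa)|exact: sb].
have sgab : smooth_fun_at (fun z' => g (ab z')) z.
  by apply: smooth_fun_comp => //; apply: findim_prod => //; exact: findim_mx.
have cab : {for z, continuous (fun z' => (alpha z', beta z'))}.
  by apply: cvg_pair; [exact: (proj1 sa)|exact: smooth_fun_continuous].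
have e : \forall z' \near z, chart_dom (f (alpha z) (beta z)) (f (alpha z') (beta z')) /\
    chart (f (alpha z) (beta z)) (f (alpha z') (beta z')) = g (ab z').
  have := near_continuous cab ng; apply: filterS2 nA => z' Az' /= /(_ Az') //.
have sh : smooth_fun_at (fun z' => chart (f (alpha z) (beta z)) (f (alpha z') (beta z'))) z.
  by apply: smooth_fun_ext sgab; apply: filterS e => z' [].
split; last exact: sh.
(* [smooth_map2_at] speaks only of coordinates; continuity of the composite is recovered by applying
   the inverse chart. *)
have := smooth_fun_continuous sh; set x1 := f (alpha z) (beta z) => ch.
have im : (chart x1 @` chart_dom x1) (chart x1 x1).
  by exists x1 => //; exact: chart_dom_refl.
have := continuous_comp ch (chart_inv_continuous im).
rewrite /prop_for /continuous_at /= -/x1 chart_invxx; apply: cvg_trans.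
by apply: near_eq_cvg; apply: filterS e => z' [d _] /=; rewrite chartK.
Qed.

(** The derivative is the sum of the two partial ones. As [f] is controlled only for parameters in
    [A], the second is taken along a curve [c] in [A] with the velocity of [beta]. All three terms
    are derivatives of the ambient extension [g], where linearity applies. *)
Lemma tangent_map2 (alpha : M0 -> M) (beta : M0 -> F) (c : R^o -> F) z (w : tangent z) :
  smooth_map2_at A f (alpha z) (beta z) -> smooth_map_at alpha z ->
  smooth_fun_at beta z -> (\forall z' \near z, A (beta z')) ->
  smooth_near c 0 -> c 0 = beta z -> (\forall t \near 0, A (c t)) ->
  der c 0 1 = fun_deriv beta w ->
  tangent_map (fun z' => f (alpha z') (beta z')) w =
  tangent_map (fun x => f x (beta z)) (tangent_map alpha w) +
  'D_1 (fun t => chart (f (alpha z) (beta z)) (f (alpha z) (c t))) 0 :> 'rV[R]_n'.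
Proof.
move=> [g sg ng] sa sb nA sc c0 nAc dc.
have Ab := nbhs_singleton nA.
have fEF : findim ('rV[R]_n * F)%type by apply: findim_prod => //; exact: findim_mx.
pose ab z' := (chart (alpha z) (alpha z'), beta z').
have sab : smooth_fun_at ab z by apply: smooth_near_pair; [exact: (proj2 sa)|exact: sb].
have cab : {for z, continuous (fun z' => (alpha z', beta z'))}.
  by apply: cvg_pair; [exact: (proj1 sa)|exact: smooth_fun_continuous].
have e : \forall z' \near z,
    g (ab z') = chart (f (alpha z) (beta z)) (f (alpha z') (beta z')).
  have := near_continuous cab ng; apply: filterS2 nA => z' Az' /= /(_ Az') [] //.
have sgab : smooth_fun_at (fun z' => g (ab z')) z by exact: smooth_fun_comp.
have -> : tangent_map (fun z' => f (alpha z') (beta z')) w =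
    der g (chart (alpha z) (alpha z), beta z) (tangent_map alpha w, fun_deriv beta w) :>
        'rV[R]_n'.
  apply: etrans (fun_deriv_ext w e sgab) _.
  apply: etrans (fun_deriv_comp w sab sg) _.
  by congr der; exact: (der_pair w (proj2 sa) sb).
have s1 : smooth_fun_at (fun x => (chart (alpha z) x, beta z)) (alpha z).
  apply: smooth_near_pair; last exact: smooth_near_cst.
  by apply: smooth_fun_chart_self; exact: chart_dom_refl.
have -> : tangent_map (fun x => f x (beta z)) (tangent_map alpha w) =
    der g (chart (alpha z) (alpha z), beta z) (tangent_map alpha w, 0) :> 'rV[R]_n'.
  have e1 : \forall x \near alpha z,
      g (chart (alpha z) x, beta z) = chart (f (alpha z) (beta z)) (f x (beta z)).
    have c1 : {for alpha z, continuous (fun x : M => (x, beta z))}.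
      by apply: cvg_pair; [exact: cvg_id|exact: cvg_cst].
    by have := near_continuous c1 ng; apply: filterS => x /= /(_ Ab)[].
  have sg1 : smooth_fun_at (fun x => g (chart (alpha z) x, beta z)) (alpha z).
    exact: (smooth_fun_comp fEF s1 sg).
  apply: etrans (fun_deriv_ext _ e1 sg1) _.
  apply: etrans (fun_deriv_comp _ s1 sg) _.
  congr der; apply: etrans (der_pair _ _ _) _; last 1 first.
  - by congr pair; [exact: fun_deriv_chart|exact: der_cst].
  - by apply: smooth_fun_chart_self; exact: chart_dom_refl.
  - exact: smooth_near_cst.
have s2 : smooth_near (fun t : R^o => (chart (alpha z) (alpha z), c t)) 0.
  by apply: smooth_near_pair => //; exact: smooth_near_cst.
have sg2 : smooth_near g (chart (alpha z) (alpha z), c 0) by rewrite c0.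
have sg2c := smooth_near_comp fEF s2 sg2.
have e2 : \forall t \near (0 : R^o), g (chart (alpha z) (alpha z), c t) =
    chart (f (alpha z) (beta z)) (f (alpha z) (c t)).
  have c2 : {for (0 : R^o), continuous (fun t => (alpha z, c t))}.
    by apply: cvg_pair; [exact: cvg_cst|exact: smooth_near_continuous].
  have ng' : \forall z0 \near (alpha z, c 0), A z0.2 ->
     chart_dom (f (alpha z) (beta z)) (f z0.1 z0.2) /\
     chart (f (alpha z) (beta z)) (f z0.1 z0.2) = g (chart (alpha z) z0.1, z0.2).
    by rewrite c0.
  by have := near_continuous c2 ng'; apply: filterS2 nAc => t At /= /(_ At)[].
rewrite deriveE1; last exact: smooth_near_ext e2 sg2c.
rewrite (der_ext (1 : R^o) e2 sg2c) (der_comp (1 : R^o) s2 sg2).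
rewrite (der_pair _ (smooth_near_cst _ _) sc) der_cst dc c0.
have lg := @der_is_linear _ _ _ g (chart (alpha z) (alpha z), beta z).
have := lg 1 (tangent_map alpha w, 0) (0, fun_deriv beta w).
rewrite !scale1r => <-; congr der.
by rewrite /GRing.add/= /add_pair/= addr0 add0r.
Qed.

Lemma smooth_map2_curve (c : R^o -> F) x a : smooth_map2_at A f x a ->
  smooth_near c 0 -> c 0 = a -> (\forall t \near 0, A (c t)) ->
  (\forall t \near 0, chart_dom (f x a) (f x (c t))) /\
  smooth_near (fun t => chart (f x a) (f x (c t))) 0.
Proof.
move=> [g sg ng] sc c0 nAc.
have fEF : findim ('rV[R]_n * F)%type by apply: findim_prod => //; exact: findim_mx.
have c2 : {for (0 : R^o), continuous (fun t => (x, c t))}.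
  by apply: cvg_pair; [exact: cvg_cst|exact: smooth_near_continuous].
have ng' : \forall z0 \near (x, c 0), A z0.2 ->
    chart_dom (f x a) (f z0.1 z0.2) /\
    chart (f x a) (f z0.1 z0.2) = g (chart x z0.1, z0.2) by rewrite c0.
have nc := near_continuous c2 ng'; split.
  by apply: filterS2 nAc nc => t At /= /(_ At)[].
have s2 : smooth_near (fun t : R^o => (chart x x, c t)) 0.
  by apply: smooth_near_pair => //; exact: smooth_near_cst.
have sg2 : smooth_near g (chart x x, c 0) by rewrite c0.
apply: smooth_near_ext (smooth_near_comp fEF s2 sg2).
by apply: filterS2 nAc nc => t At /= /(_ At)[].
Qed.

End SmoothMap2.

(** * The frame bundle of a local connection form *)

Section MatrixSecondCountable.
Variable R : realType.

Lemma mx_second_countable m n : @second_countable 'M[R]_(m, n).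
Proof.
pose f (qk : 'M[rat]_(m, n) * nat) : set 'M[R]_(m, n) :=
  ball (map_mx (@ratr R) qk.1) (qk.2.+1%:R^-1).
exists (range f).
  exact: card_le_trans (card_image_le _ _) (countableP _).
split=> [_ [qk _ <-]|M A /nbhs_ballP[e /= e0 eA]]; first exact: ball_open.
have [k ke] : exists k : nat, k.+1%:R^-1 < e / 2.
  have := @near_infty_natSinv_lt R (PosNum (divr_gt0 e0 (ltr0Sn R 1))).
  by case=> k _ /(_ k (leqnn k)) /= kk; exists k.
have k0 : 0 < k.+1%:R^-1 :> R by rewrite invr_gt0 ltr0n.
have Q i j : exists q : rat, `|ratr q - M i j| < k.+1%:R^-1.
  have lt : M i j < M i j + k.+1%:R^-1 by rewrite ltrDl.
  have [q] := rat_in_itvoo lt; rewrite in_itv /= => /andP[q1 q2].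
  exists q; move: (k.+1%:R^-1 : R) k0 q1 q2 => e' ? ? ?.
  by rewrite ltr_norml; apply/andP; split; lra.
pose q := \matrix_(i, j) xchoose (Q i j).
have MQ : f (q, k) M.
  split=> // i j; rewrite /ball /= !mxE; exact: (xchooseP (Q i j)).
exists (f (q, k)); first by split => //; exists (q, k).
move=> B MB; apply: eA; apply: (@ball_split _ _ (map_mx (@ratr R) q)).
- by apply: ball_sym; apply: le_ball (ltW ke) _ MQ.
- by apply: le_ball (ltW ke) _ MB.
Qed.

End MatrixSecondCountable.

(* [gtrans x y] compares the moving frames centered at [x] and [y]: at the point
   [y], the frame centered at [y] is the one centered at [x] times [gtrans x y].
   [gform x] is the connection form in the frame centered at [x]. *)
Record gauge (R : realType) (m : nat) (N : manifold 'rV[R]_m.+1) := Gauge {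
  gdom : N -> set N;
  gtrans : N -> N -> 'M[R]_m.+2;
  gform : N -> forall y : N, tangent y -> 'M[R]_m.+2;
  gdomP : forall x, open_nbhs x (gdom x);
  gtrans_isotropy : forall x y, gdom x y -> isotropy R m (gtrans x y);
  gtrans1 : forall x, gtrans x x = 1%:M;
  gtrans_smooth : forall x x' y, gdom x y -> gdom x' y ->
    smooth_fun_at (fun z => gtrans x' z *m invmx (gtrans x z)) y;
  gform_linear : forall x y, gdom x y -> linear (@gform x y);
  gform_skew : forall x y (w : tangent y), gdom x y -> skew_alg (gform x w);
  gform_smooth : forall x y v, gdom x y ->
    smooth_fun_at (fun z => gform x (coord_field y v z)) y;
  gform_gauge : forall x x' y (w : tangent y), gdom x y -> gdom x' y ->
    gtrans x' y *m invmx (gtrans x y) *m gform x w =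
    gform x' w *m (gtrans x' y *m invmx (gtrans x y))
    + fun_deriv (fun z => gtrans x' z *m invmx (gtrans x z)) w;
  gform_inj : forall x (w : tangent x), gform x w *m ell = 0 -> w = 0 }.

(** * The total space of frames and its topology *)

Section FrameSpace.
Context {R : realType} {m : nat} {N : manifold 'rV[R]_m.+1}.
Variable D : gauge N.
Local Notation H := (isotropy R m).
Local Notation MX := 'M[R]_m.+2.

(* The pair (x, k) stands for the frame centered at [x] at the point [x], times
   [k]; its matrix in the frame centered at [x0] is [frame_mx x0]. *)
Record frame_space : Type := Frame {
  fpt : N; fmx : MX; fmxP : H fmx }.
Implicit Types (u : frame_space) (x y : N) (k : MX).

Lemma frame_eq u u' : fpt u = fpt u' -> fmx u = fmx u' -> u = u'.
Proof.
case: u => x k h; case: u' => x' k' h' /= xx kk; subst x' k'.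
by congr Frame; exact: Prop_irrelevance.
Qed.

(** The action of a principal bundle takes every matrix as argument; outside [H] the identity is the
    default. *)
Definition mk_frame x k : frame_space :=
  if pselect (H k) is left Hk then Frame x Hk else Frame x (@isotropy1 R m).

Lemma fpt_mk x k : fpt (mk_frame x k) = x.
Proof. by rewrite /mk_frame; case: pselect. Qed.

Lemma fmx_mk x k : H k -> fmx (mk_frame x k) = k.
Proof. by rewrite /mk_frame; case: pselect. Qed.

Definition frame_mx x u : MX := gtrans D x (fpt u) *m fmx u.
Definition frame_of x y k : frame_space := mk_frame y (invmx (gtrans D x y) *m k).
Definition gchange x x' y : MX := gtrans D x' y *m invmx (gtrans D x y).

Lemma gdomxx x : gdom D x x. Proof. by case: (gdomP D x). Qed.

Lemma gdom_near x y : gdom D x y -> \forall z \near y, gdom D x z.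
Proof. by move=> xy; apply: open_nbhs_nbhs; split=> //; case: (gdomP D x). Qed.

Lemma frame_mx_isotropy x u : gdom D x (fpt u) -> H (frame_mx x u).
Proof. by move=> xu; apply: isotropyM; [exact: gtrans_isotropy|exact: fmxP]. Qed.

Lemma fpt_frame_of x y k : fpt (frame_of x y k) = y.
Proof. exact: fpt_mk. Qed.

Lemma frame_of_isotropy x y k : gdom D x y -> H k -> H (invmx (gtrans D x y) *m k).
Proof. by move=> xy Hk; apply: isotropyM => //; apply: isotropyV; exact: gtrans_isotropy. Qed.

Lemma frame_ofK x y k : gdom D x y -> H k -> frame_mx x (frame_of x y k) = k.
Proof.
move=> xy Hk; rewrite /frame_mx fpt_frame_of /frame_of fmx_mk; last exact: frame_of_isotropy.
by rewrite mulKVmx //; apply: isotropy_unit; exact: gtrans_isotropy.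
Qed.

Lemma frame_mxK x u : gdom D x (fpt u) -> frame_of x (fpt u) (frame_mx x u) = u.
Proof.
move=> xu; rewrite /frame_of /frame_mx mulKmx; last by apply: isotropy_unit; exact:
    gtrans_isotropy.
by apply: frame_eq; [exact: fpt_mk|apply: fmx_mk; exact: fmxP].
Qed.

Lemma frame_mx_self u : frame_mx (fpt u) u = fmx u.
Proof. by rewrite /frame_mx gtrans1 mul1mx. Qed.

Lemma frame_mx_inj x u u' : gdom D x (fpt u) -> fpt u = fpt u' ->
  frame_mx x u = frame_mx x u' -> u = u'.
Proof.
move=> xu uu' e; rewrite -(frame_mxK xu) e uu' frame_mxK //.
by rewrite -uu'.
Qed.

Lemma frame_mx_change x x' u : gdom D x (fpt u) ->
  frame_mx x' u = gchange x x' (fpt u) *m frame_mx x u.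
Proof.
move=> xu; rewrite /gchange /frame_mx mulmxA mulmxKV //.
by apply: isotropy_unit; exact: gtrans_isotropy.
Qed.

Definition frame_pair x u : N * MX := (fpt u, frame_mx x u).

(** The topology induced from [N * MX] by the trivialization centered at the base point of [u].
    Pairs whose matrix lies outside [H] come from no frame, hence the quantification over [u']. *)
Definition frame_nbhs u (A : set frame_space) : Prop :=
  \forall z \near frame_pair (fpt u) u, forall u', frame_pair (fpt u) u' = z -> A u'.

Lemma gchange_continuous x x' (z : N * MX) : gdom D x z.1 -> gdom D x' z.1 ->
  {for z, continuous (fun z : N * MX => (z.1, gchange x x' z.1 *m z.2))}.
Proof.
move=> xz x'z; apply: continuous_pair; first exact: continuous_fst.
apply: (@continuous_comp _ _ _ (fun z : N * MX => (gchange x x' z.1, z.2))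
  (fun q : MX * MX => q.1 *m q.2)); last exact: mulmx_continuous.
apply: continuous_pair; last exact: continuous_snd.
apply: (@continuous_comp _ _ _ fst (gchange x x')); first exact: continuous_fst.
exact: smooth_fun_continuous (gtrans_smooth xz x'z).
Qed.

(** The change of trivialization [T] makes sense for all matrices and is continuous at the pair of
    [u], so neighborhoods can be pulled back in [N * MX] itself. *)
Lemma frame_nbhs_change x x' u (A : set frame_space) :
  gdom D x (fpt u) -> gdom D x' (fpt u) ->
  (\forall z \near frame_pair x u, forall u', frame_pair x u' = z -> A u') ->
  \forall z \near frame_pair x' u, forall u', frame_pair x' u' = z -> A u'.
Proof.
move=> xu x'u nA.
pose T (z : N * MX) := (z.1, gchange x' x z.1 *m z.2).
have TE v : gdom D x' (fpt v) -> T (frame_pair x' v) = frame_pair x v.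
  by move=> x'v; rewrite /T /= -frame_mx_change.
have cT : {for frame_pair x' u, continuous T} by exact: gchange_continuous.
rewrite -(TE u x'u) in nA.
have nd : \forall z \near frame_pair x' u, gdom D x' z.1.
  by apply: (@near_continuous _ _ fst _ (gdom D x')); [exact: continuous_fst|exact: gdom_near].
apply: filterS2 nd (near_continuous cT nA) => z dz Az u' uz.
by apply: Az; rewrite -uz TE // -[fpt u']/((frame_pair x' u').1) uz.
Qed.

Lemma frame_nbhsE x u (A : set frame_space) : gdom D x (fpt u) ->
  frame_nbhs u A <->
  \forall z \near frame_pair x u, forall u', frame_pair x u' = z -> A u'.
Proof. by move=> xu; split; apply: frame_nbhs_change => //; exact: gdomxx. Qed.

Lemma frame_nbhs_singleton u A : frame_nbhs u A -> A u.
Proof. by move=> /nbhs_singleton; exact. Qed.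

Lemma frame_nbhs_filter u : ProperFilter (frame_nbhs u).
Proof.
have F : Filter (nbhs (frame_pair (fpt u) u)) by exact: nbhs_filter.
apply: Build_ProperFilter_ex; first by move=> A /frame_nbhs_singleton Au; exists u.
split.
- by apply: (@filterS _ _ F setT) => //; exact: (@filterT _ _ F).
- rewrite /frame_nbhs => A B nA nB; apply: (@filterS2 _ _ F _ _ _ _ nA nB) => z Az Bz u' uz.
  by split; [exact: Az|exact: Bz].
- rewrite /frame_nbhs => A B AB nA; apply: (@filterS _ _ F _ _ _ nA) => z Az u' uz.
  exact/AB/Az.
Qed.

Lemma frame_nbhs_nbhs u A : frame_nbhs u A -> frame_nbhs u (frame_nbhs^~ A).
Proof.
have nd : \forall z \near frame_pair (fpt u) u, gdom D (fpt u) z.1.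
  apply: (@near_continuous _ _ fst _ (gdom D (fpt u))); first exact: continuous_fst.
  by apply: gdom_near; exact: gdomxx.
move=> /near_join; apply: filterS2 nd => z dz Az u' uz.
apply/(frame_nbhsE (x := fpt u)); first by rewrite -[fpt u']/((frame_pair (fpt u) u').1) uz.
by rewrite uz.
Qed.

HB.instance Definition _ := gen_eqMixin frame_space.
HB.instance Definition _ := gen_choiceMixin frame_space.
End FrameSpace.

(** A copy of [frame_space] tagged with the gauge: the topology depends on [D], the bare type does
    not. *)
Definition frame_top (R : realType) m (N : manifold 'rV[R]_m.+1) (D : gauge N) := @frame_space R
    m N.
HB.instance Definition _ (R : realType) m (N : manifold 'rV[R]_m.+1) (D : gauge N) :=
  Choice.on (frame_top D).
HB.instance Definition _ (R : realType) m (N : manifold 'rV[R]_m.+1) (D : gauge N) :=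
  hasNbhs.Build (frame_top D) (frame_nbhs D).
HB.instance Definition _ (R : realType) m (N : manifold 'rV[R]_m.+1) (D : gauge N) :=
  Nbhs_isNbhsTopological.Build (frame_top D) (@frame_nbhs_filter _ _ _ D)
    (@frame_nbhs_singleton _ _ _ D) (@frame_nbhs_nbhs _ _ _ D).

Section FrameTopology.
Context {R : realType} {m : nat} {N : manifold 'rV[R]_m.+1}.
Variable D : gauge N.
Local Notation H := (isotropy R m).
Local Notation MX := 'M[R]_m.+2.
Local Notation P := (frame_top D).
Implicit Types (u : P) (x y : N).

Lemma frame_nearP x u (A : set P) : gdom D x (fpt u) ->
  (\forall u' \near u, A u') <->
  (\forall z \near frame_pair D x u, forall u', frame_pair D x u' = z -> A u').
Proof. exact: frame_nbhsE. Qed.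

Lemma frame_pair_continuous x u : gdom D x (fpt u) ->
  {for u, continuous (frame_pair D x : P -> N * MX)}.
Proof.
move=> xu A nA; apply/(frame_nearP _ xu).
by apply: filterS nA => z Az u' uz; rewrite -uz in Az.
Qed.

Lemma fpt_continuous u : {for u, continuous (@fpt _ _ _ : P -> N)}.
Proof.
have c := frame_pair_continuous (gdomxx D (fpt u)).
exact: (continuous_comp c (@continuous_fst _ _ _)).
Qed.

Lemma frame_mx_continuous x u : gdom D x (fpt u) ->
  {for u, continuous (frame_mx D x : P -> MX)}.
Proof.
move=> /frame_pair_continuous c.
exact: (continuous_comp c (@continuous_snd _ _ _)).
Qed.

Lemma frame_continuous (T : topologicalType) (f : T -> P) t x : gdom D x (fpt (f t)) ->
  {for t, continuous (fpt \o f)} -> {for t, continuous (frame_mx D x \o f)} ->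
  {for t, continuous f}.
Proof.
move=> xt c1 c2 A nA.
have /(frame_nearP _ xt) nA' : \forall u' \near f t, A u' by [].
have c : {for t, continuous (fun s => frame_pair D x (f s))} by exact: continuous_pair.
by apply: filterS (near_continuous c nA') => s; exact.
Qed.

(** Base points are separated first; two frames over the same point share a trivialization, where
    their matrices are separated. *)
Lemma frame_hausdorff : hausdorff_space P.
Proof.
move=> u v uv.
have puv : fpt u = fpt v.
  apply: (@manifold_hausdorff _ _ N) => A B nA nB.
  have [w [Aw Bw]] := uv _ _ (fpt_continuous nA) (fpt_continuous nB).
  by exists (fpt w).
apply: (@frame_mx_inj _ _ _ D (fpt u)) => //; first exact: gdomxx.
apply: (@norm_hausdorff R MX) => A B nA nB.
have cu := frame_mx_continuous (gdomxx D (fpt u)).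
have cv : {for v, continuous (frame_mx D (fpt u) : P -> MX)}.
  by apply: frame_mx_continuous; rewrite -puv; exact: gdomxx.
have [w [Aw Bw]] := uv _ _ (cu _ nA) (cv _ nB).
by exists (frame_mx D (fpt u) w).
Qed.

(** The trivializations are indexed by all points of [N], which are too many. Only basic open sets
    [V1] contained in some domain are kept, and [xc] picks one center for each, so the boxes
    [f (V1, V, W)] form a countable family. *)
Lemma frame_second_countable : @second_countable P.
Proof.
have [BN cBN [oBN bBN]] := @manifold_second_countable _ _ N.
have [BM cBM [oBM bBM]] := @mx_second_countable R m.+2 m.+2.
pose IN := [set V : set N | BN V /\ exists x, V `<=` gdom D x].
pose xc (V : set N) : option N :=
  if pselect (exists x, V `<=` gdom D x) is left ex then Some (sval (cid ex)) else None.
have xcP V : IN V -> exists2 x, xc V = Some x & V `<=` gdom D x.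
  move=> [_ ex]; rewrite /xc; case: pselect => // ex'.
  by exists (sval (cid ex')) => //; exact: (svalP (cid ex')).
pose f (q : set N * set N * set MX) : set P :=
  if xc q.1.1 is Some x then
    [set u | [/\ q.1.1 (fpt u), q.1.2 (fpt u) & q.2 (frame_mx D x u)]]
  else set0.
exists (f @` (IN `*` BN `*` BM)).
  apply: card_le_trans (card_image_le _ _) _.
  apply: countableX => //; apply: countableX => //.
  by apply: sub_countable cBN; apply: subset_card_le => V [].
split=> [_ [[[V1 V] W] [[iV1 bV] bW] <-]|u A nA].
  have [x xE xV1] := xcP _ iV1; rewrite /f /= xE openE => u [/= V1u Vu Wu].
  have du : gdom D x (fpt u) by exact: xV1.
  have o1 : open_nbhs (fpt u) V1 by split=> //; apply: oBN; case: iV1.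
  have n1 := near_continuous (@fpt_continuous u) (open_nbhs_nbhs o1).
  have o2 : open_nbhs (fpt u) V by split=> //; exact: oBN.
  have n2 := near_continuous (@fpt_continuous u) (open_nbhs_nbhs o2).
  have o3 : open_nbhs (frame_mx D x u) W by split=> //; exact: oBM.
  have n3 := near_continuous (frame_mx_continuous du) (open_nbhs_nbhs o3).
  by apply: filterS3 n1 n2 n3 => v; split.
have [V1 [bV1 V1u] V1d] := bBN _ _ (open_nbhs_nbhs (gdomP D (fpt u))).
have iV1 : IN V1 by split=> //; exists (fpt u).
have [x xE xV1] := xcP _ iV1; have du : gdom D x (fpt u) by exact: xV1.
have /(frame_nearP _ du)[[A1 A2] [/= nA1 nA2] sA] : \forall u' \near u, A u' by [].
have [V [bV Vu] VA] := bBN _ _ nA1.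
have [W [bW Wu] WA] := bBM _ _ nA2.
exists (f (V1, V, W)).
  by split; [exists (V1, V, W)|rewrite /f /= xE; split].
move=> v; rewrite /f /= xE => -[/= _ Vv Wv]; apply: (sA (frame_pair D x v)) => //.
by split; [exact: VA|exact: WA].
Qed.

End FrameTopology.

Section IsotropyCoordinates.
Variables (R : realType) (m : nat).

Definition isotropy_dim : nat := sval (cid (@isotropy_alg_coord R m)).

Definition isotropy_log : {linear 'M[R]_m.+2 -> 'rV[R]_isotropy_dim} :=
  sval (cid (svalP (cid (@isotropy_alg_coord R m)))).

Definition isotropy_exp : {linear 'rV[R]_isotropy_dim -> 'M[R]_m.+2} :=
  sval (cid (svalP (cid (svalP (cid (@isotropy_alg_coord R m)))))).

Lemma isotropy_coordP : [/\ forall e, isotropy_alg (isotropy_exp e),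
  cancel isotropy_exp isotropy_log &
  forall X, isotropy_alg X -> isotropy_exp (isotropy_log X) = X].
Proof. exact: (svalP (cid (svalP (cid (svalP (cid (@isotropy_alg_coord R m))))))). Qed.

End IsotropyCoordinates.
Arguments isotropy_log {R m}.
Arguments isotropy_exp {R m}.

Lemma smooth_near_linf (R : realType) (E F G : normedModType R) (L : {linear F -> G})
  (f : E -> F) x : findim F -> smooth_near f x -> smooth_near (fun y => L (f y)) x.
Proof.
by move=> fF sf; apply: (smooth_near_comp fF sf); exact: smooth_near_lin.
Qed.

Lemma smooth_near_row_mx (R : realType) (E : normedModType R) p q r (f : E -> 'M[R]_(p, q))
  (g : E -> 'M[R]_(p, r)) x : smooth_near f x -> smooth_near g x ->
  smooth_near (fun y => row_mx (f y) (g y)) x.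
Proof.
move=> sf sg; apply: smooth_near_mx => i j.
case: (fintype.splitP j) => k jk.
  apply: smooth_near_ext (smooth_near_coord i k sf); apply: nearW => y.
  by rewrite -(row_mxEl (f y) (g y)); congr (_ _ _); exact: val_inj.
apply: smooth_near_ext (smooth_near_coord i k sg); apply: nearW => y.
by rewrite -(row_mxEr (f y) (g y)); congr (_ _ _); exact: val_inj.
Qed.

(** * Charts of the space of frames *)

Section FrameCharts.
Context {R : realType} {m : nat} {N : manifold 'rV[R]_m.+1}.
Variable D : gauge N.
Local Notation H := (isotropy R m).
Local Notation MX := 'M[R]_m.+2.
Local Notation P := (frame_top D).
Local Notation d := (isotropy_dim R m).
Local Notation C := 'rV[R]_(m.+1 + d).
Implicit Types (u : P) (x y : N) (e : C) (k : MX).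

(** The last condition puts the matrix of [u'] relative to [u] in the domain of [cayley_inv]. *)
Definition frame_dom u : set P := [set u' |
  [/\ chart_dom (fpt u) (fpt u'), gdom D (fpt u) (fpt u') &
      1%:M + invmx (fmx u) *m frame_mx D (fpt u) u' \in unitmx]].

(** Written for arbitrary matrices, so that smoothness can be proved on an open set of a normed
    space instead of on [H]. *)
Definition frame_coords u (q : 'rV[R]_m.+1 * MX) : C :=
  row_mx q.1 (isotropy_log (cayley_inv (invmx (fmx u) *m q.2))).

Definition frame_chart u u' : C :=
  frame_coords u (chart (fpt u) (fpt u'), frame_mx D (fpt u) u').

Definition coords_base u e : N := chart_inv (fpt u) (lsubmx e).
Definition coords_mx u e : MX := fmx u *m cayley (isotropy_exp (rsubmx e)).

Definition frame_chart_inv u e : P :=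
  frame_of D (fpt u) (coords_base u e) (coords_mx u e).

Definition coords_dom u : set C := [set e |
  [/\ chart_dom (fpt u) (coords_base u e) /\ chart (fpt u) (coords_base u e) = lsubmx e,
      gdom D (fpt u) (coords_base u e) & 1%:M - isotropy_exp (rsubmx e) \in unitmx]].

Lemma fmx_unit u : fmx u \in unitmx.
Proof. by apply: isotropy_unit; exact: fmxP. Qed.

Lemma fpt_chart_inv u e : fpt (frame_chart_inv u e) = coords_base u e.
Proof. exact: fpt_frame_of. Qed.

Lemma coords_mx_isotropy u e : 1%:M - isotropy_exp (rsubmx e) \in unitmx -> H (coords_mx u e).
Proof.
move=> ue; apply: isotropyM; first exact: fmxP.
by apply: cayley_isotropy => //; case: (isotropy_coordP R m).
Qed.

Lemma frame_mx_chart_inv u e : coords_dom u e ->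
  frame_mx D (fpt u) (frame_chart_inv u e) = coords_mx u e.
Proof. by move=> [_ ? ue]; apply: frame_ofK => //; exact: coords_mx_isotropy. Qed.

Lemma coords_domE u e : coords_dom u e ->
  frame_dom u (frame_chart_inv u e) /\ frame_chart u (frame_chart_inv u e) = e.
Proof.
move=> de; have := de => -[[c1 c2] g ue]; split.
  split; rewrite ?fpt_chart_inv ?frame_mx_chart_inv //.
  by rewrite /coords_mx mulKmx ?fmx_unit //; exact: cayley_unit.
rewrite /frame_chart /frame_coords /= fpt_chart_inv frame_mx_chart_inv // c2.
rewrite /coords_mx mulKmx ?fmx_unit // cayleyK //.
by case: (isotropy_coordP R m) => _ -> _; rewrite hsubmxK.
Qed.

Lemma frame_chartE u u' : frame_dom u u' ->
  [/\ coords_base u (frame_chart u u') = fpt u',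
      coords_mx u (frame_chart u u') = frame_mx D (fpt u) u',
      frame_chart_inv u (frame_chart u u') = u' & coords_dom u (frame_chart u u')].
Proof.
move=> [c g un].
have bE : coords_base u (frame_chart u u') = fpt u'.
  by rewrite /coords_base /frame_chart /frame_coords row_mxKl /= chartK.
have iA : H (invmx (fmx u) *m frame_mx D (fpt u) u').
  by apply: isotropyM; [apply: isotropyV; exact: fmxP|exact: frame_mx_isotropy].
have eE : isotropy_exp (rsubmx (frame_chart u u')) =
    cayley_inv (invmx (fmx u) *m frame_mx D (fpt u) u').
  rewrite /frame_chart /frame_coords row_mxKr /=.
  by case: (isotropy_coordP R m) => _ _; apply; exact: cayley_inv_isotropy.
have mE : coords_mx u (frame_chart u u') = frame_mx D (fpt u) u'.
  by rewrite /coords_mx eE cayley_invK // mulKVmx // fmx_unit.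
split=> //.
  by rewrite /frame_chart_inv bE mE frame_mxK.
split; rewrite ?bE ?eE //; last exact: cayley_inv_unit.
by rewrite /frame_chart /frame_coords row_mxKl.
Qed.

Lemma frame_chart_image u : frame_chart u @` frame_dom u = coords_dom u.
Proof.
apply/seteqP; split=> [_ [u' du' <-]|e de]; first by case: (frame_chartE du').
by exists (frame_chart_inv u e); case: (coords_domE de).
Qed.

Lemma frame_domxx u : frame_dom u u.
Proof.
split; [exact: chart_dom_refl|exact: gdomxx|].
rewrite frame_mx_self mulVmx ?fmx_unit //.
by rewrite -[1%:M + 1%:M]raddfD unitmxE det_scalar unitfE expf_neq0 // pnatr_eq0.
Qed.

Lemma frame_dom_near u u' : frame_dom u u' -> \forall v \near u', frame_dom u v.
Proof.
move=> [c g un].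
have n1 := near_continuous (@fpt_continuous _ _ _ D u') (chart_nbhs c).
have n2 := near_continuous (@fpt_continuous _ _ _ D u') (gdom_near g).
have cf : {for u', continuous (fun v : P => 1%:M + invmx (fmx u) *m frame_mx D (fpt u) v)}.
  apply: (@continuous_comp _ _ _ (frame_mx D (fpt u) : P -> MX)
      (fun A => 1%:M + invmx (fmx u) *m A)).
    exact: frame_mx_continuous.
  apply: smooth_near_continuous; apply: smooth_nearD; first exact: smooth_near_cst.
  by apply: smooth_near_mulmx; [exact: smooth_near_cst|exact: smooth_near_id].
by apply: filterS3 n1 n2 (near_unitmx cf un) => v; split.
Qed.

Lemma smooth_near_lsubmx e : smooth_near (fun e => lsubmx e : 'rV[R]_m.+1) e.
Proof. by apply: smooth_near_lin; exact: findim_mx. Qed.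

Lemma smooth_near_coords_mx u e : 1%:M - isotropy_exp (rsubmx e) \in unitmx ->
  smooth_near (coords_mx u) e.
Proof.
move=> ue; apply: smooth_near_mulmx; first exact: smooth_near_cst.
apply: smooth_near_cayley => //; apply: smooth_near_linf; first exact: findim_mx.
by apply: smooth_near_lin; exact: findim_mx.
Qed.

Lemma coords_dom_near u e : coords_dom u e -> \forall e' \near e, coords_dom u e'.
Proof.
move=> [[c1 c2] g ue].
have cl := smooth_near_continuous (smooth_near_lsubmx e).
have n1 := near_chart_invK c1; have n2 := chart_inv_cvg c1 (gdom_near g).
rewrite c2 in n1 n2.
have sr : smooth_near (fun e => 1%:M - isotropy_exp (rsubmx e)) e.
  apply: smooth_nearD; first exact: smooth_near_cst.
  apply: smooth_nearN; apply: smooth_near_linf; first exact: findim_mx.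
  by apply: smooth_near_lin; exact: findim_mx.
have n3 := near_unitmx (smooth_near_continuous sr) ue.
by apply: filterS3 (near_continuous cl n1) (near_continuous cl n2) n3 => e' [? ?]; split.
Qed.

Lemma smooth_near_frame_coords (E : normedModType R) (f : E -> 'rV[R]_m.+1) (g : E -> MX) u t :
  smooth_near f t -> smooth_near g t -> 1%:M + invmx (fmx u) *m g t \in unitmx ->
  smooth_near (fun s => frame_coords u (f s, g s)) t.
Proof.
move=> sf sg un; apply: smooth_near_row_mx => //; apply: smooth_near_linf.
  exact: findim_mx.
apply: smooth_near_cayley_inv => //.
by apply: smooth_near_mulmx => //; exact: smooth_near_cst.
Qed.

Lemma smooth_near_base (F : normedModType R) (f : N -> F) u e :
  coords_dom u e -> smooth_fun_at f (coords_base u e) ->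
  smooth_near (fun e => f (coords_base u e)) e.
Proof.
move=> [[c1 c2] g ue] /(smooth_fun_chart f c1); rewrite c2 => sf.
exact: (smooth_near_comp (@findim_mx _ 1 m.+1) (smooth_near_lsubmx e) sf).
Qed.

Lemma frame_chart_continuous u u' : frame_dom u u' -> {for u', continuous (frame_chart u)}.
Proof.
move=> [c g un].
have c1 : {for u', continuous (fun v : P => (chart (fpt u) (fpt v), frame_mx D (fpt u) v))}.
  apply: continuous_pair; last exact: frame_mx_continuous.
  apply: (@continuous_comp _ _ _ (@fpt _ _ _ : P -> N) (chart (fpt u))).
    exact: fpt_continuous.
  exact: chart_continuous.
apply: (continuous_comp c1); apply: smooth_near_continuous.
rewrite (_ : frame_coords u = fun q => frame_coords u (fst q, snd q)); last first.
  by apply/funext => -[].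
apply: smooth_near_frame_coords => //.
- by apply: smooth_near_clin => q; exact: cvg_fst.
- by apply: smooth_near_clin => q; exact: cvg_snd.
Qed.

Lemma frame_chart_inv_continuous u e : (frame_chart u @` frame_dom u) e ->
  {for e, continuous (frame_chart_inv u)}.
Proof.
rewrite frame_chart_image => de; have [[c1 c2] g ue] := de.
apply: (@frame_continuous _ _ _ _ _ _ _ (fpt u)); first by rewrite fpt_chart_inv.
  rewrite (_ : _ \o _ = chart_inv (fpt u) \o (fun e => lsubmx e)); last first.
    by apply/funext => e'; rewrite /= fpt_chart_inv.
  apply: continuous_comp; first exact: smooth_near_continuous (smooth_near_lsubmx e).
  by apply: chart_inv_continuous; exists (coords_base u e).
apply: smooth_near_continuous; apply: smooth_near_ext (smooth_near_coords_mx u ue).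
by apply: filterS (coords_dom_near de) => e' de' /=; rewrite frame_mx_chart_inv.
Qed.

Lemma smooth_near_gchange x u e : coords_dom u e -> gdom D x (coords_base u e) ->
  smooth_near (fun e => frame_mx D x (frame_chart_inv u e)) e.
Proof.
move=> de xe; have [[c1 c2] g ue] := de.
have s1 := smooth_near_base de (gtrans_smooth g xe).
apply: smooth_near_ext (smooth_near_mulmx s1 (smooth_near_coords_mx u ue)).
apply: filterS (coords_dom_near de) => e' de' /=.
rewrite (@frame_mx_change _ _ _ _ (fpt u)) ?fpt_chart_inv ?frame_mx_chart_inv //.
by case: de'.
Qed.

Lemma frame_chart_smooth u u' v : frame_dom u v -> frame_dom u' v ->
  smooth_near (frame_chart u' \o frame_chart_inv u) (frame_chart u v).
Proof.
move=> uv [c' g' un']; have [bE mE vE de] := frame_chartE uv.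
apply: smooth_near_frame_coords.
- have sc : smooth_fun_at (chart (fpt u')) (coords_base u (frame_chart u v)).
    by rewrite bE; exact: smooth_fun_chart_self.
  by apply: smooth_near_eq (smooth_near_base de sc) => e; rewrite fpt_chart_inv.
- by apply: smooth_near_gchange => //; rewrite bE.
- by rewrite vE.
Qed.

Lemma frame_dom_open u : open (frame_dom u).
Proof. by rewrite openE => u' /frame_dom_near. Qed.

Lemma frame_chart_open u : open (frame_chart u @` frame_dom u).
Proof. by rewrite frame_chart_image openE => e /coords_dom_near. Qed.

Lemma frame_chartK u u' : frame_dom u u' -> frame_chart_inv u (frame_chart u u') = u'.
Proof. by case/frame_chartE. Qed.

Definition frame_manifold : manifold C := @Manifold R C P frame_dom frame_chart
  frame_chart_inv (@frame_hausdorff _ _ _ D) (@frame_second_countable _ _ _ D)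
  frame_domxx frame_dom_open frame_chart_open frame_chartK frame_chart_continuous
  frame_chart_inv_continuous frame_chart_smooth.

End FrameCharts.

(** * The principal bundle structure on frames *)

Section FrameBundle.
Context {R : realType} {m : nat} {N : manifold 'rV[R]_m.+1}.
Variable D : gauge N.
Local Notation H := (isotropy R m).
Local Notation MX := 'M[R]_m.+2.
Local Notation P := (frame_manifold D).
Implicit Types (u : P) (x y : N) (k : MX).

Definition frame_proj u : N := fpt u.
Definition frame_act u k : P := mk_frame (fpt u) (fmx u *m k).

Lemma fpt_act u k : fpt (frame_act u k) = fpt u.
Proof. exact: fpt_mk. Qed.

Lemma fmx_act u k : H k -> fmx (frame_act u k) = fmx u *m k.
Proof. by move=> Hk; apply: fmx_mk; apply: isotropyM => //; exact: fmxP. Qed.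

Lemma frame_mx_act x u k : H k -> frame_mx D x (frame_act u k) = frame_mx D x u *m k.
Proof. by move=> Hk; rewrite /frame_mx fpt_act fmx_act // mulmxA. Qed.

Lemma frame_act1 u : frame_act u 1%:M = u.
Proof.
apply: frame_eq; first exact: fpt_act.
by rewrite fmx_act ?mulmx1 //; exact: isotropy1.
Qed.

Lemma frame_actM u h k : H h -> H k -> frame_act (frame_act u h) k = frame_act u (h *m k).
Proof.
move=> Hh Hk; apply: frame_eq; rewrite ?fpt_act //.
by rewrite !fmx_act ?mulmxA //; exact: isotropyM.
Qed.

Lemma frame_proj_act u h : H h -> frame_proj (frame_act u h) = frame_proj u.
Proof. by move=> _; exact: fpt_act. Qed.

Lemma coords_dom_self u : coords_dom (D := D) u (chart u u).
Proof. by case: (frame_chartE (@frame_domxx _ _ _ D u)). Qed.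

Lemma coords_base_self u : coords_base u (chart u u) = fpt u.
Proof. by case: (frame_chartE (@frame_domxx _ _ _ D u)). Qed.

Lemma frame_proj_smooth u : smooth_map_at frame_proj u.
Proof.
split; first exact: fpt_continuous.
have sc : smooth_fun_at (chart (fpt u)) (coords_base u (chart u u)).
  by rewrite coords_base_self; apply: smooth_fun_chart_self; exact: chart_dom_refl.
apply: smooth_near_eq (smooth_near_base (coords_dom_self u) sc) => e /=.
by rewrite -fpt_chart_inv.
Qed.

Lemma frame_mx_smooth x u : gdom D x (fpt u) -> smooth_fun_at (frame_mx D x : P -> MX) u.
Proof.
move=> xu; apply: smooth_near_gchange; first exact: coords_dom_self.
by rewrite coords_base_self.
Qed.

Lemma frame_act_smooth u h : H h -> smooth_map2_at H frame_act u h.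
Proof.
move=> Hh; pose u1 := frame_act u h; pose x := fpt u.
have e1 : fpt u1 = x by exact: fpt_act.
pose b (q : 'rV[R]_(m.+1 + isotropy_dim R m) * MX) := coords_mx u q.1 *m q.2.
have [_ mE _ [[_ _] _ ue]] := frame_chartE (@frame_domxx _ _ _ D u).
have mE' : coords_mx u (chart u u) = fmx u by rewrite mE frame_mx_self.
have un : 1%:M + invmx (fmx u1) *m (fmx u *m h) \in unitmx.
  rewrite -fmx_act // mulVmx ?fmx_unit //.
  by case: (@frame_domxx _ _ _ D u1); rewrite frame_mx_self mulVmx ?fmx_unit.
(* The smooth extension off [H] required by [smooth_map2_at]: the coordinate formula of the action,
   read for arbitrary matrices. *)
exists (fun q => frame_coords u1 (lsubmx q.1, b q)).
  apply: smooth_near_frame_coords.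
  - apply: smooth_near_linf; first exact: findim_mx.
    by apply: smooth_near_clin => q; exact: cvg_fst.
  - apply: smooth_near_mulmx.
      apply: (@smooth_near_comp _ _ _ _ fst (coords_mx u)).
      + exact: findim_mx.
      + by apply: smooth_near_clin => q; exact: cvg_fst.
      + exact: smooth_near_coords_mx.
    by apply: smooth_near_clin => q; exact: cvg_snd.
  - by rewrite /b /= mE'.
have n1 : \forall z \near (u, h), @frame_dom _ _ _ D u z.1.
  apply: near_continuous; first exact: continuous_fst.
  by apply: frame_dom_near; exact: frame_domxx.
have n2 : \forall z \near (u, h), 1%:M + invmx (fmx u1) *m (frame_mx D x z.1 *m z.2) \in unitmx.
  apply: (@near_unitmx R m.+2 _ (fun z : P * MX => 1%:M + invmx (fmx u1) *m
      (frame_mx D x z.1 *m z.2))); last first.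
    by rewrite /= frame_mx_self.
  apply: (@continuous_comp _ _ _ (fun z : P * MX => (frame_mx D x z.1, z.2))
    (fun q : MX * MX => 1%:M + invmx (fmx u1) *m (q.1 *m q.2))).
    apply: continuous_pair; last exact: continuous_snd.
    apply: (@continuous_comp _ _ _ fst (frame_mx D x : P -> MX)).
      exact: continuous_fst.
    by apply: frame_mx_continuous; exact: gdomxx.
  apply: smooth_near_continuous; apply: smooth_nearD; first exact: smooth_near_cst.
  apply: smooth_near_mulmx; first exact: smooth_near_cst.
  apply: smooth_near_mulmx; apply: smooth_near_clin => q.
    exact: cvg_fst.
  exact: cvg_snd.
apply: filterS2 n1 n2 => -[v k] /= dv un' Hk.
have [bE mEv _ _] := frame_chartE dv; case: dv => c g _.
split.
  by split; rewrite ?fpt_act ?e1 // frame_mx_act // e1.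
rewrite /= /frame_chart -/u1 fpt_act e1 frame_mx_act // /b /= mEv.
by rewrite /frame_chart /frame_coords row_mxKl.
Qed.

Lemma frame_of_smooth x y k : gdom D x y -> H k ->
  smooth_map2_at H (frame_of D x : N -> MX -> P) y k.
Proof.
move=> xy Hk; pose u1 : P := frame_of D x y k.
have e1 : fpt u1 = y by exact: fpt_frame_of.
have E z k' : gdom D x z -> H k' ->
    frame_mx D y (frame_of D x z k') = gchange D x y z *m k'.
  by move=> xz Hk'; rewrite (frame_mx_change (x := x)) ?fpt_frame_of // frame_ofK.
pose b (q : 'rV[R]_m.+1 * MX) := gchange D x y (chart_inv y q.1) *m q.2.
have un : 1%:M + invmx (fmx u1) *m (gchange D x y y *m k) \in unitmx.
  rewrite -E // -/u1 -e1 frame_mx_self.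
  by case: (@frame_domxx _ _ _ D u1); rewrite frame_mx_self.
have sg := gtrans_smooth xy (gdomxx D y).
(* The extension to all matrices, where [b] passes from the trivialization at [x] to the one at [y],
   on which the chart of [u1] is built. *)
exists (fun q => frame_coords u1 (q.1, b q)).
  apply: smooth_near_frame_coords.
  - by apply: smooth_near_clin => q; exact: cvg_fst.
  - apply: smooth_near_mulmx; last by apply: smooth_near_clin => q; exact: cvg_snd.
    apply: (@smooth_near_comp _ _ _ _ fst (fun e => gchange D x y (chart_inv y e))).
    + exact: findim_mx.
    + by apply: smooth_near_clin => q; exact: cvg_fst.
    + exact: sg.
  - by rewrite /b /= chart_invxx.
have n1 : \forall z \near (y, k), chart_dom y z.1.
  apply: near_continuous; first exact: continuous_fst.
  by apply: chart_nbhs; exact: chart_dom_refl.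
have n2 : \forall z \near (y, k), gdom D x z.1.
  by apply: near_continuous; [exact: continuous_fst|exact: gdom_near].
have n3 : \forall z \near (y, k), gdom D y z.1.
  by apply: near_continuous; [exact: continuous_fst|apply: gdom_near; exact: gdomxx].
have n4 : \forall z \near (y, k), 1%:M + invmx (fmx u1) *m (gchange D x y z.1 *m z.2) \in unitmx.
  apply: (@near_unitmx R m.+2 _ (fun z : N * MX => 1%:M + invmx (fmx u1) *m
      (gchange D x y z.1 *m z.2))) => //.
  have c := @gchange_continuous _ _ _ D x y (y, k) xy (gdomxx D y).
  apply: (@continuous_comp _ _ _ _ (fun q : N * MX => 1%:M + invmx (fmx u1) *m q.2)) c _.
  apply: (@continuous_comp _ _ _ snd (fun q : MX => 1%:M + invmx (fmx u1) *m q)).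
    exact: continuous_snd.
  apply: smooth_near_continuous; apply: smooth_nearD; first exact: smooth_near_cst.
  by apply: smooth_near_mulmx; [exact: smooth_near_cst|exact: smooth_near_id].
apply: filterS3 n1 n2 (filterI n3 n4) => -[z k'] /= cz xz [yz un'] Hk'.
have Ez := E z k' xz Hk'.
split; first by split; rewrite ?fpt_frame_of ?e1 // Ez.
by rewrite /= /frame_chart -/u1 fpt_frame_of e1 Ez /b /= chartK.
Qed.

Definition frame_local_triv x : local_triv H frame_proj frame_act x.
Proof.
refine (@LocalTriv R _ N _ H _ P frame_proj frame_act x (gdom D x) (frame_mx D x : P -> MX)
    (frame_of D x : N -> MX -> P) _ _ _ _ _ _ _ _).
- exact: gdomP.
- by move=> u; exact: frame_mx_isotropy.
- by move=> u h _ Hh; exact: frame_mx_act.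
- by move=> u; exact: frame_mxK.
- by move=> y h _ _; exact: fpt_frame_of.
- by move=> y h; exact: frame_ofK.
- by move=> u; exact: frame_mx_smooth.
- by move=> y h; exact: frame_of_smooth.
Defined.

Definition frame_bundle : principal_bundle N H := PrincipalBundle
  frame_act1 frame_actM frame_proj_act frame_proj_smooth frame_act_smooth
  (fun x => inhabits (frame_local_triv x)).

End FrameBundle.

(** * The Cartan connection of a gauge *)

Section FrameForm.
Context {R : realType} {m : nat} {N : manifold 'rV[R]_m.+1}.
Variable D : gauge N.
Local Notation H := (isotropy R m).
Local Notation MX := 'M[R]_m.+2.
Local Notation P := (frame_manifold D).
Implicit Types (u : P) (x y : N) (k : MX).

Definition frame_form_at x u (v : tangent u) : MX :=
  invmx (frame_mx D x u) *m (gform D x (tangent_map (@frame_proj _ _ _ D) v) *m frame_mx D x u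
    + fun_deriv (frame_mx D x : P -> MX) v).

Lemma frame_mx_unit x u : gdom D x (fpt u) -> frame_mx D x u \in unitmx.
Proof. by move=> xu; apply: isotropy_unit; exact: frame_mx_isotropy. Qed.

Lemma frame_gdom_near x u : gdom D x (fpt u) -> \forall u' \near u, gdom D x (fpt u').
Proof. by move=> xu; exact: near_continuous (@fpt_continuous _ _ _ D u) (gdom_near xu). Qed.

(** With b the change of frames, M' = b M and dM' = b dM + db M. The gauge law b Gamma = Gamma' b +
    db turns b (Gamma M + dM) into Gamma' M' + dM'. *)
Lemma frame_form_change x x' u (v : tangent u) : gdom D x (fpt u) -> gdom D x' (fpt u) ->
  frame_form_at x v = frame_form_at x' v.
Proof.
move=> xu x'u; set w := tangent_map (@frame_proj _ _ _ D) v.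
have e : \forall u' \near u,
    gchange D x x' (frame_proj u') *m frame_mx D x u' = frame_mx D x' u'.
  by apply: filterS (frame_gdom_near xu) => u' xu'; rewrite -frame_mx_change.
have sp := @frame_proj_smooth _ _ _ D u.
have sg : smooth_fun_at (gchange D x x') (frame_proj u) by exact: gtrans_smooth.
have sgp : smooth_fun_at (fun u' : P => gchange D x x' (frame_proj u')) u.
  exact: smooth_fun_map sp sg.
have st : smooth_fun_at (frame_mx D x : P -> MX) u by exact: frame_mx_smooth.
have sgt := smooth_near_mulmx sgp st.
have dE : fun_deriv (frame_mx D x' : P -> MX) v =
    gchange D x x' (fpt u) *m fun_deriv (frame_mx D x : P -> MX) v
    + fun_deriv (gchange D x x') w *m frame_mx D x u.
  apply: etrans (fun_deriv_ext v e sgt) _.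
  apply: etrans (fun_deriv_mulmx v sgp st) _; congr (_ + _ *m _).
  exact: (fun_deriv_map v sp sg).
have := gform_gauge w xu x'u; rewrite -/(gchange D x x' (fpt u)) => gE.
have gauge_key (b t a a' db dt : MX) : b *m a = a' *m b + db ->
    b *m (a *m t + dt) = a' *m (b *m t) + (b *m dt + db *m t).
  by move=> bE; rewrite mulmxDr !mulmxA bE mulmxDl -addrA; congr (_ + _); rewrite addrC.
have E : frame_mx D x' u *m frame_form_at x v =
    gform D x' w *m frame_mx D x' u + fun_deriv (frame_mx D x' : P -> MX) v.
  rewrite dE (frame_mx_change (D := D) x' xu) /frame_form_at -/w -mulmxA mulKVmx ?frame_mx_unit
      //.
  exact: gauge_key.
by rewrite -[LHS](mulKmx (frame_mx_unit x'u)) E.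
Qed.

Definition frame_form_fun u (v : tangent u) : MX := frame_form_at (fpt u) v.

Lemma frame_form_linear u : linear (@frame_form_fun u).
Proof.
move=> a v w; rewrite /frame_form_fun /frame_form_at.
have key (i A B t b c : MX) : i *m ((a *: A + B) *m t + (a *: b + c)) =
    a *: (i *m (A *m t + b)) + i *m (B *m t + c).
  by rewrite scalemxAr -mulmxDr mulmxDl scalerDr -scalemxAl addrACA.
have -> : tangent_map (@frame_proj _ _ _ D) (a *: v + w) =
    a *: tangent_map (@frame_proj _ _ _ D) v + tangent_map (@frame_proj _ _ _ D) w.
  exact: fun_derivP.
rewrite (gform_linear (gdomxx D (fpt u))) (fun_derivP (frame_mx D (fpt u) : P -> MX)).
exact: key.
Qed.

Definition frame_form u : {linear tangent u -> MX} :=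
  HB.pack (@frame_form_fun u) (GRing.isLinear.Build _ _ _ _ _ (@frame_form_linear u)).

Lemma frame_formE x u (v : tangent u) : gdom D x (fpt u) ->
  frame_form u v = frame_form_at x v.
Proof. by move=> xu; apply: frame_form_change => //; exact: gdomxx. Qed.

Lemma frame_tangent_proj u (v : tangent u) : tangent_map (@frame_proj _ _ _ D) v = lsubmx
    (v : 'rV[R]_(m.+1 + isotropy_dim R m)).
Proof.
have e : \forall e \near chart u u, lsubmx e =
    chart (fpt u) (frame_proj (chart_inv u e)) :> 'rV[R]_m.+1.
  apply: filterS (coords_dom_near (coords_dom_self u)) => e [[_ c2] _ _].
  by rewrite -c2 -fpt_chart_inv.
apply: etrans (der_ext v e (smooth_near_lsubmx _)) _.
by rewrite der_lin //; exact: findim_mx.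
Qed.

Lemma frame_deriv_ell x u (v : tangent u) : gdom D x (fpt u) ->
  fun_deriv (frame_mx D x : P -> MX) v *m ell = 0 :> 'cV[R]_m.+2.
Proof.
move=> xu; have st : smooth_fun_at (frame_mx D x : P -> MX) u by exact: frame_mx_smooth.
have e : \forall u' \near u, frame_mx D x u' *m ell = ell :> 'cV[R]_m.+2.
  by apply: filterS (frame_gdom_near xu) => u' xu'; case: (frame_mx_isotropy xu').
have sc := @smooth_fun_cst _ _ P _ (ell : 'cV[R]_m.+2) u.
have := fun_deriv_ext v e (smooth_near_mulmx st (smooth_near_cst _ _)).
rewrite fun_deriv_cst => ->; apply: esym.
apply: etrans (fun_deriv_mulmx v st sc) _.
by rewrite fun_deriv_cst mulmx0 add0r.
Qed.

Lemma fmx_ell (u : P) : fmx u *m ell = ell :> 'cV[R]_m.+2.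
Proof. by case: (fmxP u). Qed.

(** Frame matrices fix [ell], so their derivatives kill it, and the [ell] column of the form sees
    only the projection of [v]. This column separates base directions from vertical ones. *)
Lemma frame_form_ell u (v : tangent u) : frame_form u v *m ell =
  invmx (fmx u) *m (gform D (fpt u) (tangent_map (@frame_proj _ _ _ D) v) *m ell).
Proof.
rewrite /frame_form /= /frame_form_fun /frame_form_at frame_mx_self -!mulmxA mulmxDl.
by rewrite frame_deriv_ell ?addr0 -?mulmxA ?fmx_ell //; exact: gdomxx.
Qed.

Lemma frame_form_inj u : injective (frame_form u).
Proof.
apply: raddf_inj => v v0.
have w0 : tangent_map (@frame_proj _ _ _ D) v = 0.
  apply: (@gform_inj _ _ _ D (fpt u)).
  apply: (can_inj (mulKVmx (fmx_unit u))).
  by rewrite mulmx0 -frame_form_ell v0 mul0mx.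
have d0 : fun_deriv (frame_mx D (fpt u) : P -> MX) v = 0.
  move: v0; rewrite /frame_form /= /frame_form_fun /frame_form_at w0 frame_mx_self.
  have g0 := linear_fun0 (gform_linear (gdomxx D (fpt u))).
  rewrite g0 mul0mx add0r => e; apply: (can_inj (mulKVmx (fmx_unit u))).
  by rewrite e mulmx0.
(* The vector [v] is the derivative of the chart along itself, and the chart is a function of base
   point and frame matrix, whose derivatives along [v] have just been shown to vanish. *)
rewrite -[v](fun_deriv_chart (M := P)).
have sp := proj2 (@frame_proj_smooth _ _ _ D u).
have st : smooth_fun_at (frame_mx D (fpt u) : P -> MX) u by apply: frame_mx_smooth; exact: gdomxx.
have un : 1%:M + invmx (fmx u) *m frame_mx D (fpt u) u \in unitmx.
  by case: (@frame_domxx _ _ _ D u).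
have sf : smooth_fun_at (fun u' : P => (chart (fpt u) (fpt u'), frame_mx D (fpt u) u')) u.
  exact: smooth_near_pair sp st.
have sc : smooth_near (frame_coords u) (chart (fpt u) (fpt u), frame_mx D (fpt u) u).
  rewrite (_ : frame_coords u = fun q => frame_coords u (fst q, snd q)); last first.
    by apply/funext => -[].
  apply: smooth_near_frame_coords => //.
  - by apply: smooth_near_clin => q; exact: cvg_fst.
  - by apply: smooth_near_clin => q; exact: cvg_snd.
apply: etrans (fun_deriv_comp v sf sc) _.
have -> : fun_deriv (fun u' : P => (chart (fpt u) (fpt u'), frame_mx D (fpt u) u')) v = 0.
  apply: etrans (der_pair v sp st) _.
  by congr pair; [exact: w0|exact: d0].
exact: der0.
Qed.

Lemma skew_algJ X k : H k -> skew_alg X -> skew_alg (invmx k *m X *m k).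
Proof.
move=> Hk sX; have uk := isotropy_unit Hk; have /isotropyP[kJk _] := Hk.
have /isotropyP[kJk' _] := isotropyV Hk.
have e1 : (invmx k)^T *m gram R m = gram R m *m k.
  by apply: (can_inj (mulmxK (isotropy_unit (isotropyV Hk)))); rewrite kJk' mulmxK.
have e2 : gram R m *m invmx k = k^T *m gram R m.
  by apply: (can_inj (mulmxK uk)); rewrite mulmxKV // kJk.
rewrite /skew_alg !trmx_mul -!mulmxA e1 [X in _ + X]mulmxA e2.
have -> : k^T *m (X^T *m (gram R m *m k)) + k^T *m gram R m *m (X *m k) =
    k^T *m (X^T *m gram R m + gram R m *m X) *m k by rewrite mulmxDr mulmxDl !mulmxA.
by rewrite sX mulmx0 mul0mx.
Qed.

Lemma skew_algD X Y : skew_alg X -> skew_alg Y -> skew_alg (X + Y : MX).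
Proof.
by rewrite /skew_alg linearD /= mulmxDl mulmxDr addrACA => -> ->; rewrite addr0.
Qed.

Lemma skew_algN X : skew_alg X -> skew_alg (- X : MX).
Proof.
by rewrite /skew_alg linearN /= mulNmx mulmxN -opprD => ->; rewrite oppr0.
Qed.

(** The summand M^-1 Gamma M is a conjugate of a skew matrix by an isometry, and M^-1 dM is skew by
    differentiating M^T J M = J. *)
Lemma frame_form_skew u (v : tangent u) : skew_alg (frame_form u v).
Proof.
rewrite /frame_form /= /frame_form_fun /frame_form_at frame_mx_self mulmxDr.
apply: skew_algD.
  by rewrite mulmxA; apply: skew_algJ; [exact: fmxP|apply: gform_skew; exact: gdomxx].
have st : smooth_fun_at (frame_mx D (fpt u) : P -> MX) u by apply: frame_mx_smooth; exact: gdomxx.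
have nJ : \forall u' \near u, (frame_mx D (fpt u) u')^T *m gram R m *m frame_mx D (fpt u) u' =
    gram R m.
  apply: filterS (frame_gdom_near (gdomxx D (fpt u))) => u' du'.
  by have /isotropyP[] := frame_mx_isotropy du'.
have := der_gram v st (chart_inv_cvg (chart_dom_refl (u : P)) nJ).
rewrite /comp chart_invxx frame_mx_self -/(fun_deriv (frame_mx D (fpt u) : P -> MX) v) => dE.
have /isotropyP[kJk _] := fmxP u; have uk := fmx_unit u.
set k := fmx u in dE kJk uk *; set X := fun_deriv _ _ in dE *.
have e2 : gram R m *m invmx k = k^T *m gram R m.
  by apply: (can_inj (mulmxK uk)); rewrite mulmxKV // kJk.
have e1 : (invmx k)^T *m gram R m = gram R m *m k.
  by have := congr1 trmx e2; rewrite !trmx_mul !gram_tr trmxK => <-.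
by rewrite /skew_alg trmx_mul [X in _ + X]mulmxA e2 -(mulmxA X^T) e1 mulmxA.
Qed.

Lemma frame_form_act u h (v : tangent u) : H h ->
  frame_form (frame_act u h) (tangent_map (fun u' : P => frame_act u' h) v)
  = invmx h *m frame_form u v *m h.
Proof.
move=> Hh; have xu : gdom D (fpt u) (fpt u) by exact: gdomxx.
have sr : smooth_map_at (fun u' : P => frame_act u' h) u.
  apply: (@smooth_map2_comp _ _ _ _ P P P _ H _ _ id (fun=> h)) => //.
  - exact: findim_mx.
  - exact: frame_act_smooth.
  - exact: smooth_map_id.
  - exact: smooth_fun_cst.
  - exact: near_all.
have pr (u' : P) : frame_proj (frame_act u' h) = frame_proj u' by exact: fpt_act.
have e1 := @near_all P u (fun u' => frame_proj u' = frame_proj (frame_act u' h))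
  (fun u' => esym (pr u')).
have e2 := @near_all P u (fun u' => frame_mx D (fpt u) u' *m h = frame_mx D (fpt u)
    (frame_act u' h))
  (fun u' => esym (@frame_mx_act _ _ _ D (fpt u) u' h Hh)).
have xu' : gdom D (fpt u) (fpt (frame_act u h)) by rewrite fpt_act.
rewrite (@frame_formE (fpt u) (frame_act u h) _ xu').
rewrite (@frame_formE (fpt u) u _ xu) /frame_form_at frame_mx_act //.
have := tangent_map_comp v sr (frame_proj_smooth (frame_act u h)).
rewrite (tangent_map_ext v e1 (frame_proj_smooth u)).
have st : smooth_fun_at (frame_mx D (fpt u) : P -> MX) u by exact: frame_mx_smooth.
have st' : smooth_fun_at (frame_mx D (fpt u) : P -> MX) (frame_act u h) by exact: frame_mx_smooth.
have := fun_deriv_map v sr st'.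
rewrite (fun_deriv_ext v e2 (smooth_near_mulmx st (smooth_near_cst h _))).
have -> : fun_deriv (fun u' : P => frame_mx D (fpt u) u' *m h) v =
    fun_deriv (frame_mx D (fpt u) : P -> MX) v *m h.
  apply: etrans (fun_deriv_mulmx v st (smooth_fun_cst h u)) _.
  by rewrite fun_deriv_cst mulmx0 add0r.
move=> <- pE.
(* The two base points are equal but not convertible, and the tangent types depend on them; the
   coordinates are compared as plain row vectors. *)
have gE y y' (w : tangent y) (w' : tangent y') : y = y' -> w = w' :> 'rV[R]_m.+1 ->
    gform D (fpt u) w = gform D (fpt u) w' by move=> yy; subst y' => ->.
rewrite -(gE _ _ _ _ (esym (pr u)) pE).
have uh := isotropy_unit Hh; have ut := frame_mx_unit xu.
have uth : frame_mx D (fpt u) u *m h \in unitmx by rewrite unitmx_mul ut.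
rewrite -[RHS](mulKmx uth); congr (_ *m _).
by rewrite !mulmxA (mulmxK uh) (mulmxV ut) mul1mx mulmxDl.
Qed.

Lemma frame_curve u (c : R^o -> MX) : curve_at_id H c ->
  (\forall t \near 0, chart_dom u (frame_act u (c t) : P)) /\
  smooth_near (fun t => chart u (frame_act u (c t) : P)) 0.
Proof.
move=> [sc c0 nc]; have fMX : findim MX by exact: findim_mx.
have := @smooth_map2_curve _ _ _ _ _ _ _ _ fMX c u 1%:M
  (@frame_act_smooth _ _ _ D u _ (@isotropy1 R m)) sc c0 nc.
by rewrite frame_act1.
Qed.

Lemma frame_form_fund u (c : R^o -> MX) : curve_at_id H c ->
  frame_form u ('D_1 (fun t => chart u (frame_act u (c t) : P)) 0) = 'D_1 c 0.
Proof.
move=> Hc; have [nd sc] := frame_curve u Hc; case: Hc => scc c0 nc.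
rewrite (deriveE1 sc) (deriveE1 scc).
have xu : gdom D (fpt u) (fpt u) by exact: gdomxx.
have a0 : frame_act u (c 0) = u by rewrite c0 frame_act1.
set w := der _ _ _.
have sp := @frame_proj_smooth _ _ _ D u.
have st : smooth_fun_at (frame_mx D (fpt u) : P -> MX) u by exact: frame_mx_smooth.
have pw : tangent_map (@frame_proj _ _ _ D) (w : tangent u) = 0.
  apply: etrans (esym (fun_deriv_curve a0 nd sc (proj2 sp))) _.
  have e := @near_all R^o 0 (fun t => chart (frame_proj u) (frame_proj u) = chart (frame_proj u)
      (frame_proj (frame_act u (c t))))
    (fun t => congr1 (chart (frame_proj u)) (esym (fpt_act u (c t)))).
  by rewrite (der_ext _ e (smooth_near_cst _ _)) der_cst.
have tw : fun_deriv (frame_mx D (fpt u) : P -> MX) (w : tangent u) = fmx u *m der c 0 1.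
  apply: etrans (esym (fun_deriv_curve a0 nd sc st)) _.
  have e : \forall t \near (0 : R^o), fmx u *m c t = frame_mx D (fpt u) (frame_act u (c t)).
    by apply: filterS nc => t Ht; rewrite frame_mx_act // frame_mx_self.
  by rewrite (der_ext _ e (smooth_near_mulmx (smooth_near_cst _ _) scc)) der_mulmxl.
rewrite /frame_form /= /frame_form_fun /frame_form_at pw tw frame_mx_self.
by rewrite (linear_fun0 (gform_linear xu)) mul0mx add0r mulKmx ?fmx_unit.
Qed.

(** Skewness makes X ell orthogonal to [ell], and the product with [ell] reads the last
    coordinate. *)
Lemma skew_alg_ell X : skew_alg X -> (X *m ell : 'cV[R]_m.+2) ord_max 0 = 0.
Proof.
move=> sX; rewrite -lorentz_ell.
have e : lorentz (X *m ell) ell = - lorentz ell (X *m ell) :> R.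
  rewrite /lorentz -/(gram R m) trmx_mul.
  have XJ : X^T *m gram R m = - (gram R m *m X) by apply/eqP; rewrite -addr_eq0 sX.
  rewrite -(mulmxA _ X^T) XJ mulmxN mulNmx mxE; congr (- _).
  by rewrite !mulmxA.
by move: e; rewrite (lorentzC ell); lra.
Qed.

(* Both sides have dimension m + 1, and the map is injective by [gform_inj]. *)
Lemma gform_ell_surj x (a : 'cV[R]_m.+2) : a ord_max 0 = 0 ->
  exists w : tangent x, gform D x w *m ell = a.
Proof.
move=> a0; have xx := gdomxx D x.
pose f (w : 'rV[R]_m.+1) := (row' ord_max (gform D x (w : tangent x) *m ell : 'cV[R]_m.+2))^T.
have lf : linear f.
  move=> b v w; rewrite /f (gform_linear xx) mulmxDl -scalemxAl.
  by rewrite !linearD !linearZ.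
pose L : {linear 'rV[R]_m.+1 -> 'rV[R]_m.+1} := HB.pack f (GRing.isLinear.Build _ _ _ _ _ lf).
have cvE (b c : 'cV[R]_m.+2) : b ord_max 0 = 0 -> c ord_max 0 = 0 ->
    (row' ord_max b)^T = (row' ord_max c)^T -> b = c.
  move=> b0 c0 /trmx_inj/colP bc; apply/colP => i.
  case: (unliftP ord_max i) => [j ->|->]; last by rewrite b0 c0.
  by have := bc j; rewrite [LHS]mxE [RHS]mxE.
have ge0 w : (gform D x (w : tangent x) *m ell : 'cV[R]_m.+2) ord_max 0 = 0.
  by apply: skew_alg_ell; exact: gform_skew.
have Linj : row_free (lin1_mx L).
  rewrite -kermx_eq0; apply/rowV0P => w /sub_kermxP.
  rewrite mul_rV_lin1 => fw0; apply: (@gform_inj _ _ _ D x).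
  apply: cvE; rewrite ?ge0 //; first by rewrite mxE.
  by apply: etrans fw0 _; rewrite !linear0.
exists ((row' ord_max a)^T *m invmx (lin1_mx L)); apply: cvE => //.
have := mulmxKV (etrans (esym (row_free_unit _)) Linj) (row' ord_max a)^T.
by rewrite mul_rV_lin1.
Qed.

(** A base direction [w] first matches the column X ell. The remainder is skew and kills [ell], so
    it is the velocity of a curve in [H], which the form recovers on vertical vectors. *)
Lemma frame_form_surj u X : skew_alg X -> exists v : tangent u, frame_form u v = X.
Proof.
move=> sX; have Xl := skew_alg_ell sX.
have kXl : (fmx u *m (X *m ell) : 'cV[R]_m.+2) ord_max 0 = 0.
  have [[iso _] kl] := fmxP u.
  by rewrite -lorentz_ell -{2}kl iso lorentz_ell.
have [w wE] := gform_ell_surj (fpt u) kXl.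
pose v0 : tangent u := row_mx (w : 'rV[R]_m.+1) 0.
have p0 : tangent_map (@frame_proj _ _ _ D) v0 = w :> 'rV[R]_m.+1.
  by rewrite frame_tangent_proj row_mxKl.
have l0 : (X - frame_form u v0) *m ell = 0 :> 'cV[R]_m.+2.
  by rewrite mulmxBl frame_form_ell p0 wE mulKmx ?fmx_unit // subrr.
have s0 : skew_alg (X - frame_form u v0).
  by apply: skew_algD => //; apply: skew_algN; exact: frame_form_skew.
have [c [_ /(_ l0) Hc] cE] := cayley_curve s0.
exists (v0 + 'D_1 (fun t => chart u (frame_act u (c t) : P)) 0).
by rewrite linearD (frame_form_fund u Hc) cE addrC subrK.
Qed.

Lemma frame_form_image u : range (frame_form u) = lie_algebra (lorentz_group R m).
Proof.
apply/seteqP; split=> [_ [v _ <-]|X /lie_algebra_lorentz/(frame_form_surj u)[v <-]].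
  by apply/lie_algebra_lorentz; exact: frame_form_skew.
by exists v.
Qed.

(** Near [u0] everything is rewritten in the chart of [u0] and the single trivialization at [x0],
    because the form and the designated chart at [u] are given by data that jump with [u]. *)
Lemma frame_form_smooth : smooth_form frame_form.
Proof.
move=> u0 v; set x0 := fpt u0.
have nd := chart_nbhs (chart_dom_refl (u0 : P)).
have x00 : gdom D x0 x0 by exact: gdomxx.
have st : smooth_fun_at (frame_mx D x0 : P -> MX) u0 by exact: frame_mx_smooth.
have sg : smooth_fun_at (fun y => gform D x0 (coord_field x0
    (lsubmx (v : 'rV[R]_(m.+1 + isotropy_dim R m)) : 'rV[R]_m.+1) y)) x0.
  exact: gform_smooth.
have sgp := smooth_fun_map (@frame_proj_smooth _ _ _ D u0) sg.
have sd : smooth_fun_at (fun u : P => der (fun e => frame_mx D x0 (chart_inv u0 e)) (chart u0 u)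
    v) u0.
  have := smooth_near_der v st; apply: smooth_near_ext.
  apply: filterS (near_chart_invK (chart_dom_refl u0)) => e [_ eE].
  exact: (congr1 (fun z => der _ z v) (esym eE)).
have si : smooth_fun_at (fun u : P => invmx (frame_mx D x0 u)) u0.
  by apply: smooth_near_invmx st; rewrite /comp chart_invxx frame_mx_unit.
have sF : smooth_fun_at (fun u : P => invmx (frame_mx D x0 u) *m
    (gform D x0 (coord_field x0 (lsubmx (v : 'rV[R]_(m.+1 + isotropy_dim R m)) : 'rV[R]_m.+1)
        (frame_proj u)) *m frame_mx D x0 u
     + der (fun e => frame_mx D x0 (chart_inv u0 e)) (chart u0 u) v)) u0.
  exact: smooth_near_mulmx si (smooth_nearD (smooth_near_mulmx sgp st) sd).
apply: smooth_fun_ext sF.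
apply: filterS nd => u du; have [cu gu _] := du.
rewrite (@frame_formE x0 u _ gu) /frame_form_at.
have st' : smooth_fun_at (frame_mx D x0 : P -> MX) u by exact: frame_mx_smooth.
rewrite (@coord_field_deriv _ _ P _ _ u0 v u du st'); congr (_ *m (gform _ _ _ *m _ + _)).
have sc : smooth_fun_at (fun u' : P => chart (fpt u) (fpt u')) u by exact:
    (proj2 (frame_proj_smooth u)).
(* It remains to see that a coordinate field of the total space projects to the coordinate field of
   [N] given by the first m + 1 entries of [v]: these are the base coordinates. *)
apply: esym; apply: etrans (@coord_field_deriv _ _ P _ _ u0 v u du sc) _.
have [bE mE vE de] := frame_chartE du.
have clE : lsubmx (chart u0 u) = chart x0 (fpt u) :> 'rV[R]_m.+1.
  by case: de => -[_ <-] _ _; rewrite bE.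
have sl := smooth_near_lsubmx (chart u0 u : 'rV[R]_(m.+1 + isotropy_dim R m)).
have sy : smooth_near (chart (fpt u) \o chart_inv x0)
    (lsubmx (chart u0 u : 'rV[R]_(m.+1 + isotropy_dim R m)) : 'rV[R]_m.+1).
  by rewrite clE; apply: chart_smooth => //; exact: chart_dom_refl.
have e := @near_all _ (chart u0 u) (fun e => (chart (fpt u) \o chart_inv x0) (lsubmx e) = chart
    (fpt u) (fpt (chart_inv u0 e)))
  (fun e => congr1 (chart (fpt u)) (esym (fpt_chart_inv u0 e))).
apply: etrans (der_ext _ e (smooth_near_comp (@findim_mx _ _ _) sl sy)) _.
apply: etrans (der_comp _ sl sy) _.
rewrite der_lin; last exact: findim_mx.
by rewrite clE.
Qed.

Definition gauge_geometry : cartan_geometry N :=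
  @CartanGeometry R m N (frame_bundle D) frame_form frame_form_smooth frame_form_inj
    frame_form_image frame_form_act frame_form_fund.

End FrameForm.

(** * Tractor connections and uniqueness *)

Section TractorGauge.
Context {R : realType} {m : nat} {N : manifold 'rV[R]_m.+1}.
Variable C : cartan_geometry N.
Local Notation H := (isotropy R m).
Local Notation MX := 'M[R]_m.+2.
Local Notation V := 'cV[R]_m.+2.
Implicit Types (u : C) (x y : N).

Lemma local_section_bproj x y : ltdom (triv_at C x) y -> bproj (local_section C x y) = y.
Proof. by move=> xy; apply: ltriv_inv_proj => //; exact: isotropy1. Qed.

Lemma local_section_smooth x y : ltdom (triv_at C x) y ->
  smooth_map_at (local_section C x) y.
Proof.
move=> xy; apply: (@smooth_map2_comp _ _ _ _ N C N _ H (ltriv_inv (triv_at C x)) _ id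
    (fun=> 1%:M)).
- exact: findim_mx.
- by apply: ltriv_inv_smooth => //; exact: isotropy1.
- exact: smooth_map_id.
- exact: smooth_fun_cst.
- by apply: near_all => _; exact: isotropy1.
Qed.

Lemma ltdomxx x : ltdom (triv_at C x) x.
Proof. by case: (ltdomP (triv_at C x)). Qed.

Lemma ltdom_near x : \forall y \near x, ltdom (triv_at C x) y.
Proof. exact: open_nbhs_nbhs (ltdomP (triv_at C x)). Qed.

Lemma local_section_act x u : ltdom (triv_at C x) (bproj u) ->
  bact (local_section C x (bproj u)) (ltriv (triv_at C x) u) = u.
Proof.
move=> xu; have Ht := ltriv_in xu; have ps := local_section_bproj xu.
have xs : ltdom (triv_at C x) (bproj (local_section C x (bproj u))) by rewrite ps.
have pb : bproj (bact (local_section C x (bproj u)) (ltriv (triv_at C x) u)) = bproj u.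
  by rewrite bproj_act.
rewrite -[LHS](ltrivK (l := triv_at C x)); last by rewrite pb.
rewrite pb ltriv_act // ltriv_invK //; last exact: isotropy1.
by rewrite mul1mx ltrivK.
Qed.

Lemma cform_congr u u' (v : tangent u) (v' : tangent u') : u = u' ->
  v = v' :> 'rV[R]__ -> cform u v = cform u' v'.
Proof. by move=> uu; subst u' => ->. Qed.

(* [cform_act] and [cform_fund] compute the two partial derivatives of [bact]. *)
Lemma cform_bact n0 (M0 : manifold 'rV[R]_n0) (s : M0 -> C) (b : M0 -> MX) z (w : tangent z) :
  smooth_map_at s z -> smooth_fun_at b z -> (\forall z' \near z, H (b z')) ->
  cform (bact (s z) (b z)) (tangent_map (fun z' => bact (s z') (b z')) w) =
  invmx (b z) *m cform (s z) (tangent_map s w) *m b z + invmx (b z) *m fun_deriv b w.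
Proof.
move=> ss sb nH; have Hb := nbhs_singleton nH; have ub := isotropy_unit Hb.
pose h (t : R^o) := t *: (w : 'rV[R]_n0).
have lh : linear h by move=> a s' t; rewrite /h scalerDl scalerA.
pose L : {linear R^o -> 'rV[R]_n0} := HB.pack h (GRing.isLinear.Build _ _ _ _ _ lh).
have sh : smooth_near h 0 by apply: (@smooth_near_lin _ _ _ L); exact: findim_regular.
have sa : smooth_near (fun t => chart z z + h t) 0.
  by apply: smooth_nearD => //; exact: smooth_near_cst.
have a0 : chart z z + h 0 = chart z z by rewrite /h scale0r addr0.
have da : der (fun t => chart z z + h t) 0 1 = w.
  rewrite (derD _ (smooth_near_cst _ _) sh) der_cst add0r.
  by rewrite (@der_lin _ _ _ L) /= ?/h ?scale1r //; exact: findim_regular.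
have sb' : smooth_near (b \o chart_inv z) (chart z z + h 0) by rewrite a0.
pose c (t : R^o) := b (chart_inv z (chart z z + h t)).
have sc : smooth_near c 0 by exact: (smooth_near_comp (@findim_mx _ _ _) sa sb').
have c0 : c 0 = b z by rewrite /c a0 chart_invxx.
have dc : der c 0 1 = fun_deriv b w.
  by apply: etrans (der_comp _ sa sb') _; rewrite da a0.
have nHc : \forall t \near (0 : R^o), H (c t).
  have nz := chart_inv_cvg (chart_dom_refl z) nH; rewrite -a0 in nz.
  exact: near_continuous (smooth_near_continuous sa) nz.
have fMX : findim MX by exact: findim_mx.
have s2 : smooth_map2_at H (@bact _ _ _ _ _ C) (s z) (b z) by exact: bact_smooth.
rewrite (cform_congr (erefl _) (tangent_map2 fMX s2 ss sb nH sc c0 nHc dc)).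
rewrite linearD cform_act //; congr (_ + _).
(* Translated to start at the identity, the curve gives a fundamental vector at [bact (s z) (b z)],
   to which [cform_fund] applies. *)
pose c' t := invmx (b z) *m c t.
have sc' : smooth_near c' 0 by exact: smooth_near_mulmx (smooth_near_cst _ _) sc.
have Hc' : curve_at_id H c'.
  split=> //; first by rewrite /c' c0 mulVmx.
  by apply: filterS nHc => t; apply: isotropyM; exact: isotropyV.
have <- : 'D_1 c' 0 = invmx (b z) *m fun_deriv b w.
  by rewrite (deriveE1 sc') (der_mulmxl _ _ sc) dc.
rewrite -(cform_fund (bact (s z) (b z)) Hc'); congr (cform _ _).
have [_ sC] := smooth_map2_curve fMX s2 sc c0 nHc.
have e : \forall t \near (0 : R^o), chart (bact (s z) (b z)) (bact (s z) (c t)) =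
    chart (bact (s z) (b z)) (bact (bact (s z) (b z)) (c' t)).
  apply: filterS nHc => t Ht; rewrite bactM // /c'.
    by rewrite mulKVmx.
  by apply: isotropyM => //; exact: isotropyV.
rewrite (deriveE1 sC) (deriveE1 (smooth_near_ext e sC)).
by rewrite (der_ext _ e sC).
Qed.

Lemma frame_coord_linear x u : bproj u = x -> linear (@frame_coord _ _ _ C x u).
Proof.
move=> ux a c e; apply: (can_inj (fbracketK ux)).
by rewrite fbracketD // fbracketZ // !(frame_coordK ux).
Qed.

Section Gauge.
Variables (s : N -> C) (x : N).
Hypotheses (ss : smooth_map_at s x) (ps : \forall y \near x, bproj (s y) = y).
Let l := triv_at C x.
Let b y := ltriv l (s y).

Let nb : \forall y \near x, ltdom l y /\ bproj (s y) = y.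
Proof. by apply: filterS2 ps (ltdom_near x). Qed.

Let sb : smooth_fun_at b x.
Proof.
apply: smooth_fun_map ss _; apply: ltriv_smooth.
by rewrite (nbhs_singleton ps); exact: ltdomxx.
Qed.

Let Hb : \forall y \near x, H (b y).
Proof. by apply: filterS nb => y [dy py]; apply: ltriv_in; rewrite py. Qed.

Let sE : \forall y \near x, bact (local_section C x y) (b y) = s y.
Proof.
by apply: filterS nb => y [dy py]; rewrite -{1}py local_section_act // py.
Qed.

Let fE (t : forall y, tractor_fiber C y) : \forall y \near x,
  frame_coord (local_section C x y) (t y) = b y *m frame_coord (s y) (t y).
Proof.
apply: filterS2 nb (filterI Hb sE) => y [dy py] [Hby <-].
rewrite frame_coord_act ?local_section_bproj // mulKVmx //.
exact: isotropy_unit.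
Qed.

(** The tractor bundle is defined through its own local sections; any smooth section [s] of the
    principal bundle may replace them, as the two differ by a smooth [H]-valued function [b]. *)
Lemma tractor_smoothP (t : forall y, tractor_fiber C y) :
  @smooth_section_at _ _ N _ (tractor_bundle C) t x <->
  smooth_fun_at (fun y => frame_coord (s y) (t y)) x.
Proof.
split=> [st|st].
  have ub : b x \in unitmx by apply: isotropy_unit; exact: nbhs_singleton Hb.
  have sib : smooth_fun_at (fun y => invmx (b y)) x.
    by apply: smooth_near_invmx sb; rewrite /comp chart_invxx.
  apply: smooth_fun_ext (smooth_near_mulmx sib st).
  apply: filterS2 Hb (fE t) => y Hy e.
  exact: etrans (congr1 (mulmx (invmx (b y))) e) (mulKmx (isotropy_unit Hy) _).
apply: smooth_fun_ext (smooth_near_mulmx sb st).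
by apply: filterS (fE t) => y e; exact: esym e.
Qed.

(** With sigma the local section at [x], s = sigma b and coordinates satisfy f_sigma = b f_s. By
    [cform_bact], b (df_s + omega(Ts) f_s) = b df_s + db f_s + omega(T sigma) b f_s, whose first two
    terms are df_sigma. *)
Lemma tractor_nablaE (t : forall y, tractor_fiber C y) (w : tangent x) :
  smooth_fun_at (fun y => frame_coord (s y) (t y)) x ->
  tractor_nabla w t = fbracket x (s x)
    (fun_deriv (fun y => frame_coord (s y) (t y)) w
     + cform (s x) (tangent_map s w) *m frame_coord (s x) (t x)).
Proof.
move=> st; have sx := nbhs_singleton sE; have Hbx := nbhs_singleton Hb.
have sl := local_section_smooth (ltdomxx x).
have e1 := tangent_map_ext w sE (smooth_map2_comp (@findim_mx _ _ _)
  (bact_smooth (local_section C x x) Hbx) sl sb Hb).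
rewrite (cform_congr (esym sx) e1) (cform_bact w sl sb Hb).
set om := cform _ (tangent_map (local_section C x) w).
have key (a c da : MX) (f df : V) (o : MX) : c *m a = 1%:M ->
    c *m (df + (a *m o *m c + a *m da) *m f) = c *m df + da *m f + o *m (c *m f).
  move=> ca; rewrite mulmxDr mulmxDl mulmxDr !mulmxA ca !mul1mx -addrA; congr (_ + _).
  by rewrite addrC.
have fb Z : fbracket x (s x) Z = fbracket x (local_section C x x) (b x *m Z).
  by rewrite -(fbracket_act Z (local_section_proj C x) Hbx) sx.
have ub : b x *m invmx (b x) = 1%:M by exact: mulmxV (isotropy_unit Hbx).
rewrite fb (key _ _ _ _ _ om ub).
have dE : fun_deriv (fun y => frame_coord (local_section C x y) (t y)) w =
    b x *m fun_deriv (fun y => frame_coord (s y) (t y)) w + fun_deriv b w *m frame_coord (s x)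
        (t x).
  apply: etrans (fun_deriv_ext w (filterS (fun y e => esym e) (fE t)) (smooth_near_mulmx sb st))
      _.
  exact: fun_deriv_mulmx w sb st.
rewrite -dE -(nbhs_singleton (fE t)).
by [].
Qed.

End Gauge.
End TractorGauge.

Section QuadrupleIso.
Context {R : realType} {E : normedModType R} {N : manifold E} {r : nat}.
Implicit Types (Q : quadruple N r).

(** The body of [quadruple_iso] for a given map, which the lift to principal bundles needs as
    data. *)
Definition iso_map Q Q' (f : forall x, Q x -> Q' x) : Prop :=
  [/\ forall x, linear (f x) /\ bijective (f x),
      forall x (s : forall y, Q y),
        smooth_section_at s x <-> smooth_section_at (fun y => f y (s y)) x,
      forall x (v w : Q x), qmetric (f x v) (f x w) = qmetric v w,
      forall x (w : tangent x) (s : forall y, Q y), smooth_section_at s x ->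
        f x (nabla w s) = nabla w (fun y => f y (s y)) &
      forall x, f x (qsection Q x) = qsection Q' x].

Lemma iso_map_inv Q Q' (f : forall x, Q x -> Q' x) : iso_map f ->
  exists2 g : forall x, Q' x -> Q x, iso_map g &
    (forall x, cancel (f x) (g x)) /\ (forall x, cancel (g x) (f x)).
Proof.
move=> [lf sf mf nf ef].
have ex x : exists g : Q' x -> Q x, cancel (f x) g /\ cancel g (f x).
  by have [_ [g fg gf]] := lf x; exists g.
pose g x := sval (cid (ex x)).
have fg x : cancel (f x) (g x) by case: (svalP (cid (ex x))).
have gf x : cancel (g x) (f x) by case: (svalP (cid (ex x))).
have fgs (s : forall y, Q' y) : (fun y => f y (g y (s y))) = s.
  by apply/functional_extensionality_dep => y; rewrite gf.
exists g => //; split.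
- move=> x; split; last by exists (f x).
  by move=> a v w; apply: (can_inj (fg x)); rewrite (lf x).1 !gf.
- by move=> x s; rewrite -{1}(fgs s); split=> /sf.
- by move=> x v w; rewrite -mf !gf.
- move=> x w s ss; apply: (can_inj (fg x)).
  by rewrite gf nf ?fgs //; apply/sf; rewrite fgs.
- by move=> x; apply: (can_inj (fg x)); rewrite gf ef.
Qed.

Lemma iso_map_comp Q Q' Q'' (f : forall x, Q x -> Q' x) (g : forall x, Q' x -> Q'' x) :
  iso_map f -> iso_map g -> iso_map (fun x v => g x (f x v)).
Proof.
move=> [lf sf mf nf ef] [lg sg mg ng eg]; split.
- move=> x; split; last exact: bij_comp (lg x).2 (lf x).2.
  by move=> a v w; rewrite (lf x).1 (lg x).1.
- by move=> x s; apply: iff_trans (sf x s) (sg x _).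
- by move=> x v w; rewrite mg mf.
- by move=> x w s ss; rewrite nf // ng //; apply/sf.
- by move=> x; rewrite ef eg.
Qed.

End QuadrupleIso.

(** * Lifting a tractor isomorphism to the principal bundles *)

Section TractorLift.
Context {R : realType} {m : nat} {N : manifold 'rV[R]_m.+1}.
Variables (C C' : cartan_geometry N).
Local Notation H := (isotropy R m).
Local Notation MX := 'M[R]_m.+2.
Local Notation V := 'cV[R]_m.+2.
Variable psi : forall x, tractor_fiber C x -> tractor_fiber C' x.
Hypothesis psiP : @iso_map _ _ _ _ (standard_tractor C) (standard_tractor C') psi.
Implicit Types (u : C) (x y : N).

(** Points over [x] differ by an element of [H], and a matrix is determined by its action on
    vectors. *)
Lemma frame_unique x (u u' : C') : bproj u = x -> bproj u' = x ->
  (forall v, fbracket x u v = fbracket x u' v) -> u = u'.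
Proof.
move=> ux u'x e; have [h Hh uE] := bact_transitive (etrans ux (esym u'x)).
have h1 : h = 1%:M.
  apply: mulmx_delta_eq => j; apply: (can_inj (fbracketK ux)).
  by rewrite -fbracket_act // -uE mul1mx.
by rewrite uE h1 bact1.
Qed.

Definition lift_mx u (u' : C') : MX :=
  \matrix_(i, j) frame_coord u' (psi (fbracket (bproj u) u (delta_mx j 0))) i 0.

Lemma lift_mxE u (u' : C') v : bproj u' = bproj u ->
  lift_mx u u' *m v = frame_coord u' (psi (fbracket (bproj u) u v)).
Proof.
move=> uu'; pose f v := frame_coord u' (psi (fbracket (bproj u) u v)).
have lf : linear f.
  move=> a v1 v2; rewrite /f fbracketD // fbracketZ //.
  by have [/(_ (bproj u))[-> _] _ _ _ _] := psiP; rewrite frame_coord_linear.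
exact: (linear_matrix lf).
Qed.

(** The map [psi] preserves the metric and the distinguished section, which by [isotropyP] is all
    that membership in [H] asks. *)
Lemma lift_mx_isotropy u (u' : C') : bproj u' = bproj u -> H (lift_mx u u').
Proof.
move=> uu'; have [_ _ mf _ ef] := psiP; apply/isotropyP; split.
  apply/lorentz_isometryP => v w; rewrite !lift_mxE //.
  rewrite -(tractor_metricE (C := C') _ _ uu') !(frame_coordK uu').
  by rewrite [LHS]mf; exact: tractor_metricE.
rewrite lift_mxE // -(tractor_sectionE (C := C) (erefl (bproj u))).
by rewrite [psi _]ef [qsection _ _](tractor_sectionE uu') (fbracketK uu').
Qed.

(** Any point over the same base point would do: the factor [lift_mx] corrects it to the one frame
    that satisfies [fbracket_lift]. *)
Definition bundle_lift u : C' :=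
  bact (local_section C' (bproj u) (bproj u)) (lift_mx u (local_section C' (bproj u) (bproj u))).

Lemma bproj_lift u : bproj (bundle_lift u) = bproj u.
Proof.
have p := local_section_proj C' (bproj u).
by rewrite /bundle_lift bproj_act //; exact: lift_mx_isotropy.
Qed.

Lemma fbracket_lift x u v : bproj u = x ->
  fbracket x (bundle_lift u) v = psi (fbracket x u v).
Proof.
move=> <-; have p := local_section_proj C' (bproj u).
rewrite /bundle_lift fbracket_act //; last exact: lift_mx_isotropy.
by rewrite lift_mxE // (frame_coordK p).
Qed.

(** Equivariance, the local formula and the fact that two lifts are mutually inverse all follow from
    this characterization. *)
Lemma bundle_lift_unique x u (u' : C') : bproj u = x -> bproj u' = x ->
  (forall v, fbracket x u' v = psi (fbracket x u v)) -> bundle_lift u = u'.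
Proof.
move=> ux u'x e; apply: (frame_unique (x := x)) => //; first by rewrite bproj_lift.
by move=> v; rewrite fbracket_lift // e.
Qed.

Lemma bundle_lift_act u h : H h -> bundle_lift (bact u h) = bact (bundle_lift u) h.
Proof.
move=> Hh; apply: (@bundle_lift_unique (bproj u)).
- by rewrite bproj_act.
- by rewrite bproj_act // bproj_lift.
- move=> v; rewrite fbracket_act ?bproj_lift // fbracket_lift //.
  by rewrite -(fbracket_act (C := C) _ (erefl _) Hh).
Qed.

Section LocalForm.
Variable x : N.
Let s := local_section C x.
Let s' := local_section C' x.
Let b y := lift_mx (s y) (s' y).

Let nx : \forall y \near x, bproj (s y) = y /\ bproj (s' y) = y.
Proof.
apply: filterS2 (ltdom_near C x) (ltdom_near C' x) => y dy dy'.
by split; exact: local_section_bproj.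
Qed.

Let smooth_const_section (a : V) :
  @smooth_section_at _ _ N _ (tractor_bundle C) (fun y => fbracket y (s y) a) x.
Proof.
apply: smooth_fun_ext (smooth_fun_cst a x).
by apply: filterS nx => y [py _]; exact: esym (fbracketK py a).
Qed.

Let smooth_b : smooth_fun_at b x.
Proof.
have [_ sf _ _ _] := psiP.
apply: smooth_near_mx => i j.
have sC : smooth_fun_at (fun y => frame_coord (s' y) (psi (fbracket y (s y) (delta_mx j 0))) i 0
    : R^o) x.
  exact: smooth_near_coord i 0 ((sf x (fun y => fbracket y (s y) (delta_mx j 0))).1
      (smooth_const_section _)).
have e : \forall y \near x, frame_coord (s' y) (psi (fbracket y (s y) (delta_mx j 0))) i 0 = b y
    i j.
  by apply: filterS nx => y [py _]; rewrite /b mxE py.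
exact: (smooth_fun_ext e sC).
Qed.

Let Hb : \forall y \near x, H (b y).
Proof. by apply: filterS nx => y [py py']; apply: lift_mx_isotropy; rewrite py py'. Qed.

Let lift_s : \forall y \near x, bact (s' y) (b y) = bundle_lift (s y).
Proof.
apply: filterS2 nx Hb => y [py py'] Hby; apply: esym.
apply: (@bundle_lift_unique y) => //; first by rewrite bproj_act.
by move=> v; rewrite fbracket_act // /b lift_mxE ?py ?py' // frame_coordK.
Qed.

Let ss' : smooth_map_at s' x.
Proof. exact: local_section_smooth (ltdomxx C' x). Qed.

Let smooth_lift_s : smooth_map_at (fun y => bundle_lift (s y)) x.
Proof.
apply: smooth_map_ext lift_s _.
apply: (@smooth_map2_comp _ _ _ _ C' C' N _ H (@bact _ _ _ _ _ C') _ s' b) => //.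
- exact: findim_mx.
- by apply: bact_smooth; exact: nbhs_singleton Hb.
Qed.

(** For a constant vector a, nabla [s, a] = [s, omega(Ts) a], and the isomorphism carries [s, a] to
    [F s, a] with F the lift. Compatibility with the connections thus equates the two matrices
    column by column. *)
Lemma tangent_lift_section (w : tangent x) :
  cform (bundle_lift (s x)) (tangent_map (fun y => bundle_lift (s y)) w) =
  cform (s x) (tangent_map s w).
Proof.
have [_ sf _ nf _] := psiP; have [px _] := nbhs_singleton nx.
have ss : smooth_map_at s x by exact: local_section_smooth (ltdomxx C x).
have ns : \forall y \near x, bproj (s y) = y by apply: filterS nx => y [].
have ns' : \forall y \near x, bproj (bundle_lift (s y)) = y.
  by apply: filterS ns => y py; rewrite bproj_lift.
have px' := nbhs_singleton ns'.
apply: mulmx_delta_eq => j; move: (delta_mx j 0) => a.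
have st := smooth_const_section a; have st' := (sf x _).1 st.
have c1 : \forall y \near x, a = frame_coord (s y) (fbracket y (s y) a).
  by apply: filterS ns => y py; rewrite fbracketK.
have c2 : \forall y \near x, a = frame_coord (bundle_lift (s y)) (psi (fbracket y (s y) a)).
  apply: filterS2 ns ns' => y py py'.
  by rewrite -fbracket_lift // fbracketK.
have s1 := smooth_fun_ext c1 (smooth_fun_cst a x).
have s2 := smooth_fun_ext c2 (smooth_fun_cst a x).
have E1 := tractor_nablaE ss ns w s1.
have E2 := tractor_nablaE smooth_lift_s ns' w s2.
have d1 := etrans (fun_deriv_ext w c1 (smooth_fun_cst a x)) (fun_deriv_cst a w).
have d2 := etrans (fun_deriv_ext w c2 (smooth_fun_cst a x)) (fun_deriv_cst a w).
rewrite d1 add0r -(nbhs_singleton c1) in E1.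
rewrite d2 add0r -(nbhs_singleton c2) in E2.
apply: (can_inj (fbracketK px')); rewrite -E2.
apply: etrans (esym (nf x w _ st)) _.
by rewrite fbracket_lift // -E1.
Qed.

Lemma bundle_lift_local u : ltdom (triv_at C x) (bproj u) -> 
  bact (bundle_lift (s (bproj u))) (ltriv (triv_at C x) u) = bundle_lift u.
Proof.
move=> du; rewrite -bundle_lift_act; last exact: ltriv_in.
by rewrite local_section_act.
Qed.

(** Near [u] a point is s(p u') tr(u') and its lift is F(s(p u')) tr(u') with the same [tr].
    Expanded by [cform_bact], the two forms differ only in their values along the sections, which
    [tangent_lift_section] identifies. *)
Lemma bundle_lift_smooth_form u : bproj u = x ->
  smooth_map_at bundle_lift u /\
  forall v : tangent u, cform (bundle_lift u) (tangent_map bundle_lift v) = cform u v.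
Proof.
move=> ux; have sp := bproj_smooth u; pose tr := ltriv (triv_at C x).
have nd : \forall u' \near u, ltdom (triv_at C x) (bproj u').
  by apply: near_continuous (proj1 sp) _; rewrite ux; exact: ltdom_near.
have nH : \forall u' \near u, H (tr u') by apply: filterS nd => u'; exact: ltriv_in.
have st : smooth_fun_at tr u by apply: ltriv_smooth; rewrite ux; exact: ltdomxx.
have e1 : \forall u' \near u, bact (bundle_lift (s (bproj u'))) (tr u') = bundle_lift u'.
  by apply: filterS nd => u'; exact: bundle_lift_local.
have e2 : \forall u' \near u, bact (s (bproj u')) (tr u') = u'.
  by apply: filterS nd => u'; exact: local_section_act.
have sl : smooth_map_at (fun y => bundle_lift (s y)) (bproj u) by rewrite ux.
have ss : smooth_map_at s (bproj u) by rewrite ux; exact: local_section_smooth (ltdomxx C x).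
have slp := smooth_map_comp sp sl; have ssp := smooth_map_comp sp ss.
have Htr := nbhs_singleton nH.
have sm : smooth_map_at (fun u' => bact (bundle_lift (s (bproj u'))) (tr u')) u.
  apply: (@smooth_map2_comp _ _ _ _ C' C' C _ H (@bact _ _ _ _ _ C')
    _ (fun u' => bundle_lift (s (bproj u'))) tr) => //.
    exact: findim_mx.
  exact: bact_smooth.
have sm2 : smooth_map_at (fun u' => bact (s (bproj u')) (tr u')) u.
  apply: (@smooth_map2_comp _ _ _ _ C C C _ H (@bact _ _ _ _ _ C)
    _ (fun u' => s (bproj u')) tr) => //.
    exact: findim_mx.
  exact: bact_smooth.
split; first exact: smooth_map_ext e1 sm.
move=> v.
have t1 := tangent_map_ext v e1 sm.
have t2 := tangent_map_ext v e2 sm2.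
rewrite (cform_congr (esym (nbhs_singleton e1)) t1) (cform_bact v slp st nH).
have t2' : v = tangent_map (fun u' => bact (s (bproj u')) (tr u')) v :> 'rV[R]__.
  by rewrite -t2 tangent_map_id.
rewrite [RHS](cform_congr (esym (nbhs_singleton e2)) t2') (cform_bact v ssp st nH).
congr (_ *m _ *m _ + _).
rewrite (tangent_map_comp v sp sl) (tangent_map_comp v sp ss).
move: (tangent_map _ v) => w; rewrite ux in w *.
exact: tangent_lift_section.
Qed.

End LocalForm.

End TractorLift.

Lemma tractor_iso_cartan_iso (R : realType) (m : nat) (N : manifold 'rV[R]_m.+1)
    (C C' : cartan_geometry N) :
  quadruple_iso (standard_tractor C) (standard_tractor C') -> cartan_iso C C'.
Proof.
move=> [f fP]; have [g gP [fg gf]] := iso_map_inv fP.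
exists (bundle_lift f), (bundle_lift g); split.
- split=> u.
    apply: (bundle_lift_unique gP (x := bproj u)) => //; first exact: bproj_lift fP u.
    by move=> v; rewrite (fbracket_lift fP) // fg.
  apply: (bundle_lift_unique fP (x := bproj u)) => //; first exact: bproj_lift gP u.
  by move=> v; rewrite (fbracket_lift gP) // gf.
- by split=> u; [case: (bundle_lift_smooth_form fP (erefl (bproj u)))|case:
    (bundle_lift_smooth_form gP (erefl (bproj u)))].
- by move=> u; exact: bproj_lift fP u.
- by move=> u h; exact: bundle_lift_act fP u h.
- by move=> u v; case: (bundle_lift_smooth_form fP (erefl (bproj u))).
Qed.

(** * Adapted frames of an extension bundle *)

Section PseudoOrthonormalization.
Variable R : realType.

Lemma smooth_near_block_mx (E : normedModType R) p q r s (a : E -> 'M[R]_(p, r))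
  (b : E -> 'M[R]_(p, s)) (c : E -> 'M[R]_(q, r)) (d : E -> 'M[R]_(q, s)) x :
  smooth_near a x -> smooth_near b x -> smooth_near c x -> smooth_near d x ->
  smooth_near (fun y => block_mx (a y) (b y) (c y) (d y)) x.
Proof.
move=> sa sb sc sd.
have s1 := smooth_near_trmx (smooth_near_row_mx sa sb).
have s2 := smooth_near_trmx (smooth_near_row_mx sc sd).
apply: smooth_near_eq (smooth_near_trmx (smooth_near_row_mx s1 s2)) => y.
by rewrite tr_row_mx !trmxK.
Qed.

(* One step of the Gram-Schmidt process: normalize the first basis vector and
   recurse on the Schur complement of its square. *)
Lemma pseudo_orthonormalization n (d : 'rV[R]_n) : (forall i, d 0 i * d 0 i = 1) ->
  exists2 Phi : 'M[R]_n -> 'M[R]_n, smooth_near Phi (diag_mx d) &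
    \forall S \near diag_mx d, S^T = S -> (Phi S)^T *m S *m Phi S = diag_mx d.
Proof.
elim: n d => [|n IH] d dd.
  exists id; first exact: smooth_near_id.
  by apply: near_all => S _; apply/matrixP => -[].
pose d1 : 'rV[R]_1 := @lsubmx R 1 1 n d; pose d2 : 'rV[R]_n := @rsubmx R 1 1 n d.
have dE : d = row_mx d1 d2 by rewrite hsubmxK.
have d1d1 : d1 0 0 * d1 0 0 = 1 by rewrite mxE.
have d2d2 i : d2 0 i * d2 0 i = 1 by rewrite mxE.
have [Psi sPsi nPsi] := IH d2 d2d2.
pose s (S : 'M[R]_(1 + n)) : R^o := (ulsubmx S : 'M[R]_1) 0 0.
pose r (S : 'M[R]_(1 + n)) : 'rV[R]_n := ursubmx S.
pose T (S : 'M[R]_(1 + n)) : 'M[R]_n := drsubmx S - (s S)^-1 *: ((r S)^T *m r S).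
(* The sign of the first square: near [diag_mx d] the product [e * s S] stays positive, so its
   inverse square root is smooth. *)
pose e := d1 0 0.
pose al (S : 'M[R]_(1 + n)) : R^o := (Num.sqrt (e * s S))^-1.
pose Phi (S : 'M[R]_(1 + n)) : 'M[R]_(1 + n) :=
  block_mx (al S)%:M (- ((s S)^-1 *: (r S *m Psi (T S)))) 0 (Psi (T S)).
have DE : diag_mx d = block_mx (diag_mx d1) 0 0 (diag_mx d2) :> 'M[R]_(1 + n).
  by rewrite -(diag_mx_row d1 d2) -dE.
have sD : s (diag_mx d) = e.
  by rewrite /s DE block_mxKul mxE eqxx.
have rD : r (diag_mx d) = 0 by rewrite /r DE block_mxKur.
have TD : T (diag_mx d) = diag_mx d2.
  by rewrite /T rD mulmx0 scaler0 subr0 DE block_mxKdr.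
have e0 : e != 0 by apply/eqP => e0; move: d1d1; rewrite -/e e0 mul0r => /esym/eqP; rewrite
    oner_eq0.
have fM : findim 'M[R]_(1 + n) by exact: findim_mx.
have sul (S : 'M[R]_(1 + n)) : smooth_near (fun S => ulsubmx S : 'M[R]_1) S.
  apply: (@smooth_near_linf _ _ _ _ (@lsubmx R 1 1 n) (fun S : 'M[R]_(1 + n) => usubmx S)).
    exact: findim_mx.
  exact: (@smooth_near_lin R _ _ (@usubmx R 1 n (1 + n)) S fM).
have ss S : smooth_near s S by exact: smooth_near_coord 0 0 (sul S).
have sr S : smooth_near r S.
  apply: (@smooth_near_linf _ _ _ _ (@rsubmx R 1 1 n) (fun S : 'M[R]_(1 + n) => usubmx S)).
    exact: findim_mx.
  exact: (@smooth_near_lin R _ _ (@usubmx R 1 n (1 + n)) S fM).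
have ssi : smooth_near (fun S => (s S)^-1 : R^o) (diag_mx d).
  by apply: smooth_near_inv => //; rewrite sD.
have sT : smooth_near T (diag_mx d).
  apply: smooth_nearD.
    apply: (@smooth_near_linf _ _ _ _ (@rsubmx R n 1 n) (fun S : 'M[R]_(1 + n) => dsubmx S)).
      exact: findim_mx.
    exact: (@smooth_near_lin R _ _ (@dsubmx R 1 n (1 + n)) _ fM).
  apply: smooth_nearN; apply: smooth_nearZ => //.
  by apply: smooth_near_mulmx => //; exact: smooth_near_trmx.
have sal : smooth_near al (diag_mx d).
  apply: (@smooth_near_rsqrt _ _ (fun S => e * s S : R^o)).
    by rewrite sD d1d1.
  by apply: smooth_nearM => //; exact: smooth_near_cst.
have sPT : smooth_near (fun S => Psi (T S)) (diag_mx d).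
  by apply: (smooth_near_comp (@findim_mx _ _ _) sT); rewrite TD.
exists Phi.
  apply: smooth_near_block_mx => //.
  - apply: smooth_near_eq (smooth_nearZ sal (smooth_near_cst (1%:M : 'M[R]_1) _)) => S.
    by rewrite scalemx1.
  - apply: smooth_nearN; apply: smooth_nearZ => //.
    exact: smooth_near_mulmx.
  - exact: smooth_near_cst.
have n1 : \forall S \near diag_mx d, 0 < e * s S.
  have c : {for diag_mx d, continuous (fun S : 'M[R]_(1 + n) => e * s S : R^o)}.
    apply: smooth_near_continuous; apply: smooth_nearM => //.
    exact: smooth_near_cst.
  have o : open [set t : R^o | 0 < t] by exact: open_gt.
  have p : 0 < e * s (diag_mx d) by rewrite sD d1d1.
  exact: (@near_continuous _ _ _ _ [set t : R^o | 0 < t] c (open_nbhs_nbhs (conj o p))).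
rewrite -TD in nPsi.
have n2 := near_continuous (smooth_near_continuous sT) nPsi.
apply: filterS2 n1 n2 => S es0 PT SS.
have s0 : s S != 0 by apply/eqP => s0; move: es0; rewrite s0 mulr0 ltxx.
have ulE : ulsubmx S = (s S)%:M.
  by rewrite [LHS]mx11_scalar.
have SE : S = block_mx (s S)%:M (r S) (r S)^T (drsubmx S).
  rewrite -[LHS]submxK ulE; congr block_mx.
  by rewrite /r -{1}SS -trmx_ursub.
have TT : (T S)^T = T S.
  rewrite /T linearB linearZ /= trmx_mul trmxK.
  by rewrite trmx_drsub SS.
have {}PT := PT TT; move: PT.
rewrite TD DE /Phi; move: (Psi (T S)) => P PT.
have TE : drsubmx S = T S + (s S)^-1 *: ((r S)^T *m r S) by rewrite subrK.
set u := - ((s S)^-1 *: (r S *m P)).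
have su : (s S)%:M *m u + r S *m P = 0.
  by rewrite mulmxN mul_scalar_mx scalerA divff // scale1r addNr.
have e1 : S *m block_mx (al S)%:M u 0 P =
    block_mx (s S * al S)%:M 0 (al S *: (r S)^T) (T S *m P).
  rewrite {1}SE mulmx_block !mulmx0 !addr0 su -scalar_mxM mul_mx_scalar; congr block_mx.
  rewrite TE mulmxDl addrCA [X in _ + X](_ : _ = 0) ?addr0 //.
  by rewrite -scalemxAl -mulmxA mulmxN -scalemxAr addNr.
have e2 : (block_mx (al S)%:M u 0 P)^T = block_mx (al S)%:M 0 u^T P^T :> 'M[R]_(1 + n).
  by rewrite tr_block_mx trmx0 tr_scalar_mx.
apply: etrans (esym (mulmxA _ _ _)) _; apply: etrans (congr2 mulmx e2 e1) _.
apply: etrans (mulmx_block _ _ _ _ _ _ _ _) _.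
rewrite !mulmx0 !mul0mx !addr0 add0r mulmxA PT -scalar_mxM; congr block_mx.
  rewrite [RHS]mx11_scalar mxE eqxx mulr1n -/e; congr (_%:M).
  have q0 : Num.sqrt (e * s S) != 0 by rewrite gt_eqF // sqrtr_gt0.
  have sE : s S = e * (Num.sqrt (e * s S) ^+ 2).
    by rewrite sqr_sqrtr ?ltW // mulrA d1d1 mul1r.
  rewrite {1}sE /al; move: (Num.sqrt (e * s S)) q0 => q q0.
  by field.
have := congr1 trmx su; rewrite linearD /= !trmx_mul tr_scalar_mx trmx0 => suT.
by rewrite -scalemxAr scalar_mxM mulmxA mul_mx_scalar -scalerDr suT scaler0.
Qed.

End PseudoOrthonormalization.

(** * Null vectors and reflections *)

Section LightlikeFrames.
Context {R : realType} {m : nat}.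
Local Notation J := (gram R m).
Local Notation MX := 'M[R]_m.+2.
Local Notation V := 'cV[R]_m.+2.
Implicit Types (a b v w : V).

Definition signature : 'rV[R]_m.+2 := \row_i (if i.+1 == m.+2 then -1 else 1).

Lemma signature_gram : exists K : MX, K^T *m diag_mx signature *m K = J.
Proof.
pose D : MX := diag_mx signature.
pose q (v w : V) : R := (v^T *m D *m w) 0 0.
have qD v v' w : q (v + v') w = q v w + q v' w by rewrite /q linearD /= !mulmxDl mxE.
have qZ (c : R) v w : q (c *: v) w = c * q v w by rewrite /q linearZ /= -!scalemxAl mxE.
have qD' v w w' : q v (w + w') = q v w + q v w' by rewrite /q mulmxDr mxE.
have qZ' (c : R) v w : q v (c *: w) = c * q v w by rewrite /q -scalemxAr mxE.
pose d (i : 'I_m.+2) : V := delta_mx i 0.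
have qd i j : q (d i) (d j) = signature 0 i *+ (i == j) by rewrite /q lorentz_delta mxE.
have s0 : signature 0 ord0 = 1 by rewrite mxE.
have sm : signature 0 ord_max = -1 by rewrite mxE eqxx.
have si (i : 'I_m.+2) : i != ord_max -> signature 0 i = 1.
  by move=> im; rewrite mxE eqSS; case: eqP => // e; case/eqP: im; exact: val_inj.
(* With d_0 of square 1 and d_max of square -1, the vectors d_0 + d_max and (d_0 - d_max) / 2 are
   null with product 1, as [ell] and [enn] are. *)
pose k (j : 'I_m.+2) : V := if j == ord0 then d ord0 + d ord_max
  else if j == ord_max then 2^-1 *: (d ord0 + (-1) *: d ord_max) else d j.
pose K : MX := \matrix_(i, j) k j i 0.
have KE i : K *m d i = k i.
  by apply/colP => j; rewrite -colE !mxE.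
exists K; apply/matrixP => i j.
have -> : (K^T *m D *m K) i j = q (k i) (k j).
  by rewrite -[LHS]lorentz_delta -!KE /q trmx_mul !mulmxA.
rewrite /J /gram /tperm_mx !mxE /k.
have m0 : (ord_max == ord0 :> 'I_m.+2) = false by [].
have m0' : (ord0 == ord_max :> 'I_m.+2) = false by [].
have nz p (i' : 'I_m.+2) : i' != p -> ((i' == p) = false) * ((p == i') = false).
  by move=> ip; rewrite [p == _]eq_sym (negPf ip).
have simp := (qD, qZ, qD', qZ', qd, s0, sm).
case: (eqVneq i ord0) => [->|i0]; case: (eqVneq j ord0) => [->|j0].
- rewrite tpermL !simp !eqxx m0 m0' /=; lra.
- case: (eqVneq j ord_max) => [->|jm].
    by rewrite tpermL !simp !eqxx m0 m0' /=; lra.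
  by rewrite tpermL !simp !(nz _ _ j0) !(nz _ _ jm) /=; lra.
- case: (eqVneq i ord_max) => [->|im].
    by rewrite tpermR !simp !eqxx m0 m0' /=; lra.
  by rewrite tpermD 1?eq_sym // !simp !(nz _ _ i0) !(nz _ _ im) /=; lra.
case: (eqVneq i ord_max) => [->|im]; case: (eqVneq j ord_max) => [->|jm].
- by rewrite tpermR !simp !eqxx m0 m0' /=; lra.
- by rewrite tpermR !simp !(nz _ _ j0) !(nz _ _ jm) /=; lra.
- by rewrite tpermD 1?eq_sym // !simp !(nz _ _ i0) !(nz _ _ im) /=; lra.
- by rewrite qd si // tpermD // eq_sym.
Qed.

(* For null vectors with [lorentz a b != 0] this is the reflection exchanging
   [a] and [b]. *)
Definition null_reflection a b : MX :=
  1%:M + (lorentz a b)^-1 *: ((a - b) *m ((a - b)^T *m J)).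

Lemma null_reflectionE a b v :
  null_reflection a b *m v = v + (lorentz (a - b) v / lorentz a b) *: (a - b).
Proof.
rewrite mulmxDl mul1mx -scalemxAl -mulmxA [X in _ *m X]mx11_scalar mul_mx_scalar.
by rewrite scalerA mulrC.
Qed.

Lemma lorentzBl a b v : lorentz (a - b) v = lorentz a v - lorentz b v.
Proof. by rewrite lorentzDl -scaleN1r lorentzZl mulN1r. Qed.

Lemma lorentzBr a b v : lorentz v (a - b) = lorentz v a - lorentz v b.
Proof. by rewrite !(lorentzC v) lorentzBl. Qed.

Lemma null_reflection_swap a b : lorentz b b = 0 -> lorentz a b != 0 ->
  null_reflection a b *m b = a.
Proof.
move=> bb ab; rewrite null_reflectionE lorentzBl bb subr0 divff // scale1r.
by rewrite addrC subrK.
Qed.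

(** For null a and b the vector d = a - b has square -2 times their product, so the formula is the
    usual reflection v - 2 (d, v) / (d, d) d. *)
Lemma null_reflection_gram a b : lorentz a a = 0 -> lorentz b b = 0 -> lorentz a b != 0 ->
  (null_reflection a b)^T *m J *m null_reflection a b = J.
Proof.
move=> aa bb ab; apply/lorentz_isometryP => v w; rewrite !null_reflectionE.
have : lorentz (a - b) (a - b) = - 2 * lorentz a b.
  by rewrite lorentzBl !lorentzBr aa bb (lorentzC b a); ring.
move: (a - b) => d dd; rewrite !(lorentzDl, lorentzDr, lorentzZl, lorentzZr) dd (lorentzC v d).
by move: (lorentz d v) (lorentz d w) (lorentz a b) (lorentz v w) ab => p q c e c0; field.
Qed.

Lemma smooth_near_lorentz (E : normedModType R) (f g : E -> V) x :
  smooth_near f x -> smooth_near g x -> smooth_near (fun y => lorentz (f y) (g y) : R^o) x.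
Proof.
move=> sf sg; apply: smooth_near_coord; apply: smooth_near_mulmx => //.
apply: smooth_near_mulmx; last exact: smooth_near_cst.
exact: smooth_near_trmx.
Qed.

Lemma smooth_near_null_reflection (E : normedModType R) (f : E -> V) b x :
  smooth_near f x -> lorentz (f x) b != 0 -> smooth_near (fun y => null_reflection (f y) b) x.
Proof.
move=> sf fb; have sB : smooth_near (fun y => f y - b) x.
  by apply: smooth_nearD => //; exact: smooth_near_cst.
apply: smooth_nearD; first exact: smooth_near_cst.
apply: smooth_nearZ.
  apply: (@smooth_near_inv _ _ (fun y => lorentz (f y) b : R^o)) => //.
  by apply: smooth_near_lorentz => //; exact: smooth_near_cst.
apply: smooth_near_mulmx => //; apply: smooth_near_mulmx; last exact: smooth_near_cst.
exact: smooth_near_trmx.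
Qed.

(** If both extreme coordinates vanished, the square of [a] would be a sum of squares of all its
    coordinates. *)
Lemma null_product_neq0 a : a != 0 -> lorentz a a = 0 -> lorentz a ell = 0 -> lorentz a enn != 0.
Proof.
rewrite lorentz_ell lorentz_enn => an0 aa am; apply: contra an0 => /eqP a0.
have sq0 : \sum_i a i 0 ^+ 2 = 0.
  apply: etrans _ aa; rewrite lorentzE; apply: eq_bigr => i _; rewrite expr2.
  by case: tpermP => [->|->|] //; rewrite ?am ?a0 ?mulr0 ?mul0r.
apply/eqP/colP => i; rewrite mxE; apply/eqP; rewrite -sqrf_eq0.
have /eqP := sq0; rewrite psumr_eq0; last by move=> j _; exact: sqr_ge0.
by move=> /allP/(_ i); rewrite mem_index_enum => /(_ isT).
Qed.

(* [f x] is not orthogonal to both [ell] and [enn]; it is reached from [ell] by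
   one reflection, or by two of them through [enn]. *)
Lemma lightlike_rotation (E : normedModType R) (f : E -> V) x :
  smooth_near f x -> (\forall y \near x, lorentz (f y) (f y) = 0) -> f x != 0 ->
  exists2 A : E -> MX, smooth_near A x &
    \forall y \near x, (A y)^T *m J *m A y = J /\ A y *m ell = f y.
Proof.
move=> sf nf fn0; have fx0 := nbhs_singleton nf.
have ll : lorentz (ell : V) ell = 0 by rewrite lorentz_ell ell_max.
have nn : lorentz (enn : V) enn = 0 by rewrite lorentz_enn enn_0.
have near0 b : lorentz (f x) b != 0 -> \forall y \near x, lorentz (f y) b != 0.
  move=> fb; have c := smooth_near_continuous (smooth_near_lorentz sf (smooth_near_cst b x)).
  exact: (near_continuous c (open_nbhs_nbhs (conj (@open_neq R 0) fb))).
have [fl|fl] := eqVneq (lorentz (f x) ell) 0; last first.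
  exists (fun y => null_reflection (f y) ell); first exact: smooth_near_null_reflection.
  apply: filterS2 nf (near0 _ fl) => y fy fly; split.
    exact: null_reflection_gram.
  exact: null_reflection_swap.
have fn := null_product_neq0 fn0 fx0 fl.
have nl : lorentz (enn : V) ell != 0 by rewrite lorentz_ell enn_max oner_eq0.
exists (fun y => null_reflection (f y) enn *m null_reflection enn ell).
  by apply: smooth_near_mulmx; [exact: smooth_near_null_reflection|exact: smooth_near_cst].
apply: filterS2 nf (near0 _ fn) => y fy fny; split.
  have g1 := null_reflection_gram fy nn fny; have g2 := null_reflection_gram nn ll nl.
  move: (null_reflection (f y) enn) (null_reflection enn ell) g1 g2 => A B g1 g2.
  have -> : (A *m B)^T *m J *m (A *m B) = B^T *m (A^T *m J *m A) *m B.
    by rewrite trmx_mul !mulmxA.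
  by rewrite g1.
by rewrite -mulmxA !null_reflection_swap.
Qed.

End LightlikeFrames.

(** A local section of the frame bundle still to be built: a trivialization of [Q] by isometries
    that take the distinguished section to [ell]. The maps are total and meaningful over [adom]. *)
Record adapted_triv (R : realType) (m : nat) (N : manifold 'rV[R]_m.+1)
    (Q : quadruple N m.+2) (x : N) := AdaptedTriv {
  adom : set N;
  atriv : forall y : N, Q y -> 'cV[R]_m.+2;
  ainv : forall y : N, 'cV[R]_m.+2 -> Q y;
  adomP : open_nbhs x adom;
  atriv_linear : forall y, adom y -> linear (@atriv y);
  atrivK : forall y, adom y -> cancel (@atriv y) (@ainv y);
  ainvK : forall y, adom y -> cancel (@ainv y) (@atriv y);
  atriv_lorentz : forall y (v w : Q y), adom y ->
    lorentz (atriv v) (atriv w) = qmetric v w;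
  atriv_ell : forall y, adom y -> atriv (qsection Q y) = ell;
  atriv_smooth : forall y (s : forall z, Q z), adom y ->
    smooth_section_at s y <-> smooth_fun_at (fun z => atriv (s z)) y }.

(** * Existence of adapted trivializations *)

Section AdaptedExistence.
Context {R : realType} {m : nat} {N : manifold 'rV[R]_m.+1}.
Variable Q : quadruple N m.+2.
Hypothesis QP : is_extension Q.
Local Notation J := (gram R m).
Local Notation MX := 'M[R]_m.+2.
Local Notation V := 'cV[R]_m.+2.
Implicit Types (x y z : N).

Let VB := ext_vbundle QP.

Lemma vdom_near x y : vdom Q x y -> \forall z \near y, vdom Q x z.
Proof. by move=> xy; apply: open_nbhs_nbhs; split=> //; case: (vdomP VB x). Qed.

Lemma vdomxx x : vdom Q x x.
Proof. by case: (vdomP VB x). Qed.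

Lemma vtriv_inv_linear x y : vdom Q x y -> linear (@vtriv_inv _ _ _ _ Q x y).
Proof.
move=> xy a v w; apply: (can_inj (vtrivK VB xy)).
by rewrite (vtriv_linear VB xy) !(vtriv_invK VB xy).
Qed.

(** The bundle axioms give smooth transitions for constant vectors only; these are the columns of
    [T], and linearity does the rest. *)
Lemma smooth_section_change x x' y (s : forall z, Q z) : vdom Q x y -> vdom Q x' y ->
  smooth_fun_at (fun z => vtriv x (s z)) y -> smooth_fun_at (fun z => vtriv x' (s z)) y.
Proof.
move=> xy x'y ss.
pose T z : MX := \matrix_(i, j) (vtriv x' (vtriv_inv Q x z (delta_mx j 0))) i 0.
have sT : smooth_fun_at T y.
  apply: smooth_near_mx => i j.
  have sC := smooth_near_coord i 0 (vtriv_smooth VB (delta_mx j 0) xy x'y).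
  by apply: smooth_near_eq sC => e; rewrite /T /= mxE.
apply: smooth_fun_ext (smooth_near_mulmx sT ss).
apply: filterS2 (vdom_near xy) (vdom_near x'y) => z xz x'z.
have lf : linear (fun a => vtriv x' (vtriv_inv Q x z a)).
  by move=> a v w; rewrite (vtriv_inv_linear xz) (vtriv_linear VB x'z).
by apply: etrans (linear_matrix lf _) _; congr (vtriv x' _); exact: (vtrivK VB xz).
Qed.

Lemma smooth_sectionP x y (s : forall z, Q z) : vdom Q x y ->
  smooth_section_at s y <-> smooth_fun_at (fun z => vtriv x (s z)) y.
Proof. by move=> xy; split; apply: smooth_section_change => //; exact: vdomxx. Qed.

Lemma vtriv_inv_smooth x y (a : V) : vdom Q x y -> smooth_section_at (fun z => vtriv_inv Q x z a)
    y.
Proof.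
move=> xy; apply/(smooth_sectionP _ xy).
apply: smooth_fun_ext (smooth_fun_cst a y).
by apply: filterS (vdom_near xy) => z xz; rewrite (vtriv_invK VB xz).
Qed.

Lemma qmetric_bilinear x (v : Q x) (w w' : Q x) (a : R) :
  qmetric v (a *: w + w') = a * qmetric v w + qmetric v w'.
Proof. exact: (qmetric_linear (ext_metric QP)). Qed.

Lemma qmetric_coords x (L : V -> Q x) v w : linear L ->
  qmetric (L v) (L w) =
  (v^T *m (\matrix_(i, j) qmetric (L (delta_mx i 0)) (L (delta_mx j 0))) *m w) 0 0.
Proof.
move=> lL; set G := (\matrix_(i, j) _).
have sym := qmetric_sym (ext_metric QP).
pose LL : {linear V -> Q x} := HB.pack L (GRing.isLinear.Build _ _ _ _ _ lL).
have lq u : linear_for *%R (@qmetric _ _ _ _ Q x u) by move=> a ? ?; exact: qmetric_bilinear.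
pose qL u : {linear Q x -> R | *%R} := HB.pack (@qmetric _ _ _ _ Q x u)
    (GRing.isLinear.Build _ _ _ _ _ (lq u)).
have E u w' : qmetric u (L w') = \sum_j w' j 0 * qmetric u (L (delta_mx j 0)).
  rewrite -[LHS]/(qL u (LL w')) {1}(matrix_sum_delta w') !linear_sum.
  apply: eq_bigr => j _; rewrite big_ord1 !linearZ.
  by [].
rewrite E mxE; apply: eq_bigr => j _; rewrite mulrC; congr (_ * _).
by rewrite sym E mxE; apply: eq_bigr => i _; rewrite !mxE sym.
Qed.

Section AtPoint.
Variable x : N.
Let vi y := @vtriv_inv _ _ _ _ Q x y.
Let G y : MX := \matrix_(i, j) qmetric (vi y (delta_mx i 0)) (vi y (delta_mx j 0)).

Let smooth_G : smooth_fun_at G x.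
Proof.
apply: smooth_near_mx => i j.
have s (i : 'I_m.+2) := vtriv_inv_smooth (delta_mx i 0) (vdomxx x).
have sq := qmetric_smooth (ext_metric QP) (s i) (s j).
by apply: smooth_near_eq sq => e; rewrite /= mxE.
Qed.

Let GE y (v w : V) : vdom Q x y -> qmetric (vi y v) (vi y w) = (v^T *m G y *m w) 0 0.
Proof. by move=> xy; apply: qmetric_coords; exact: vtriv_inv_linear. Qed.

Let G_tr y : (G y)^T = G y.
Proof. by apply/matrixP => i j; rewrite !mxE (qmetric_sym (ext_metric QP)). Qed.

(** The frame is a product of four factors: [B0] is orthonormal at [x] alone, [Phi (S y)] makes it
    orthonormal nearby, [K] passes from the diagonal signature to the Gram matrix, and [A'] moves
    [ell] to the coordinates [f] of the distinguished section. *)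
Lemma adapted_frame_exists : exists2 B : N -> MX, smooth_fun_at B x &
  \forall y \near x, (B y)^T *m G y *m B y = J /\ B y *m ell = vtriv x (qsection Q y).
Proof.
have [e eE] := qmetric_signature (ext_metric QP) x.
pose B0 : MX := \matrix_(i, j) vtriv x (e j) i 0.
have B0E j : B0 *m delta_mx j 0 = vtriv x (e j) by apply/colP => i; rewrite -colE !mxE.
have S0 : B0^T *m G x *m B0 = diag_mx (@signature R m).
  apply/matrixP => i j; rewrite -[LHS]lorentz_delta.
  have -> : (delta_mx i 0 : V)^T *m (B0^T *m G x *m B0) *m (delta_mx j 0 : V)
    = (B0 *m delta_mx i 0)^T *m G x *m (B0 *m delta_mx j 0).
    by rewrite [in RHS]trmx_mul !mulmxA.
  rewrite !B0E -(GE _ _ (vdomxx x)) /vi !(vtrivK VB (vdomxx x)) eE.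
  by rewrite !mxE.
have sg i : (@signature R m) 0 i * (@signature R m) 0 i = 1.
  by rewrite mxE; case: ifP; rewrite ?mulr1 // mulrN1 opprK.
have [Phi sPhi nPhi] := pseudo_orthonormalization sg.
pose S y := B0^T *m G y *m B0.
have sS : smooth_fun_at S x.
  apply: smooth_near_mulmx; last exact: smooth_near_cst.
  by apply: smooth_near_mulmx => //; exact: smooth_near_cst.
have S_tr y : (S y)^T = S y by rewrite /S !trmx_mul trmxK G_tr mulmxA.
have [K KE] := @signature_gram R m.
rewrite -S0 -/(S x) in sPhi nPhi.
pose B1 y := B0 *m Phi (S y) *m K.
have sPS : smooth_fun_at (fun y => Phi (S y)) x.
  by apply: smooth_fun_comp => //; exact: findim_mx.
have sB1 : smooth_fun_at B1 x.
  apply: smooth_near_mulmx; last exact: smooth_near_cst.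
  by apply: smooth_near_mulmx => //; exact: smooth_near_cst.
have nB1 : \forall y \near x, (B1 y)^T *m G y *m B1 y = J.
  have := near_continuous (smooth_fun_continuous sS) nPhi.
  apply: filterS => y /(_ (S_tr y)) PE; rewrite -KE -S0 -/(S x) -PE /S /B1.
  by rewrite !trmx_mul !mulmxA.
have uJ A B : (A^T *m B *m A = J :> MX) -> A \in unitmx.
  move=> AE; have /mulmx1_unit[_ //] : (J *m A^T *m B) *m A = 1%:M.
  by rewrite -!mulmxA (mulmxA A^T) AE gram_sqr.
have uB1 := nbhs_singleton nB1; have {}uB1 := uJ _ _ uB1.
pose f y : V := invmx (B1 y) *m vtriv x (qsection Q y).
have seta : smooth_fun_at (fun y => vtriv x (qsection Q y)) x by exact: ext_section.
have sf : smooth_fun_at f x.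
  by apply: smooth_near_mulmx => //; apply: smooth_near_invmx => //; rewrite /comp chart_invxx.
have nf : \forall y \near x, lorentz (f y) (f y) = 0.
  apply: filterS2 nB1 (vdom_near (vdomxx x)) => y BE xy.
  have uB := uJ _ _ BE; rewrite /lorentz -/J -BE.
  rewrite gram_pullback.
  rewrite /f mulKVmx // -GE // /vi (vtrivK VB xy).
  by case: (ext_lightlike QP y).
have f0 : f x != 0.
  apply/eqP => f0; case: (ext_lightlike QP x) => /eqP eta0 _; apply: eta0.
  have : vtriv x (qsection Q x) = 0 by rewrite -[LHS](mulKVmx uB1) -/(f x) f0 mulmx0.
  move=> e0; rewrite -[LHS](vtrivK VB (vdomxx x)) e0.
  exact: linear_fun0 (vtriv_inv_linear (vdomxx x)).
have f0' : (f \o chart_inv x) (chart x x) != 0 by rewrite /comp chart_invxx.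
have [A sA nA] := lightlike_rotation sf (chart_inv_cvg (chart_dom_refl x) nf) f0'.
(* [lightlike_rotation] works on a normed space, so it is applied to [f] read in the chart and its
   result is brought back to [N]. *)
pose A' y := A (chart x y).
have sA' : smooth_fun_at A' x.
  apply: smooth_near_ext sA.
  by apply: filterS (near_chart_invK (chart_dom_refl x)) => e' [_ eK]; rewrite /A' /= eK.
have nA' := chart_cvg (chart_dom_refl x) nA.
exists (fun y => B1 y *m A' y); first exact: smooth_near_mulmx.
have ncd := chart_nbhs (chart_dom_refl x).
apply: filterS3 ncd nA' nB1 => y xy [AE Al] BE; split.
  by rewrite -gram_pullback BE.
rewrite -mulmxA /A' Al /comp chartK // /f mulKVmx //.
exact: uJ BE.
Qed.

Lemma adapted_triv_exists : inhabited (adapted_triv Q x).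
Proof.
have [B sB nB] := adapted_frame_exists.
have nall : \forall y \near x, [/\ vdom Q x y, smooth_fun_at B y &
    (B y)^T *m G y *m B y = J /\ B y *m ell = vtriv x (qsection Q y)].
  by apply: filterS3 (vdom_near (vdomxx x)) (smooth_fun_near sB) nB => y; split.
move: nall; rewrite -nbhs_nearE nbhsE => -[U oU UP].
have dU y : U y -> vdom Q x y by case/UP.
have uB y : U y -> B y \in unitmx.
  move=> /UP[_ _ [BE _]]; have /mulmx1_unit[_ //] : (J *m (B y)^T *m G y) *m B y = 1%:M.
  by rewrite -!mulmxA (mulmxA (B y)^T) BE gram_sqr.
have K1 y : U y -> cancel (fun v : Q y => invmx (B y) *m vtriv x v)
    (fun a => vtriv_inv Q x y (B y *m a)).
  by move=> Uy v; rewrite mulKVmx ?uB // (vtrivK VB (dU _ Uy)).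
have K2 y : U y -> cancel (fun a => vtriv_inv Q x y (B y *m a))
    (fun v : Q y => invmx (B y) *m vtriv x v).
  by move=> Uy v; rewrite (vtriv_invK VB (dU _ Uy)) mulKmx ?uB.
constructor; apply: (@AdaptedTriv _ _ _ _ _ U (fun y v => invmx (B y) *m vtriv x v)
  (fun y a => vtriv_inv Q x y (B y *m a))) => //.
- move=> y Uy a v w; rewrite (vtriv_linear VB (dU _ Uy)).
  by rewrite mulmxDr -scalemxAr.
- move=> y v w Uy; have [xy _ [BE _]] := UP _ Uy.
  rewrite -[in RHS](K1 _ Uy v) -[in RHS](K1 _ Uy w) [RHS]GE // /lorentz -/J -BE.
  by rewrite !trmx_mul !mulmxA.
- move=> y Uy; have [_ _ [_ <-]] := UP _ Uy.
  by rewrite mulKmx // uB.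
move=> y s Uy; have [xy sBy _] := UP _ Uy.
have nU : \forall z \near y, U z by apply: open_nbhs_nbhs; split => //; case: oU.
apply: iff_trans (smooth_sectionP s xy) _; split=> ss.
  apply: smooth_near_mulmx ss; apply: smooth_near_invmx sBy.
  by rewrite /comp chart_invxx uB.
apply: smooth_fun_ext (smooth_near_mulmx sBy ss).
by apply: filterS nU => z Uz; exact: (mulKVmx (uB _ Uz)).
Qed.

End AtPoint.
End AdaptedExistence.

(** * The gauge of an extension bundle *)

Section ExtensionGauge.
Context {R : realType} {m : nat} {N : manifold 'rV[R]_m.+1}.
Variable Q : quadruple N m.+2.
Hypothesis QP : is_extension Q.
Local Notation J := (gram R m).
Local Notation MX := 'M[R]_m.+2.
Local Notation V := 'cV[R]_m.+2.
Local Notation H := (isotropy R m).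
Implicit Types (x y z : N).

Let QC := ext_connection QP.

(* Since a function defined near [x] may jump away from [x], the Leibniz rule
   applied to an indicator function gives the locality of the connection. *)
Lemma nabla_local x (w : tangent x) (s t : forall y, Q y) :
  smooth_section_at s x -> smooth_section_at t x ->
  (\forall y \near x, s y = t y) -> nabla w s = nabla w t.
Proof.
move=> ss st; rewrite -nbhs_nearE nbhsE => -[U oU UP].
have Ux : U x by case: oU.
pose f y : R^o := if `[< U y >] then 1 else 0.
have nf : \forall y \near x, 1 = f y.
  by apply: filterS (open_nbhs_nbhs oU) => y Uy; rewrite /f asboolT.
have sf : smooth_fun_at f x by exact: smooth_fun_ext nf (smooth_fun_cst (1 : R^o) x).
have df : fun_deriv f w = 0.
  by apply: etrans (fun_deriv_ext w nf (smooth_fun_cst (1 : R^o) x)) _; exact: fun_deriv_cst.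
have E (s' : forall y, Q y) : smooth_section_at s' x -> nabla w (fun y => f y *: s' y) = nabla w
    s'.
  move=> ss'; rewrite (nabla_leibniz QC w sf ss') df scale0r add0r.
  by rewrite -(nbhs_singleton nf) scale1r.
rewrite -(E _ ss) -(E _ st); congr nabla.
apply/functional_extensionality_dep => y; rewrite /f.
by case: asboolP => [/UP ->|_] //; rewrite !scale0r.
Qed.

Variable A : forall x, adapted_triv Q x.

Definition ext_dom x : set N := adom (A x).
Definition ext_triv x y (v : Q y) : V := atriv (A x) v.
Definition ext_inv x y (a : V) : Q y := ainv (A x) y a.

Lemma ext_dom_near x y : ext_dom x y -> \forall z \near y, ext_dom x z.
Proof. by move=> xy; apply: open_nbhs_nbhs; split=> //; case: (adomP (A x)). Qed.

Lemma ext_domxx x : ext_dom x x.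
Proof. by case: (adomP (A x)). Qed.

Lemma ext_inv_linear x y : ext_dom x y -> linear (@ext_inv x y).
Proof.
move=> xy a v w; apply: (can_inj (atrivK xy)).
by rewrite (atriv_linear xy) !(ainvK xy).
Qed.

Lemma ext_inv_smooth x y a : ext_dom x y -> smooth_section_at (fun z => ext_inv x z a) y.
Proof.
move=> xy; apply/(atriv_smooth (fun z => ext_inv x z a) xy).
apply: smooth_fun_ext (smooth_fun_cst a y).
by apply: filterS (ext_dom_near xy) => z xz; exact: esym (ainvK xz a).
Qed.

Definition ext_trans x y : MX :=
  \matrix_(i, j) ext_triv x (ext_inv y y (delta_mx j 0)) i 0.

Lemma ext_transE x y a : ext_dom x y -> ext_trans x y *m a = ext_triv x (ext_inv y y a).
Proof.
move=> xy; apply: (linear_matrix (f := fun a => ext_triv x (ext_inv y y a))) => b v w.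
by rewrite (ext_inv_linear (ext_domxx y)) [LHS](atriv_linear xy).
Qed.

Lemma ext_trans_isotropy x y : ext_dom x y -> H (ext_trans x y).
Proof.
move=> xy; have yy := ext_domxx y; apply/isotropyP; split.
  apply/lorentz_isometryP => v w; rewrite !ext_transE //.
  rewrite [LHS](atriv_lorentz _ _ xy) -(atriv_lorentz _ _ yy).
  by rewrite !(ainvK yy).
by rewrite ext_transE // -(atriv_ell yy) /ext_inv (atrivK yy) [LHS](atriv_ell xy) (atriv_ell yy).
Qed.

Lemma ext_trans1 x : ext_trans x x = 1%:M.
Proof.
apply/matrixP => i j; rewrite mxE [ext_triv _ _](ainvK (ext_domxx x)).
by rewrite !mxE eqxx andbT.
Qed.

(** The frame centered at [y] cancels from the product. As it is chosen without continuity in [y],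
    this is why [gauge] asks smoothness of such products only. *)
Lemma ext_changeE x x' y (v : Q y) : ext_dom x y -> ext_dom x' y ->
  ext_trans x' y *m invmx (ext_trans x y) *m ext_triv x v = ext_triv x' v.
Proof.
move=> xy x'y; have yy := ext_domxx y.
have uT : ext_trans x y \in unitmx by apply: isotropy_unit; exact: ext_trans_isotropy.
have <- : ext_trans x y *m ext_triv y v = ext_triv x v.
  by rewrite ext_transE //; congr (ext_triv x _); exact: atrivK.
rewrite -mulmxA mulKmx // ext_transE //; congr (ext_triv x' _); exact: atrivK.
Qed.

Lemma ext_change_delta x x' y a : ext_dom x y -> ext_dom x' y ->
  ext_trans x' y *m invmx (ext_trans x y) *m a = ext_triv x' (ext_inv x y a).
Proof. by move=> xy x'y; rewrite -(ext_changeE _ xy x'y); congr (_ *m _); apply: esym; exact: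
    ainvK. Qed.

Lemma ext_trans_smooth x x' y : ext_dom x y -> ext_dom x' y ->
  smooth_fun_at (fun z => ext_trans x' z *m invmx (ext_trans x z)) y.
Proof.
move=> xy x'y; apply: smooth_near_mx => i j.
have sj := (atriv_smooth _ x'y).1 (ext_inv_smooth (delta_mx j 0) xy).
have e : \forall z \near y, (ext_triv x' (ext_inv x z (delta_mx j 0))) i 0 =
    (ext_trans x' z *m invmx (ext_trans x z)) i j.
  apply: filterS2 (ext_dom_near xy) (ext_dom_near x'y) => z xz x'z.
  by rewrite -ext_change_delta // -colE mxE.
have sC : smooth_fun_at (fun z => ext_triv x' (ext_inv x z (delta_mx j 0)) i 0 : R^o) y.
  exact: smooth_near_coord i 0 sj.
exact: (smooth_fun_ext e sC).
Qed.

Definition ext_form x y (w : tangent y) : MX :=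
  \matrix_(i, j) ext_triv x (nabla w (fun z => ext_inv x z (delta_mx j 0))) i 0.

Lemma ext_form_delta x y (w : tangent y) j :
  ext_form x w *m delta_mx j 0 = ext_triv x (nabla w (fun z => ext_inv x z (delta_mx j 0))).
Proof. by apply/colP => i; rewrite -colE !mxE. Qed.

Lemma ext_form_linear x y : ext_dom x y -> linear (@ext_form x y).
Proof.
move=> xy a v w; apply: mulmx_delta_eq => j.
rewrite mulmxDl -scalemxAl !ext_form_delta.
by rewrite (nabla_linear QC (ext_inv_smooth (delta_mx j 0) xy)) [LHS](atriv_linear xy).
Qed.

Lemma smooth_sectionD y (s t : forall z, Q z) : smooth_section_at s y -> smooth_section_at t y ->
  smooth_section_at (fun z => s z + t z) y.
Proof.
have yy := ext_domxx y; move=> /(atriv_smooth _ yy) ss /(atriv_smooth _ yy) st.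
apply/(atriv_smooth _ yy); apply: smooth_fun_ext (smooth_nearD ss st).
apply: filterS (ext_dom_near yy) => z yz.
by have := atriv_linear yz 1 (s z) (t z); rewrite !scale1r => ->.
Qed.

Lemma smooth_sectionZ y (f : N -> R^o) (s : forall z, Q z) : smooth_fun_at f y ->
  smooth_section_at s y -> smooth_section_at (fun z => f z *: s z) y.
Proof.
have yy := ext_domxx y; move=> sf /(atriv_smooth _ yy) ss.
apply/(atriv_smooth _ yy); apply: smooth_fun_ext (smooth_nearZ sf ss).
apply: filterS (ext_dom_near yy) => z yz.
have := atriv_linear yz (f z) (s z) 0.
by rewrite (linear_fun0 (atriv_linear yz)) !addr0 => ->.
Qed.

Lemma smooth_section0 y : smooth_section_at (fun z => 0 : Q z) y.
Proof.
have sE := ext_section QP y; have := smooth_sectionZ (smooth_fun_cst (0 : R^o) y) sE.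
by congr smooth_section_at; apply/functional_extensionality_dep => z; rewrite scale0r.
Qed.

Lemma nabla0 y (w : tangent y) : nabla w (fun z => 0 : Q z) = 0.
Proof.
have sE := ext_section QP y; have s0 := smooth_fun_cst (0 : R^o) y.
have := nabla_leibniz QC w s0 sE; rewrite fun_deriv_cst !scale0r addr0 => <-.
by congr nabla; apply/functional_extensionality_dep => z; rewrite scale0r.
Qed.

Lemma nabla_sum y (w : tangent y) (I : Type) (r : seq I) (f : I -> N -> R^o)
    (e : I -> forall z, Q z) :
  (forall j, smooth_fun_at (f j) y) -> (forall j, smooth_section_at (e j) y) ->
  smooth_section_at (fun z => \sum_(j <- r) f j z *: e j z) y /\
  nabla w (fun z => \sum_(j <- r) f j z *: e j z) =
    \sum_(j <- r) (fun_deriv (f j) w *: e j y + f j y *: nabla w (e j)).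
Proof.
move=> sf se; elim: r => [|j r [IH1 IH2]].
  rewrite big_nil (_ : (fun z => _) = fun z => 0 : Q z); last first.
    by apply/functional_extensionality_dep => z; rewrite big_nil.
  by split; [exact: smooth_section0|exact: nabla0].
rewrite big_cons (_ : (fun z => _) = fun z => f j z *: e j z + \sum_(j <- r) f j z *: e j z);
    last first.
  by apply/functional_extensionality_dep => z; rewrite big_cons.
have sj := smooth_sectionZ (sf j) (se j).
split; first exact: smooth_sectionD.
by rewrite (nabla_add QC w sj IH1) IH2 (nabla_leibniz QC w (sf j) (se j)).
Qed.

(** The expansion of [s] in the frame centered at [x] holds only near [y], so [nabla_local] is
    needed before the Leibniz rule can be applied to the sum. *)
Lemma ext_nablaE x y (w : tangent y) (s : forall z, Q z) : ext_dom x y -> smooth_section_at s y ->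
  ext_triv x (nabla w s) = fun_deriv (fun z => ext_triv x (s z)) w + ext_form x w *m ext_triv x
      (s y).
Proof.
move=> xy ss; have sx := (atriv_smooth s xy).1 ss.
pose f j z : R^o := ext_triv x (s z) j 0.
have sf j : smooth_fun_at (f j) y by exact: smooth_near_coord j 0 sx.
pose e j z := ext_inv x z (delta_mx j 0).
have se j : smooth_section_at (e j) y by exact: ext_inv_smooth.
have [s1 n1] := nabla_sum w (index_enum 'I_m.+2) sf se.
have triv_sum z I (r : seq I) (c : I -> R) (v : I -> Q z) : ext_dom x z ->
    ext_triv x (\sum_(j <- r) c j *: v j) = \sum_(j <- r) c j *: ext_triv x (v j).
  move=> xz; pose L : {linear Q z -> V} := HB.pack (@ext_triv x z)
      (GRing.isLinear.Build _ _ _ _ _ (atriv_linear xz)).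
  apply: etrans (linear_sum L _ _ _) _; apply: eq_bigr => j _.
  exact: (linearZ_LR L).
have sE : \forall z \near y, s z = \sum_j f j z *: e j z.
  apply: filterS (ext_dom_near xy) => z xz; apply: (can_inj (atrivK xz)).
  rewrite [RHS]triv_sum // [LHS](matrix_sum_delta); apply: eq_bigr => j _.
  by rewrite big_ord1 [ext_triv _ _](ainvK xz).
rewrite (nabla_local w ss s1 sE) n1 big_split /=.
pose L : {linear Q y -> V} := HB.pack (@ext_triv x y)
    (GRing.isLinear.Build _ _ _ _ _ (atriv_linear xy)).
apply: etrans (linearD L _ _) _; congr (_ + _).
  rewrite [LHS]triv_sum // [RHS](matrix_sum_delta); apply: eq_bigr => j _.
  rewrite big_ord1 [ext_triv _ _](ainvK xy); congr (_ *: _).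
  exact: (der_coord _ j 0 sx).
rewrite [LHS]triv_sum // [ext_triv x (s y)](matrix_sum_delta) mulmx_sumr; apply: eq_bigr => j _.
by rewrite big_ord1 -scalemxAr ext_form_delta.
Qed.

(** The products of the frame sections are the constants of the Gram matrix; the metric property
    differentiates them to zero. *)
Lemma ext_form_skew x y (w : tangent y) : ext_dom x y -> skew_alg (ext_form x w).
Proof.
move=> xy; apply/matrixP => i j; rewrite [RHS]mxE.
pose e j z := ext_inv x z (delta_mx j 0).
have se j' : smooth_section_at (e j') y by exact: ext_inv_smooth.
have := ext_parallel QP w (se i) (se j).
have c : \forall z \near y, (lorentz (delta_mx i 0 : V) (delta_mx j 0 : V) : R^o) = qmetric
    (e i z) (e j z).
  apply: filterS (ext_dom_near xy) => z xz.
  by rewrite -(atriv_lorentz _ _ xz) /e /ext_inv !(ainvK xz).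
rewrite (fun_deriv_ext w c (smooth_fun_cst _ _)) fun_deriv_cst.
rewrite -!(atriv_lorentz _ _ xy).
have eE j' : atriv (A x) (e j' y) = delta_mx j' 0 by exact: (ainvK xy).
rewrite !eE -[atriv _ (nabla w (e i))]ext_form_delta -[atriv _ (nabla w (e j))]ext_form_delta =>
    ->.
rewrite -[LHS]lorentz_delta mulmxDr mulmxDl mxE /lorentz -/J; congr (_ + _).
  by rewrite trmx_mul !mulmxA.
by rewrite !mulmxA.
Qed.

Lemma ext_form_smooth x y v : ext_dom x y ->
  smooth_fun_at (fun z => ext_form x (coord_field y v z)) y.
Proof.
move=> xy; apply: smooth_near_mx => i j.
have sj := nabla_smooth QC v (ext_inv_smooth (delta_mx j 0) xy).
have := smooth_near_coord i 0 ((atriv_smooth _ xy).1 sj).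
by apply: smooth_near_eq => e; rewrite /= mxE.
Qed.

(** Both sides compute, in the frame centered at [x'], the derivative of a frame section centered at
    [x]. *)
Lemma ext_form_gauge x x' y (w : tangent y) : ext_dom x y -> ext_dom x' y ->
  ext_trans x' y *m invmx (ext_trans x y) *m ext_form x w =
  ext_form x' w *m (ext_trans x' y *m invmx (ext_trans x y))
  + fun_deriv (fun z => ext_trans x' z *m invmx (ext_trans x z)) w.
Proof.
move=> xy x'y; apply: mulmx_delta_eq => j.
have sj := ext_inv_smooth (delta_mx j 0) xy.
rewrite -(mulmxA _ (ext_form x w)) ext_form_delta ext_changeE // (ext_nablaE w x'y sj).
rewrite mulmxDl -mulmxA ext_change_delta // addrC; congr (_ + _).
have sT := ext_trans_smooth xy x'y.
have e : \forall z \near y, ext_trans x' z *m invmx (ext_trans x z) *m (delta_mx j 0 : V) =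
    ext_triv x' (ext_inv x z (delta_mx j 0)).
  by apply: filterS2 (ext_dom_near xy) (ext_dom_near x'y) => z xz x'z; exact: ext_change_delta.
apply: etrans (fun_deriv_ext w e (smooth_near_mulmx sT (smooth_near_cst _ _))) _.
exact: (der_mulmxr _ _ sT).
Qed.

(** The distinguished section has constant coordinates [ell], so its derivative is the [ell] column
    of the connection matrix; [ext_mono] then applies. *)
Lemma ext_form_inj x (w : tangent x) : ext_form x w *m ell = 0 -> w = 0.
Proof.
have xx := ext_domxx x; have sE := ext_section QP x.
have e : \forall z \near x, (ell : V) = ext_triv x (qsection Q z).
  by apply: filterS (ext_dom_near xx) => z xz; rewrite [RHS](atriv_ell xz).
have := ext_nablaE w xx sE.
rewrite (fun_deriv_ext w e (smooth_fun_cst _ _)) fun_deriv_cst add0r.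
rewrite -(nbhs_singleton e) => <- n0.
apply: (ext_mono QP); rewrite -[LHS](atrivK xx) -[RHS](atrivK xx); congr (ainv _ _ _).
rewrite (linear_fun0 (nabla_linear QC sE)).
exact: etrans n0 (esym (linear_fun0 (atriv_linear xx))).
Qed.

Definition ext_gauge : gauge N := @Gauge R m N ext_dom ext_trans ext_form
  (fun x => adomP (A x)) ext_trans_isotropy ext_trans1 ext_trans_smooth ext_form_linear
  ext_form_skew ext_form_smooth ext_form_gauge ext_form_inj.

End ExtensionGauge.

(** * The tractor bundle of the frame bundle *)

Section GaugeSections.
Context {R : realType} {m : nat} {N : manifold 'rV[R]_m.+1}.
Variable D : gauge N.
Local Notation H := (isotropy R m).
Local Notation MX := 'M[R]_m.+2.
Local Notation C := (gauge_geometry D).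
Implicit Types (x y : N).

Definition gauge_section x y : C := frame_of D x y 1%:M.

Lemma gauge_section_bproj x y : bproj (gauge_section x y) = y.
Proof. exact: fpt_frame_of. Qed.

Lemma gauge_section_smooth x y : gdom D x y -> smooth_map_at (gauge_section x) y.
Proof.
move=> xy; apply: (@smooth_map2_comp _ _ _ _ N C N _ H (frame_of D x : N -> MX -> C) _ id
    (fun=> 1%:M)).
- exact: findim_mx.
- by apply: frame_of_smooth => //; exact: isotropy1.
- exact: smooth_map_id.
- exact: smooth_fun_cst.
- by apply: near_all => _; exact: isotropy1.
Qed.

Lemma gauge_section_act x y : gdom D x y ->
  bact (gauge_section x y) (gtrans D x y) = gauge_section y y.
Proof.
move=> xy; have Ha := gtrans_isotropy xy; have H1 := @isotropy1 R m.
apply: frame_eq; first by rewrite /= fpt_act !fpt_frame_of.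
rewrite /= fmx_act // /gauge_section /frame_of !fmx_mk ?mulmx1 ?gtrans1 ?invmx1 //.
- by rewrite mulVmx ?isotropy_unit.
- exact: isotropyV.
Qed.

(** Along this section the frame matrix is constantly 1, so M^-1 (dM + Gamma M) reduces to Gamma. *)
Lemma gauge_section_form x (w : tangent x) :
  cform (gauge_section x x) (tangent_map (gauge_section x) w) = gform D x w.
Proof.
have xx := gdomxx D x; have ss := gauge_section_smooth xx.
have px : fpt (gauge_section x x) = x by exact: gauge_section_bproj.
have xs : gdom D x (fpt (gauge_section x x)) by rewrite px.
apply: etrans (frame_formE _ xs) _.
rewrite /frame_form_at frame_ofK //; last exact: isotropy1.
rewrite invmx1 mul1mx mulmx1.
have sp := @frame_proj_smooth _ _ _ D (gauge_section x x).
have st : smooth_fun_at (frame_mx D x : frame_manifold D -> MX) (gauge_section x x) by exact: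
    frame_mx_smooth.
have e1 := @near_all N x (fun y => y = frame_proj (gauge_section x y : frame_manifold D))
  (fun y => esym (gauge_section_bproj x y)).
have pE : tangent_map (@frame_proj _ _ _ D) (tangent_map (gauge_section x) w) = w :> 'rV[R]_m.+1.
  rewrite -(tangent_map_comp w ss sp) (tangent_map_ext w e1 (smooth_map_id x)).
  exact: tangent_map_id.
have e2 : \forall y \near x, 1%:M = frame_mx D x (gauge_section x y).
  by apply: filterS (gdom_near xx) => y xy; rewrite frame_ofK //; exact: isotropy1.
have dE : fun_deriv (frame_mx D x : frame_manifold D -> MX) (tangent_map (gauge_section x) w) = 0.
  apply: etrans (esym (fun_deriv_map w ss st)) _.
  by rewrite (fun_deriv_ext w e2 (smooth_fun_cst _ _)) fun_deriv_cst.
rewrite dE addr0.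
have gE y y' (v : tangent y) (v' : tangent y') : y = y' -> v = v' :> 'rV[R]_m.+1 ->
    gform D x v = gform D x v' by move=> yy; subst y' => ->.
exact: gE px pE.
Qed.

End GaugeSections.

Section ExtensionTractor.
Context {R : realType} {m : nat} {N : manifold 'rV[R]_m.+1}.
Variable Q : quadruple N m.+2.
Hypothesis QP : is_extension Q.
Variable A : forall x, adapted_triv Q x.
Local Notation D := (ext_gauge QP A).
Local Notation C := (gauge_geometry D).
Implicit Types (x y : N).

Definition ext_tractor x (v : Q x) : tractor_fiber C x :=
  fbracket x (gauge_section D x x) (ext_triv A x v).

(** The definition uses at each point the frame centered there, which need not vary smoothly. In the
    frame centered at a fixed [x] the map becomes the identity on coordinates, as
    [ext_tractor_coord] says, and smoothness and connections can be compared. *)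
Lemma ext_tractorE x y (v : Q y) : ext_dom A x y ->
  ext_tractor v = fbracket y (gauge_section D x y) (ext_triv A x v).
Proof.
move=> xy; have yy := ext_domxx A y.
rewrite /ext_tractor -(@gauge_section_act _ _ _ D x y xy).
rewrite (fbracket_act _ (gauge_section_bproj D x y) (ext_trans_isotropy xy)).
congr fbracket; rewrite [_ *m _](ext_transE _ xy); congr (ext_triv A x _); exact: atrivK.
Qed.

Lemma ext_tractor_coord x y (v : Q y) : ext_dom A x y ->
  frame_coord (gauge_section D x y) (ext_tractor v) = ext_triv A x v.
Proof.
by move=> xy; rewrite (ext_tractorE v xy) (fbracketK (gauge_section_bproj D x y)).
Qed.

Lemma ext_tractor_iso : quadruple_iso Q (standard_tractor C).
Proof.
have near_coord x (s : forall y, Q y) : \forall y \near x,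
    ext_triv A x (s y) = frame_coord (gauge_section D x y) (ext_tractor (s y)).
  by apply: filterS (ext_dom_near (ext_domxx A x)) => y xy; rewrite ext_tractor_coord.
have smooth_sec x := @gauge_section_smooth _ _ _ D x x (ext_domxx A x).
have near_proj x := @near_all N x (fun y => bproj (gauge_section D x y) = y)
    (gauge_section_bproj D x).
exists ext_tractor; split.
- move=> x; have xx := ext_domxx A x; have px := gauge_section_bproj D x x; split.
    move=> a v w; rewrite /ext_tractor [ext_triv _ _ _](atriv_linear xx).
    by rewrite fbracketD // fbracketZ.
  exists (fun c => ext_inv A x x (frame_coord (gauge_section D x x) c)) => v.
    by rewrite /ext_tractor (fbracketK px); exact: (atrivK xx).
  by rewrite /ext_tractor [ext_triv _ _ _](ainvK xx) (frame_coordK px).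
- move=> x s; have xx := ext_domxx A x.
  apply: iff_trans (atriv_smooth s xx) _; apply: iff_sym.
  apply: iff_trans (tractor_smoothP (smooth_sec x) (near_proj x) _) _.
  split; apply: smooth_fun_ext; last exact: near_coord.
  by apply: filterS (near_coord x s) => y e; exact: esym e.
- move=> x v w; have xx := ext_domxx A x.
  rewrite [LHS](tractor_metricE _ _ (gauge_section_bproj D x x)).
  exact: atriv_lorentz.
- move=> x w s ss; have xx := ext_domxx A x; have px := gauge_section_bproj D x x.
  have st := (atriv_smooth s xx).1 ss.
  apply: esym; apply: etrans (tractor_nablaE (smooth_sec x) (near_proj x) w
      (smooth_fun_ext (near_coord x s) st)) _.
  rewrite (fun_deriv_ext w (near_coord x s) st) -(nbhs_singleton (near_coord x s)).
  rewrite gauge_section_form /ext_tractor; congr fbracket.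
  exact: esym (ext_nablaE QP w xx ss).
- move=> x; have xx := ext_domxx A x; apply: esym.
  apply: etrans (tractor_sectionE (gauge_section_bproj D x x)) _.
  by congr fbracket; apply: esym; exact: atriv_ell.
Qed.

End ExtensionTractor.

Theorem mainTheorem6 (R : realType) (m : nat) (hm : (2 <= m)%N)
    (N : manifold 'rV[R]_m.+1) (hN : connected [set: N])
    (V : quadruple N m.+2) (hV : lightlike_extension V) :
  exists C : cartan_geometry N,
    quadruple_iso V (standard_tractor C) /\
    forall C' : cartan_geometry N,
      quadruple_iso V (standard_tractor C') -> cartan_iso C C'.
Proof.
(* One trivialization is chosen around every point, with no relation between neighboring choices. *)
have [A] : inhabited (forall x, adapted_triv V x).
  by constructor=> x; exact: inhabited_witness (adapted_triv_exists hV x).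
have isoC := ext_tractor_iso hV A.
exists (gauge_geometry (ext_gauge hV A)); split=> // C' [g gP].
(* Any two geometries that realize [V] have tractor bundles isomorphic through [V]. *)
have [f fP] := isoC; have [f' f'P _] := iso_map_inv fP.
by apply: tractor_iso_cartan_iso; exists (fun x v => g x (f' x v)); exact: iso_map_comp f'P gP.
Qed.
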